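(* Let $\pi:(M,g)\to(B,g')$ be a semi-Riemannian submersion with totally umbilic fibres of dimension $r=\dim M-\dim B$, where $M$ has index $s$ and $B$ has index $s'$. Suppose that the function $R(X,Y,X,Y)$ is constant along fibres for all basic vector fields $X,Y$, that the mean curvature vector field $H$ is parallel in the horizontal bundle along fibres, and that $s-s'\in\{0,r\}$. Then $H$ is a basic vector field if and only if $hR(X,Y)A_XY$ is a basic vector field for all basic vector fields $X,Y$.
   Context: All manifolds are smooth and connected. A semi-Riemannian submersion $\pi:(M,g)\to(B,g')$ between semi-Riemannian manifolds is a smooth surjective map such that $\pi_*$ is onto at every point, the fibres $\pi^{-1}(b)$ are semi-Riemannian (nondegenerate) submanifolds of $M$, and $\pi_*$ preserves scalar products of vectors normal to fibres. Throughout, fibres are connected and $r=\dim M-\dim B>0$. Vectors tangent to fibres are vertical, vectors normal to fibres are horizontal; $v,h$ are the orthogonal projections onto vertical and horizontal parts; $\nabla$ is the Levi-Civita connection of $g$. A vector field on $M$ is basic if it is horizontal and $\pi$-related to a vector field on $B$. O'Neill's tensors: $A_EF=h\nabla_{hE}(vF)+v\nabla_{hE}(hF)$, $T_EF=h\nabla_{vE}(vF)+v\nabla_{vE}(hF)$. With $e_1,\dots,e_r$ a local orthonormal vertical frame, $g(e_i,e_j)=\varepsilon_i\delta_{ij}$, $\varepsilon_i\in\{-1,1\}$, put $H=\sum_i\varepsilon_iT_{e_i}e_i$. The fibres are totally umbilic if $T_UV=\frac1r g(U,V)H$ for all vertical $U,V$. $H$ is parallel in the horizontal bundle along fibres if $h\nabla_UH=0$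 for every vertical $U$. Curvature: $R(E,F)G=\nabla_E\nabla_FG-\nabla_F\nabla_EG-\nabla_{[E,F]}G$, $R(E,F,G,G')=-g(R(E,F)G,G')$. The index of a semi-Riemannian manifold is the number of negative signs in the signature of its metric. *)

(* Defs.v *)
From HB Require Import structures.
From mathcomp Require Import all_boot all_order all_algebra.
From mathcomp Require Import all_classical all_reals all_analysis.

Set Implicit Arguments.
Unset Strict Implicit.
Unset Printing Implicit Defensive.

Import Order.TTheory GRing.Theory Num.Theory numFieldNormedType.Exports.

Local Open Scope classical_set_scope.
Local Open Scope ring_scope.

Definition iter_partial (R : realType) (n : nat) (W : normedModType R)
    (f : 'rV[R]_n -> W) (s : seq 'I_n) : 'rV[R]_n -> W :=
  foldr (fun i h => fun x => 'D_(delta_mx 0 i) h x) f s.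

(* C^infinity smoothness: all iterated partial derivatives exist and are Frechet differentiable at the
   points of U, which is meant to be open. *)
Definition smooth_on (R : realType) (n : nat) (W : normedModType R)
    (U : set 'rV[R]_n) (f : 'rV[R]_n -> W) : Prop :=
  forall (s : seq 'I_n) x, U x -> differentiable (iter_partial f s) x.

(* The maps are total; only their values on cdom, resp. on cmap @` cdom, are
   meaningful. *)
Record chart (R : realType) (n : nat) (T : topologicalType) := Chart {
  cdom : set T;
  cmap : T -> 'rV[R]_n;
  cinv : 'rV[R]_n -> T;
  cdom_open : open cdom;
  cimage_open : open (cmap @` cdom);
  cmapK : forall p, cdom p -> cinv (cmap p) = p;
  cmap_continuous : {within cdom, continuous cmap};
  cinv_continuous : {within cmap @` cdom, continuous cinv}
}.

(* The atlas need not be maximal: it generates the smooth structure.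
   The field chart_at selects one chart around every point; it provides the
   basis in which the tangent space at that point is represented below. *)
Record manifold (R : realType) (n : nat) := Manifold {
  mcarrier :> topologicalType;
  atlas : set (chart R n mcarrier);
  chart_at : mcarrier -> chart R n mcarrier;
  chart_at_atlas : forall p, atlas (chart_at p);
  chart_at_dom : forall p, cdom (chart_at p) p;
  atlas_compatible : forall c d, atlas c -> atlas d ->
    smooth_on (cmap c @` (cdom c `&` cdom d)) (cmap d \o cinv c);
  manifold_hausdorff : hausdorff_space mcarrier;
  manifold_second_countable : @second_countable mcarrier;
  manifold_nonempty : [set: mcarrier] !=set0;
  manifold_connected : connected [set: mcarrier]
}.

Definition smooth_fun (R : realType) (n : nat) (M : manifold R n)
    (W : normedModType R) (U : set M) (f : M -> W) : Prop :=
  forall c, atlas c -> smooth_on (cmap c @` (cdom c `&` U)) (f \o cinv c).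

(* The tangent space of M at p is 'rV[R]_n: the row vector v stands for the
    tangent vector whose components in the chart chart_at p are those of v.
    Thus v |-> dfun f p v is the differential of f at p. *)
Definition dfun (R : realType) (n : nat) (M : manifold R n)
    (W : normedModType R) (f : M -> W) (p : M) : {linear 'rV[R]_n -> W} :=
  'd (f \o cinv (chart_at p)) (cmap (chart_at p) p).

Definition smooth_map (R : realType) (m n : nat) (M : manifold R m)
    (B : manifold R n) (pi : M -> B) : Prop :=
  continuous pi /\
  forall d, atlas d -> smooth_fun (pi @^-1` cdom d) (cmap d \o pi).

Definition tangent_map (R : realType) (m n : nat) (M : manifold R m)
    (B : manifold R n) (pi : M -> B) (p : M) : {linear 'rV[R]_m -> 'rV[R]_n} :=
  dfun (cmap (chart_at (pi p)) \o pi) p.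

Definition vfield (R : realType) (n : nat) (M : manifold R n) : Type :=
  M -> 'rV[R]_n.

Definition vapp (R : realType) (n : nat) (M : manifold R n)
    (W : normedModType R) (E : vfield M) (f : M -> W) : M -> W :=
  fun p => dfun f p (E p).

(* vapp E (cmap d) is the row of components of E in the chart d. *)
Definition smooth_vf (R : realType) (n : nat) (M : manifold R n)
    (U : set M) (E : vfield M) : Prop :=
  forall d, atlas d -> smooth_fun (cdom d `&` U) (vapp E (cmap d)).

(* [E, F] f = E (F f) - F (E f), where f runs over the coordinate functions of
   the chart used to represent the tangent space at p. *)
Definition bracket (R : realType) (n : nat) (M : manifold R n)
    (E F : vfield M) : vfield M :=
  fun p => let x := cmap (chart_at p) in
    vapp E (vapp F x) p - vapp F (vapp E x) p.

Definition mxform (R : realType) (n : nat) (G : 'M[R]_n) (u v : 'rV[R]_n) : R :=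
  (u *m G *m v^T) 0 0.

(* gram g p is the Gram matrix of the scalar product at p in the basis of the
   tangent space at p given by chart_at p. *)
Record metric (R : realType) (n : nat) (M : manifold R n) := Metric {
  gram :> M -> 'M[R]_n;
  metric_sym : forall p, (gram p)^T = gram p;
  metric_nondegenerate : forall p, gram p \in unitmx;
  metric_smooth : forall (U : set M) (E F : vfield M), open U ->
    smooth_vf U E -> smooth_vf U F ->
    smooth_fun U (fun p => mxform (gram p) (E p) (F p))
}.

(* Every tangent space has an orthonormal basis (the rows of P) in which exactly
   s vectors have square -1. *)
Definition has_index (R : realType) (n : nat) (M : manifold R n)
    (g : metric M) (s : nat) : Prop :=
  forall p, exists (P : 'M[R]_n) (neg : {set 'I_n}),
    P *m g p *m P^T = diag_mx (\row_i (-1) ^+ (i \in neg)) /\ #|neg| = s.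

(* The Levi-Civita connection is characterised as the torsion-free metric
   connection, the operator nabla being left abstract.  It acts on locally defined vector fields: a vector field on an
   open set U is a function on M whose values outside U are irrelevant. *)
Record levi_civita (R : realType) (n : nat) (M : manifold R n) (g : metric M)
    (nabla : vfield M -> vfield M -> vfield M) : Prop := LeviCivita {
  nabla_smooth : forall (U : set M) E F, open U ->
    smooth_vf U E -> smooth_vf U F -> smooth_vf U (nabla E F);
  nabla_addl : forall (U : set M) E E' F, open U ->
    smooth_vf U E -> smooth_vf U E' -> smooth_vf U F ->
    forall p, U p ->
      nabla (fun q => E q + E' q) F p = nabla E F p + nabla E' F p;
  nabla_scalel : forall (U : set M) (f : M -> R) E F, open U ->
    smooth_fun U f -> smooth_vf U E -> smooth_vf U F ->
    forall p, U p -> nabla (fun q => f q *: E q) F p = f p *: nabla E F p;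
  nabla_addr : forall (U : set M) E F F', open U ->
    smooth_vf U E -> smooth_vf U F -> smooth_vf U F' ->
    forall p, U p ->
      nabla E (fun q => F q + F' q) p = nabla E F p + nabla E F' p;
  nabla_leibniz : forall (U : set M) (f : M -> R) E F, open U ->
    smooth_fun U f -> smooth_vf U E -> smooth_vf U F ->
    forall p, U p ->
      nabla E (fun q => f q *: F q) p = vapp E f p *: F p + f p *: nabla E F p;
  nabla_torsion_free : forall (U : set M) E F, open U ->
    smooth_vf U E -> smooth_vf U F ->
    forall p, U p -> nabla E F p - nabla F E p = bracket E F p;
  nabla_metric : forall (U : set M) E F G, open U ->
    smooth_vf U E -> smooth_vf U F -> smooth_vf U G ->
    forall p, U p ->
      vapp E (fun q => mxform (g q) (F q) (G q)) p =
        mxform (g p) (nabla E F p) (G p) + mxform (g p) (F p) (nabla E G p)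
}.

Definition curvature (R : realType) (n : nat) (M : manifold R n)
    (nabla : vfield M -> vfield M -> vfield M) (E F G : vfield M) : vfield M :=
  fun p => nabla E (nabla F G) p - nabla F (nabla E G) p
           - nabla (bracket E F) G p.

Definition curvature4 (R : realType) (n : nat) (M : manifold R n)
    (g : metric M) (nabla : vfield M -> vfield M -> vfield M)
    (E F G G' : vfield M) : M -> R :=
  fun p => - mxform (g p) (curvature nabla E F G p) (G' p).

Section Submersion.
Variables (R : realType) (m n : nat) (M : manifold R m) (B : manifold R n).
Variables (g : metric M) (pi : M -> B).

(* As in mxalgebra, a subspace of T_p M is the row space of a square matrix.
   The tangent space of a fibre of a submersion is the kernel of pi_*. *)
Definition vertical_mx (p : M) : 'M[R]_m := kermx (lin1_mx (tangent_map pi p)).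

Definition horizontal_mx (p : M) : 'M[R]_m := kermx (g p *m (vertical_mx p)^T).

Definition vproj (p : M) (u : 'rV[R]_m) : 'rV[R]_m :=
  u *m proj_mx (vertical_mx p) (horizontal_mx p).

Definition hproj (p : M) (u : 'rV[R]_m) : 'rV[R]_m :=
  u *m proj_mx (horizontal_mx p) (vertical_mx p).

Definition vpart (E : vfield M) : vfield M := fun p => vproj p (E p).
Definition hpart (E : vfield M) : vfield M := fun p => hproj p (E p).

Definition vertical_on (U : set M) (E : vfield M) : Prop :=
  forall p, U p -> (E p <= vertical_mx p)%MS.

Definition horizontal_on (U : set M) (E : vfield M) : Prop :=
  forall p, U p -> (E p <= horizontal_mx p)%MS.

Definition constant_along_fibres (f : M -> R) : Prop :=
  forall p q, pi p = pi q -> f p = f q.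

Definition basic (X : vfield M) : Prop :=
  [/\ smooth_vf setT X, horizontal_on setT X &
      exists2 X' : vfield B, smooth_vf setT X' &
        forall p, tangent_map pi p (X p) = X' (pi p)].

Variable nabla : vfield M -> vfield M -> vfield M.

Definition oneillA (E F : vfield M) : vfield M :=
  fun p => hproj p (nabla (hpart E) (vpart F) p)
           + vproj p (nabla (hpart E) (hpart F) p).

Definition oneillT (E F : vfield M) : vfield M :=
  fun p => hproj p (nabla (vpart E) (vpart F) p)
           + vproj p (nabla (vpart E) (hpart F) p).

(* H is the vector field \sum_i eps_i T_{e_i} e_i, for any local orthonormal
   vertical frame e. *)
Definition mean_curvature (r : nat) (H : vfield M) : Prop :=
  smooth_vf setT H /\
  forall (U : set M) (e : 'I_r -> vfield M) (eps : 'I_r -> R), open U ->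
    (forall i, smooth_vf U (e i)) -> (forall i, vertical_on U (e i)) ->
    (forall i, eps i = 1 \/ eps i = - 1) ->
    (forall i j p, U p -> mxform (g p) (e i p) (e j p) = eps i *+ (i == j)) ->
    forall p, U p -> H p = \sum_(i < r) eps i *: oneillT (e i) (e i) p.

Definition totally_umbilic_fibres (r : nat) (H : vfield M) : Prop :=
  forall (U : set M) (E F : vfield M), open U ->
    smooth_vf U E -> smooth_vf U F -> vertical_on U E -> vertical_on U F ->
    forall p, U p ->
      oneillT E F p = (r%:R^-1 * mxform (g p) (E p) (F p)) *: H p.

Definition parallel_along_fibres (H : vfield M) : Prop :=
  forall (U : set M) (E : vfield M), open U ->
    smooth_vf U E -> vertical_on U E ->
    forall p, U p -> hproj p (nabla E H p) = 0.

End Submersion.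

Record semi_riemannian_submersion (R : realType) (m n : nat)
    (M : manifold R m) (B : manifold R n) (g : metric M) (g' : metric B)
    (pi : M -> B) : Prop := SemiRiemannianSubmersion {
  submersion_smooth : smooth_map pi;
  submersion_surjective : forall b, exists p, pi p = b;
  submersion_onto : forall p w, exists u, tangent_map pi p u = w;
  submersion_fibre_nondegenerate : forall p (u : 'rV[R]_m), (u <= vertical_mx pi p)%MS ->
    (forall v : 'rV[R]_m, (v <= vertical_mx pi p)%MS -> mxform (g p) u v = 0) ->
    u = 0;
  submersion_isometric : forall p (u v : 'rV[R]_m),
    (u <= horizontal_mx g pi p)%MS -> (v <= horizontal_mx g pi p)%MS ->
    mxform (g' (pi p)) (tangent_map pi p u) (tangent_map pi p v)
    = mxform (g p) u v
}.

(* Main.v *)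
(* A horizontal field [W] is basic if and only if [g W Z] is constant along the fibres for every basic
   [Z]; call such functions fibrewise.  By O'Neill's formula, [R (X, Y, X, Y)] differs from [3 |A_X Y|^2]
   by the corresponding curvature of [B], so the hypothesis makes [|A_X Y|^2], and by polarisation
   [g (A_X Y) (A_X Z)], fibrewise.  Umbilicity, skew-symmetry of the curvature and Bianchi's identity then
   give
     g (R X Y (A_X Y)) Z = g (nabla_Z (A_X Y)) (A_X Y) - g (A_X (h nabla_Z Y)) (A_X Y)
       - g (A_Y (h nabla_Z X)) (A_Y X) - (|A_X Y|^2 g H Z + g (A_Y Z) (A_Y X) g H X
       + g (A_X Z) (A_X Y) g H Y) / r,
   where the first term is half the derivative of [|A_X Y|^2] along [Z].  If [H] is basic, every term on
   the right is fibrewise.  Conversely, [Z = X] yields [2 |A_X Y|^2 g H X / r], so [g H X] is constant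
   along every fibre on which [|A_X Y|^2] is nonzero for some [Y].  On a fibre where it vanishes for every
   [Y], the index condition makes the fibre metric definite, hence [A_X Y = 0]; as [h nabla_V H = 0], the
   derivative of [g H X] along a vertical [V] is [g H (nabla_X V) = - g (A_X H) V = 0], and connectedness
   of the fibre concludes.  The index condition also makes [H] horizontal: a non-isotropic vertical field
   exists, so umbilicity exhibits [H] as a multiple of a horizontal vector. *)

Require Import Defs.
From mathcomp Require Import all_boot all_order all_algebra.
From mathcomp Require Import all_classical all_reals all_analysis.
From mathcomp Require Import ring lra zify.

Set Implicit Arguments.
Unset Strict Implicit.
Unset Printing Implicit Defensive.

Import Order.TTheory GRing.Theory Num.Theory numFieldNormedType.Exports.
Local Open Scope classical_set_scope.
Local Open Scope ring_scope.

(** * Smooth functions on open sets *)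

(** Two facts about submersions carry the analysis: a smooth function that is constant along the
    fibres comes from a smooth function on [B], and one whose vertical derivatives vanish is
    constant on each connected fibre. Both rest on [submersion_slice], which corrects a point along
    a fixed right inverse of the differential and bounds the correction linearly. That bound
    transfers first-order estimates between source and target; higher smoothness follows by
    induction. Tangent vectors are extended to fields on the whole of [M], so that the axioms of the
    connection are applied on [setT]; a statement at one point is reached by choosing a global basic
    or vertical field with the required value there. The connection of [B] does not appear: its role
    is played by [h nabla_X Y], which Koszul's formula shows to be basic. The obstacle in the
    converse is that [|A_X Y|^2 = 0] need not mean [A_X Y = 0] for an indefinite fibre metric. A
    dimension count shows that a nonzero isotropic vertical vector forces [0 < s - s' < r], which
    the index condition excludes. *)

Section Calculus.
Context {R : realType}.

Lemma near_eq_differentiable (V W : normedModType R) (f g : V -> W) (x : V) :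
  (\forall y \near x, f y = g y) -> differentiable f x -> differentiable g x.
Proof.
move=> fg /diff_locallyP [dc /eqaddoP df].
have fgx : f x = g x by exact: nbhs_singleton fg.
have fg0 : \forall h \near 0, f (h + x) = g (h + x).
  by move: fg; rewrite (near_shift 0) subr0; apply: filterS => h /=.
have key : g \o shift x = cst (g x) + 'd f x +o_ 0 id.
  apply/eqaddoP => e e0; have := df e e0; apply: filter_app.
  apply: filterS fg0 => h /= fgh.
  by rewrite !fctE /= fgh fgx.
apply/diff_locallyP; have -> := diff_unique dc key.
by split.
Qed.

Lemma differentiable_rowP (V : normedModType R) k (f : V -> 'rV[R]_k) (x : V) :
  differentiable f x <-> forall j, differentiable (fun y => f y 0 j) x.
Proof.
split=> [df j|df].
  exact: (differentiable_comp df (differentiable_coord _ _ _)).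
have -> : f = \sum_(j < k) (fun y => f y 0 j *: (delta_mx 0 j : 'rV[R]_k)).
  by apply/funext => y; rewrite fct_sumE [LHS]row_sum_delta.
by apply: differentiable_sum => j; apply: differentiableZl.
Qed.

Lemma diff_coord (V : normedModType R) k (f : V -> 'rV[R]_k) (x v : V) j :
  differentiable f x -> ('d f x v) 0 j = 'd (fun y => f y 0 j) x v.
Proof.
move=> df.
rewrite -!deriveE//; last by move/differentiable_rowP: df.
rewrite derive_mx ?mxE//; exact: diff_derivable.
Qed.

Lemma diff_partial (n : nat) (W : normedModType R) (f : 'rV[R]_n -> W) (x v : 'rV[R]_n) :
  differentiable f x -> 'd f x v = \sum_i v 0 i *: 'D_(delta_mx 0 i) f x.
Proof.
move=> df; rewrite {1}[v]row_sum_delta linear_sum; apply: eq_bigr => i _.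
by rewrite linearZ /= -deriveE.
Qed.

Lemma near_openP (T : topologicalType) (x : T) (P : set T) :
  (\forall y \near x, P y) <-> exists U, [/\ open U, U x & U `<=` P].
Proof.
split=> [|[U [oU Ux UP]]]; last by apply: filterS UP _; exact: open_nbhs_nbhs.
by move=> xP; have : nbhs x P by []; rewrite nbhsE => -[U [oU Ux] UP]; exists U.
Qed.

Lemma near_all (T : topologicalType) (x : T) (P : set T) :
  (forall y, P y) -> \forall y \near x, P y.
Proof. exact: nearW. Qed.

Lemma near_forall (T : topologicalType) (I : finType) (x : T) (P : I -> set T) :
  (forall i, \forall y \near x, P i y) -> \forall y \near x, forall i, P i y.
Proof. by move=> xP; apply: filter_forall. Qed.

(** Induction on a finite order replaces higher Leibniz and chain formulas: the first partial
    derivatives of a product, an inverse or a composite are built from the given functions and their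
    own first partials, so closure passes from order [k] to [k.+1]. *)
Fixpoint Ck (k n : nat) (W : normedModType R) (U : set 'rV[R]_n)
    (f : 'rV[R]_n -> W) : Prop :=
  (forall x, U x -> differentiable f x) /\
  if k is k'.+1 then forall i, Ck k' U ('D_(delta_mx 0 i) f) else True.

Lemma Ck_eq k n (W : normedModType R) (U : set 'rV[R]_n) (f g : 'rV[R]_n -> W) :
  open U -> (forall x, U x -> f x = g x) -> Ck k U f -> Ck k U g.
Proof.
move=> oU; elim: k f g => [|k IH] f g fg /= [df dk].
  split=> // x Ux; apply: near_eq_differentiable (df _ Ux).
  by near do apply: fg; apply: open_nbhs_nbhs.
have fgn x : U x -> \forall y \near x, f y = g y.
  by move=> Ux; near do apply: fg; apply: open_nbhs_nbhs.
split=> [x Ux|i]; first exact: near_eq_differentiable (fgn _ Ux) (df _ Ux).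
apply: IH (dk i) => x Ux; apply: near_eq_derive; exact: fgn.
Unshelve. all: by end_near. Qed.

Lemma Ck_differentiable k n (W : normedModType R) (U : set 'rV[R]_n)
    (f : 'rV[R]_n -> W) x : Ck k U f -> U x -> differentiable f x.
Proof. by case: k => [|k] [df _]; exact: df. Qed.

Lemma CkS k n (W : normedModType R) (U : set 'rV[R]_n) (f : 'rV[R]_n -> W) :
  Ck k.+1 U f -> Ck k U f.
Proof.
elim: k f => [|k IH] f; first by case.
by move=> [df dk]; split=> // i; apply: IH.
Qed.

Lemma Ck_subset k n (W : normedModType R) (U V : set 'rV[R]_n) (f : 'rV[R]_n -> W) :
  V `<=` U -> Ck k U f -> Ck k V f.
Proof.
move=> VU; elim: k f => [|k IH] f [df dk]; (split=> [x /VU|]; first exact: df) => //.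
by move=> i; exact/IH/dk.
Qed.

Lemma smooth_onP n (W : normedModType R) (U : set 'rV[R]_n) (f : 'rV[R]_n -> W) :
  smooth_on U f <-> forall k, Ck k U f.
Proof.
(* The last index of the list is differentiated first, so lists are taken apart from the right to
   match the recursion of [Ck]. *)
have iter_rcons (s : seq 'I_n) i (h : 'rV[R]_n -> W) :
    iter_partial h (rcons s i) = iter_partial ('D_(delta_mx 0 i) h) s.
  by rewrite /iter_partial foldr_rcons.
split=> [sf k|sf s x Ux].
  elim: k f sf => [|k IH] f sf; (split; first exact: (sf [::])) => // i.
  by apply: IH => s x Ux; rewrite -iter_rcons; exact: sf.
elim/last_ind: s f sf => [|s i IH] f sf; first by have [df _] := sf 0%N; exact: df.
by rewrite iter_rcons; apply: IH => k; have [_] := sf k.+1; exact.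
Qed.

Lemma Ck_cst k n (W : normedModType R) (U : set 'rV[R]_n) (a : W) :
  Ck k U (fun _ : 'rV[R]_n => a).
Proof.
elim: k a => [|k IH] a /=; split=> // i.
suff -> : 'D_(delta_mx 0 i) (fun _ : 'rV[R]_n => a) = fun=> 0 by exact: IH.
by apply/funext => x; exact: derive_cst.
Qed.

Lemma Ck_add k n (W : normedModType R) (U : set 'rV[R]_n) (f g : 'rV[R]_n -> W) :
  open U -> Ck k U f -> Ck k U g -> Ck k U (fun x => f x + g x).
Proof.
move=> oU; elim: k f g => [|k IH] f g [df dfk] [dg dgk];
  (split=> [x Ux|]; first by apply: (@differentiableD _ _ _ f g); [exact: df|exact: dg]) => // i.
apply: Ck_eq oU _ (IH _ _ (dfk i) (dgk i)) => x Ux.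
by rewrite -(@deriveD _ _ _ f g)//; apply: diff_derivable; [exact: df|exact: dg].
Qed.

Lemma Ck_mul k n (U : set 'rV[R]_n) (f g : 'rV[R]_n -> R) :
  open U -> Ck k U f -> Ck k U g -> Ck k U (fun x => f x * g x).
Proof.
move=> oU; elim: k f g => [|k IH] f g Cf Cg; have [df dfk] := Cf; have [dg dgk] := Cg;
  (split=> [x Ux|]; first by apply: (@differentiableM _ _ f g); [exact: df|exact: dg]) => // i.
apply: (@Ck_eq _ _ _ _ (fun x => f x * 'D_(delta_mx 0 i) g x + g x * 'D_(delta_mx 0 i) f x)) => // [x Ux|].
  by rewrite (@deriveM _ _ f g)//; apply: diff_derivable; [exact: df|exact: dg].
by apply: Ck_add => //; apply: IH; [exact: CkS|exact: dgk|exact: CkS|exact: dfk].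
Qed.

Lemma Ck_inv k n (U : set 'rV[R]_n) (f : 'rV[R]_n -> R) :
  open U -> (forall x, U x -> f x != 0) -> Ck k U f -> Ck k U (fun x => (f x)^-1).
Proof.
move=> oU f0; elim: k => [|k IH] Cf; have [df dfk] := Cf;
  (split=> [x Ux|]; first by apply: differentiableV; [exact: df|exact: f0]) => // i.
apply: (@Ck_eq _ _ _ _ (fun x => (-1 * ((f x)^-1 * (f x)^-1)) * 'D_(delta_mx 0 i) f x)) => // [x Ux|].
  rewrite (@deriveV _ _ f)//; [|exact: f0|apply: diff_derivable; exact: df].
  by rewrite mulN1r /GRing.scale /= -exprVn expr2.
apply: Ck_mul => //; last exact: dfk.
apply: Ck_mul => //; first exact: Ck_cst.
by apply: Ck_mul => //; apply: IH; exact: CkS.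
Qed.

Lemma Ck_sum k n (W : normedModType R) (U : set 'rV[R]_n) (I : Type) (r : seq I)
    (P : pred I) (f : I -> 'rV[R]_n -> W) :
  open U -> (forall i, P i -> Ck k U (f i)) -> Ck k U (fun x => \sum_(i <- r | P i) f i x).
Proof.
move=> oU Cf; elim: r => [|i r IH].
  by apply: Ck_eq oU _ (Ck_cst k U 0) => x _; rewrite big_nil.
case: (boolP (P i)) => Pi.
  by apply: Ck_eq oU _ (Ck_add oU (Cf _ Pi) IH) => x _; rewrite big_cons Pi.
by apply: Ck_eq oU _ IH => x _; rewrite big_cons (negbTE Pi).
Qed.

Lemma Ck_rowP k n p (U : set 'rV[R]_n) (f : 'rV[R]_n -> 'rV[R]_p) :
  open U -> Ck k U f <-> forall j, Ck k U (fun x => f x 0 j).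
Proof.
move=> oU; split=> [|]; elim: k f => [|k IH] f Cf.
- by move=> j; split=> // x Ux; have [df _] := Cf; move/differentiable_rowP: (df _ Ux).
- move=> j; split=> [x Ux|i].
    by have [df _] := Cf; move/differentiable_rowP: (df _ Ux).
  have [df /(_ i)/IH/(_ j) h] := Cf; apply: Ck_eq oU _ h => x Ux.
  by rewrite derive_mx ?mxE//; apply: diff_derivable; exact: df.
- by split=> // x Ux; apply/differentiable_rowP => j; exact: Ck_differentiable (Cf j) Ux.
- have df x : U x -> differentiable f x.
    by move=> Ux; apply/differentiable_rowP => j; exact: Ck_differentiable (Cf j) Ux.
  split=> // i; apply: IH => j; have [_ /(_ i) h] := Cf j; apply: Ck_eq oU _ h => x Ux.
  by rewrite derive_mx ?mxE//; apply: diff_derivable; exact: df.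
Qed.

Lemma Ck_comp k n p (U : set 'rV[R]_n) (V : set 'rV[R]_p) (phi : 'rV[R]_n -> 'rV[R]_p)
    (f : 'rV[R]_p -> R) : open U -> (forall x, U x -> V (phi x)) ->
  Ck k U phi -> Ck k V f -> Ck k U (f \o phi).
Proof.
move=> oU UV; elim: k f => [|k IH] f Cphi Cf; have [dphi _] := Cphi; have [df dfk] := Cf.
  by split=> // x Ux; apply: differentiable_comp; [exact: dphi|exact/df/UV].
split=> [x Ux|i]; first by apply: differentiable_comp; [exact: dphi|exact/df/UV].
apply: (@Ck_eq _ _ _ _ (fun x => \sum_j 'D_(delta_mx 0 i) (fun y => phi y 0 j) x
          * ('D_(delta_mx 0 j) f \o phi) x)) => // [x Ux|].
  rewrite deriveE; last by apply: differentiable_comp; [exact: dphi|exact/df/UV].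
  rewrite diff_comp/=; [|exact: dphi|exact/df/UV].
  rewrite diff_partial; last exact/df/UV.
  apply: eq_bigr => j _; rewrite diff_coord; last exact: dphi.
  rewrite -deriveE//; have := dphi x Ux; move/differentiable_rowP; exact.
apply: Ck_sum => // j _; apply: Ck_mul => //; last by apply: IH; [exact: CkS|exact: dfk].
by have /(Ck_rowP _ _ oU)/(_ j) [_] := Cphi; exact.
Qed.



(** One neighbourhood serves all orders of derivative. Asking for it, rather than for derivatives at
    [x] alone, makes the property open and stable under equality near [x]. *)
Definition smooth_at n (W : normedModType R) (f : 'rV[R]_n -> W) (x : 'rV[R]_n) :=
  \forall y \near x, forall s, differentiable (iter_partial f s) y.

Lemma smooth_atP n (W : normedModType R) (f : 'rV[R]_n -> W) (x : 'rV[R]_n) :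
  smooth_at f x <-> exists U, [/\ open U, U x & forall k, Ck k U f].
Proof.
split=> [|[U [oU Ux /smooth_onP sf]]].
  move=> /near_openP [U [oU Ux Uf]]; exists U; split=> //.
  by apply/smooth_onP => s y /Uf; exact.
rewrite /smooth_at; near=> y => s; apply: sf; near: y; exact: open_nbhs_nbhs.
Unshelve. all: by end_near. Qed.

Lemma smooth_onE n (W : normedModType R) (U : set 'rV[R]_n) (f : 'rV[R]_n -> W) :
  open U -> smooth_on U f <-> forall x, U x -> smooth_at f x.
Proof.
move=> oU; split=> [/smooth_onP sf x Ux|sf s x /sf]; last first.
  by move=> /nbhs_singleton; exact.
by apply/smooth_atP; exists U.
Qed.

Lemma smooth_at_near n (W : normedModType R) (f : 'rV[R]_n -> W) x :
  smooth_at f x -> \forall y \near x, smooth_at f y.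
Proof. by move=> /nbhs_interior. Qed.

Lemma smooth_at_eq n (W : normedModType R) (f g : 'rV[R]_n -> W) x :
  (\forall y \near x, f y = g y) -> smooth_at f x -> smooth_at g x.
Proof.
move=> /near_openP [V [oV Vx fg]] /smooth_atP [U [oU Ux Uf]].
apply/smooth_atP; exists (U `&` V); split=> //; first exact: openI.
move=> k; apply: (@Ck_eq _ _ _ _ f); first exact: openI.
  by move=> y [_ /fg].
by apply: Ck_subset (Uf k) => y [].
Qed.

Lemma smooth_at_differentiable n (W : normedModType R) (f : 'rV[R]_n -> W) x :
  smooth_at f x -> differentiable f x.
Proof. by move=> /nbhs_singleton /(_ [::]). Qed.

Lemma smooth_at_partial n (W : normedModType R) (f : 'rV[R]_n -> W) i x :
  smooth_at f x -> smooth_at ('D_(delta_mx 0 i) f) x.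
Proof.
move=> /smooth_atP [U [oU Ux Uf]]; apply/smooth_atP; exists U; split=> // k.
by have [_] := Uf k.+1; exact.
Qed.

Lemma smooth_at_partials n (W : normedModType R) (f : 'rV[R]_n -> W) x :
  (\forall y \near x, differentiable f y) ->
  (forall i, smooth_at ('D_(delta_mx 0 i) f) x) -> smooth_at f x.
Proof.
move=> /near_openP [V [oV Vx df]] pf.
have : forall i, exists U, [/\ open U, U x & forall k, Ck k U ('D_(delta_mx 0 i) f)].
  by move=> i; exact/smooth_atP.
move=> /choice [U hU]; apply/smooth_atP.
have : nbhs x (V `&` [set y | forall i, U i y]).
  apply: filterI; first exact: open_nbhs_nbhs.
  by apply: (@near_forall _ _ x U) => i; have [oU Ux _] := hU i; apply: open_nbhs_nbhs.
move=> /near_openP [V' [oV' V'x V'U]]; exists V'; split=> // k.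
have dV' y : V' y -> differentiable f y by move=> /V'U [/df].
case: k => [|k]; split=> // i; have [_ _ /(_ k)] := hU i.
by apply: Ck_subset => y /V'U [_]; exact.
Qed.

Lemma smooth_at_lift2 n (W1 W2 W3 : normedModType R) (f : 'rV[R]_n -> W1)
    (g : 'rV[R]_n -> W2) (h : 'rV[R]_n -> W3) x :
  (forall k (U : set 'rV[R]_n), open U -> Ck k U f -> Ck k U g -> Ck k U h) ->
  smooth_at f x -> smooth_at g x -> smooth_at h x.
Proof.
move=> fgh /smooth_atP [U [oU Ux Uf]] /smooth_atP [V [oV Vx Vg]].
have oUV := openI oU oV.
apply/smooth_atP; exists (U `&` V); split=> // k; apply: fgh => //.
  by apply: Ck_subset (Uf k) => y [].
by apply: Ck_subset (Vg k) => y [].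
Qed.

Lemma smooth_at_cst n (W : normedModType R) (a : W) x :
  smooth_at (fun _ : 'rV[R]_n => a) x.
Proof. by apply/smooth_atP; exists setT; split=> // [|k]; [exact: openT|exact: Ck_cst]. Qed.

Lemma smooth_atD n (W : normedModType R) (f g : 'rV[R]_n -> W) x :
  smooth_at f x -> smooth_at g x -> smooth_at (fun y => f y + g y) x.
Proof. by apply: smooth_at_lift2 => k U; exact: Ck_add. Qed.

Lemma smooth_atM n (f g : 'rV[R]_n -> R) x :
  smooth_at f x -> smooth_at g x -> smooth_at (fun y => f y * g y) x.
Proof. by apply: smooth_at_lift2 => k U; exact: Ck_mul. Qed.

Lemma smooth_at_sum n (W : normedModType R) (I : Type) (r : seq I) (P : pred I)
    (f : I -> 'rV[R]_n -> W) x :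
  (forall i, P i -> smooth_at (f i) x) -> smooth_at (fun y => \sum_(i <- r | P i) f i y) x.
Proof.
move=> sf; elim: r => [|i r IH].
  by apply: smooth_at_eq (smooth_at_cst 0 x); apply: near_all => y; rewrite big_nil.
case: (boolP (P i)) => Pi.
  apply: smooth_at_eq (smooth_atD (sf i Pi) IH).
  by apply: near_all => y; rewrite big_cons Pi.
by apply: smooth_at_eq IH; apply: near_all => y; rewrite big_cons (negbTE Pi).
Qed.

Lemma smooth_at_prod n (I : Type) (r : seq I) (P : pred I) (f : I -> 'rV[R]_n -> R) x :
  (forall i, P i -> smooth_at (f i) x) -> smooth_at (fun y => \prod_(i <- r | P i) f i y) x.
Proof.
move=> sf; elim: r => [|i r IH].
  apply: smooth_at_eq (@smooth_at_cst n R 1 x).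
  by apply: near_all => y; rewrite big_nil.
case: (boolP (P i)) => Pi.
  apply: smooth_at_eq (smooth_atM (sf i Pi) IH).
  by apply: near_all => y; rewrite big_cons Pi.
by apply: smooth_at_eq IH; apply: near_all => y; rewrite big_cons (negbTE Pi).
Qed.

Lemma smooth_at_inv n (f : 'rV[R]_n -> R) x :
  f x != 0 -> smooth_at f x -> smooth_at (fun y => (f y)^-1) x.
Proof.
move=> fx0 sf; have cf := differentiable_continuous (smooth_at_differentiable sf).
have : \forall y \near x, f y != 0.
  by apply: (cf [set z | z != 0]); apply: open_nbhs_nbhs; split=> //; exact: open_neq.
have /smooth_atP [U [oU Ux Uf]] := sf.
move=> /near_openP [V [oV Vx V0]]; have oUV := openI oU oV.
apply/smooth_atP; exists (U `&` V); split=> // k; apply: Ck_inv => //.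
  by move=> y [_ /V0].
by apply: Ck_subset (Uf k) => y [].
Qed.

Lemma smooth_at_row n p (f : 'rV[R]_n -> 'rV[R]_p) x :
  smooth_at f x <-> forall j, smooth_at (fun y => f y 0 j) x.
Proof.
split=> [/smooth_atP [U [oU Ux Uf]] j|sf].
  by apply/smooth_atP; exists U; split=> // k; move/(Ck_rowP _ _ oU): (Uf k).
have /choice [U hU] j := (smooth_atP _ _).1 (sf j).
have : nbhs x [set y | forall i, U i y].
  by apply: (@near_forall _ _ x U) => i; have [oU Ux _] := hU i; apply: open_nbhs_nbhs.
move=> /near_openP [V' [oV' V'x V'U]]; apply/smooth_atP; exists V'; split=> // k.
apply/Ck_rowP => // j; have [_ _ /(_ k)] := hU j.
by apply: Ck_subset => y /V'U; exact.
Qed.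

Lemma smooth_at_comp n p (phi : 'rV[R]_n -> 'rV[R]_p) (f : 'rV[R]_p -> R) x :
  smooth_at phi x -> smooth_at f (phi x) -> smooth_at (f \o phi) x.
Proof.
move=> sphi /smooth_atP [V [oV Vx Vf]].
have cphi := differentiable_continuous (smooth_at_differentiable sphi).
have : \forall y \near x, V (phi y) by apply: cphi; exact: open_nbhs_nbhs.
move=> /near_openP [V' [oV' V'x V'V]].
have /smooth_atP [U [oU Ux Uf]] := sphi; have oUV := openI oU oV'.
apply/smooth_atP; exists (U `&` V'); split=> // k; apply: Ck_comp (Vf k) => //.
  by move=> y [_ /V'V].
by apply: Ck_subset (Uf k) => y [].
Qed.

Lemma smooth_at_coord n j (x : 'rV[R]_n) : smooth_at (fun y : 'rV[R]_n => y 0 j) x.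
Proof.
apply: smooth_at_partials => [|i]; first by apply: near_all => y; exact: differentiable_coord.
apply: smooth_at_eq (smooth_at_cst ((delta_mx 0 i : 'rV[R]_n) 0 j) x).
apply: near_all => y; rewrite deriveE; last exact: differentiable_coord.
have := @diff_coord _ n id y (delta_mx 0 i) j.
by rewrite diff_val => ->.
Qed.

End Calculus.

(** * Mean value estimates and equality of mixed partial derivatives *)

Section MeanValue.
Context {R : realType}.

Lemma mvt_segment n (f : 'rV[R]_n -> R) (a w : 'rV[R]_n) :
  (forall t : R, 0 <= t <= 1 -> differentiable f (a + t *: w)) ->
  exists t : R, 0 <= t <= 1 /\ f (a + w) - f a = 'd f (a + t *: w) w.
Proof.
move=> df; pose ga (t : R) := a + t *: w.
have dga (t : R) : is_diff t ga (fun h => h *: w).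
  by apply: is_diff_eq; apply/funext => h; rewrite !fctE add0r.
have dfga (t : R) : 0 <= t <= 1 -> differentiable (f \o ga) t.
  by move=> t01; apply: differentiable_comp; [exact: ex_diff|exact: df].
have [t t01||t] := @MVT_segment R (f \o ga) (fun t => 'd f (ga t) w) 0 1 ler01.
- split; first by apply: diff_derivable; apply: dfga; rewrite !ltW ?(itvP t01).
  have t01' : 0 <= t <= 1 by rewrite !ltW ?(itvP t01).
  rewrite deriveE; last exact: dfga.
  by rewrite diff_comp/=; [rewrite diff_val scale1r|exact: ex_diff|exact: df].
- apply: continuous_in_subspaceT => t; rewrite inE /= => t01.
  by apply: differentiable_continuous; apply: dfga; rewrite !(itvP t01).
move=> t01 E; exists t; split; first by rewrite !(itvP t01).
by move: E; rewrite subr0 mulr1 /ga /= scale1r scale0r addr0.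
Qed.

Lemma rV_norm_le k (v : 'rV[R]_k) (e : R) :
  0 <= e -> (forall j, `|v 0 j| <= e) -> `|v| <= e.
Proof.
move=> e0 ve; rewrite /Num.Def.normr /= mx_normrE; apply: bigmax_le => // -[i j] _ /=.
by rewrite ord1.
Qed.

Lemma rV_norm_coord k (v : 'rV[R]_k) j : `|v 0 j| <= `|v|.
Proof.
rewrite [leRHS]/Num.Def.normr /= mx_normrE.
exact: (@le_bigmax _ _ _ 0 (fun ij => `|v ij.1 ij.2|) (0, j)).
Qed.

Lemma near_ballP (V : normedModType R) (p : V) (P : set V) :
  (\forall x \near p, P x) -> exists2 d : R, 0 < d & forall x, `|x - p| < d -> P x.
Proof.
move=> /nbhs_ballP [d d0 dP]; exists d => // x xp; apply: dP.
by rewrite -ball_normE /= distrC.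
Qed.

Lemma near_ball (V : normedModType R) (p : V) (d : R) :
  0 < d -> \forall x \near p, `|x - p| < d.
Proof.
move=> d0; apply/nbhs_ballP; exists d => // x.
by rewrite -ball_normE /= distrC.
Qed.

Lemma is_diff_shift (V W : normedModType R) (f : V -> W) (x b : V) :
  differentiable f (x + b) -> is_diff x (fun y => f (y + b)) ('d f (x + b)).
Proof.
move=> df.
have [ds Es] : is_diff x (fun y : V => y + b) id.
  by apply: is_diff_eq; apply/funext => y; rewrite !fctE addr0.
split; first exact: (@differentiable_comp _ _ _ _ (fun y => y + b) f x).
by rewrite (@diff_comp _ _ _ _ (fun y => y + b) f x)// Es.
Qed.

(** Schwarz's theorem by contradiction. With [e] half the supposed discrepancy at [x], both mixed
    derivatives stay within [e] of their values at [x] on a small ball. The second difference of [f]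
    over a parallelogram in that ball equals [h * h] times either mixed derivative at some point of
    it, so the discrepancy is smaller than [e + e]. *)
Lemma partial_commute n (f : 'rV[R]_n -> R) i j x : smooth_at f x ->
  'D_(delta_mx 0 i) ('D_(delta_mx 0 j) f) x = 'D_(delta_mx 0 j) ('D_(delta_mx 0 i) f) x.
Proof.
move=> sf; pose u := delta_mx 0 i : 'rV[R]_n; pose v := delta_mx 0 j : 'rV[R]_n.
rewrite -/u -/v.
apply/eqP; apply: contraT => neq.
pose e := `|'D_u ('D_v f) x - 'D_v ('D_u f) x| / 2.
have e0 : 0 < e by rewrite divr_gt0 // normr_gt0 subr_eq0.
have sP : smooth_at ('D_u ('D_v f)) x by do 2!apply: smooth_at_partial.
have sQ : smooth_at ('D_v ('D_u f)) x by do 2!apply: smooth_at_partial.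
have cP := differentiable_continuous (smooth_at_differentiable sP).
have cQ := differentiable_continuous (smooth_at_differentiable sQ).
have nP : \forall y \near x, `|'D_u ('D_v f) x - 'D_u ('D_v f) y| < e.
  exact: (@cvgr_dist_lt _ _ _ _ _ _ _ cP _ e0).
have nQ : \forall y \near x, `|'D_v ('D_u f) x - 'D_v ('D_u f) y| < e.
  exact: (@cvgr_dist_lt _ _ _ _ _ _ _ cQ _ e0).
have [d d0 hd] := near_ballP (filterI (smooth_at_near sf) (filterI nP nQ)).
(* With [h = d / N] the whole parallelogram spanned by [h *: u] and [h *: v] lies in the ball of
   radius [d]; the summand 1 keeps [N] positive and the inclusion strict. *)
pose N := `|u| + `|v| + 1.
have N0 : 0 < N by rewrite ltr_wpDl ?addr_ge0.
pose h := d / N; have h0 : 0 < h by rewrite divr_gt0.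
have small (s t : R) : 0 <= s <= 1 -> 0 <= t <= 1 ->
    `|x + s *: (h *: u) + t *: (h *: v) - x| < d.
  move=> /andP[s0 s1] /andP[t0 t1].
  have -> : x + s *: (h *: u) + t *: (h *: v) - x = s *: (h *: u) + t *: (h *: v).
    by rewrite addrAC [x + _]addrC addrK.
  apply: (@le_lt_trans _ _ (h * (`|u| + `|v|))).
    apply: le_trans (ler_normD _ _) _; rewrite mulrDr.
    have le1 (c : R) (b : 'rV[R]_n) : 0 <= c -> c <= 1 -> `|c *: (h *: b)| <= h * `|b|.
      move=> c0 c1; rewrite normrZ (ger0_norm c0) normrZ (ger0_norm (ltW h0)).
      by rewrite -[leRHS]mul1r ler_wpM2r// mulr_ge0// ltW.
    by rewrite lerD// le1.
  by rewrite /h mulrAC ltr_pdivrMr// ltr_pM2l// /N ltrDl.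
have sm0 (s : R) : 0 <= s <= 1 -> `|x + s *: (h *: u) - x| < d.
  by move=> s01; have := small s 0 s01; rewrite scale0r addr0 lexx ler01; exact.
have sm1 (t : R) : 0 <= t <= 1 -> `|x + t *: (h *: v) - x| < d.
  by move=> t01; have := small 0 t _ t01; rewrite scale0r addr0 lexx ler01; exact.
have one : 0 <= (1 : R) <= 1 by rewrite lexx ler01.
(* The second difference of [f] is computed in both orders. *)
have key (a b : 'rV[R]_n) i' j' : a = delta_mx 0 i' -> b = delta_mx 0 j' ->
   (forall s t : R, 0 <= s <= 1 -> 0 <= t <= 1 ->
     smooth_at f (x + s *: (h *: a) + t *: (h *: b))) ->
   exists s t : R, [/\ 0 <= s <= 1, 0 <= t <= 1 &
     f (x + h *: a + h *: b) - f (x + h *: a) - (f (x + h *: b) - f x)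
       = h * h * 'D_b ('D_a f) (x + s *: (h *: a) + t *: (h *: b))].
  move=> Ea Eb sfab.
  pose F y := f (y + h *: b) - f y.
  have dF (s : R) : 0 <= s <= 1 -> is_diff (x + s *: (h *: a)) F
      (fun y => 'd f (x + s *: (h *: a) + h *: b) y - 'd f (x + s *: (h *: a)) y).
    move=> s01.
    have d1 : differentiable f (x + s *: (h *: a)).
      apply: smooth_at_differentiable; have := sfab s 0 s01.
      by rewrite scale0r addr0 lexx ler01; exact.
    have d2 : differentiable f (x + s *: (h *: a) + h *: b).
      by apply: smooth_at_differentiable; have := sfab s 1 s01 one; rewrite scale1r.
    by apply: (@is_diffB _ _ _ (fun y => f (y + h *: b)) f); [exact: is_diff_shift|exact: differentiableP].
  have [s [s01 Es]] : exists s : R, 0 <= s <= 1 /\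
      F (x + h *: a) - F x = 'd F (x + s *: (h *: a)) (h *: a).
    by apply: mvt_segment => s s01; have [] := dF s s01.
  have [t [t01 Et]] : exists t : R, 0 <= t <= 1 /\
      'D_a f (x + s *: (h *: a) + h *: b) - 'D_a f (x + s *: (h *: a))
      = 'd ('D_a f) (x + s *: (h *: a) + t *: (h *: b)) (h *: b).
    apply: (@mvt_segment _ ('D_a f)) => t t01.
    by apply: smooth_at_differentiable; rewrite [in 'D_a f]Ea; exact/smooth_at_partial/sfab.
  exists s, t; split=> //; rewrite -/(F (x + h *: a)) -/(F x) Es.
  have da : differentiable ('D_a f) (x + s *: (h *: a) + t *: (h *: b)).
    by apply: smooth_at_differentiable; rewrite [in 'D_a f]Ea; exact/smooth_at_partial/sfab.
  have d1 : differentiable f (x + s *: (h *: a)).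
    by apply: smooth_at_differentiable; have := sfab s 0 s01; rewrite scale0r addr0 lexx ler01; exact.
  have d2 : differentiable f (x + s *: (h *: a) + h *: b).
    by apply: smooth_at_differentiable; have := sfab s 1 s01 one; rewrite scale1r.
  have [_ ->] := dF s s01.
  have dZ (q : 'rV[R]_n) (g : 'rV[R]_n -> R) w : differentiable g q -> 'd g q (h *: w) = h * 'D_w g q.
    by move=> dg; rewrite linearZ /= -deriveE.
  transitivity (h * 'D_a f (x + s *: (h *: a) + h *: b) - h * 'D_a f (x + s *: (h *: a))).
    by congr (_ - _); exact: dZ.
  by rewrite -mulrBr Et (dZ _ _ _ da) mulrA.
have [s [t [s01 t01 E1]]] := key u v i j erefl erefl (fun s t s01 t01 => (hd _ (small s t s01 t01)).1).
have sfvu (s' t' : R) : 0 <= s' <= 1 -> 0 <= t' <= 1 -> smooth_at f (x + s' *: (h *: v) + t' *: (h *: u)).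
  by move=> s01' t01'; rewrite addrAC; exact: (hd _ (small _ _ t01' s01')).1.
have [s' [t' [s01' t01' E2]]] := key v u j i erefl erefl sfvu.
have small' (a b : R) : 0 <= a <= 1 -> 0 <= b <= 1 -> `|x + a *: (h *: v) + b *: (h *: u) - x| < d.
  by move=> a01 b01; rewrite [x + _ + _]addrAC; exact: small.
have sub_swap (a b c b' : R) : a - b - (c - b') = a - c - (b - b') by ring.
have E : h * h * 'D_v ('D_u f) (x + s *: (h *: u) + t *: (h *: v)) =
         h * h * 'D_u ('D_v f) (x + s' *: (h *: v) + t' *: (h *: u)).
  apply: etrans (esym E1) (etrans _ E2).
  apply: etrans (sub_swap _ _ _ _) _.
  by congr (f _ - _ - _); exact: addrAC.
have {}E := mulfI (mulf_neq0 (lt0r_neq0 h0) (lt0r_neq0 h0)) E.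
have [_ [_ Q1]] := hd _ (small _ _ s01 t01).
have [_ [P1 _]] := hd _ (small' _ _ s01' t01').
have tri (a b c b' : R) : c = b' -> `|a - b'| < e -> `|b - c| < e -> `|a - b| < e + e.
  move=> -> h1 h2; apply: le_lt_trans (ltrD h1 h2).
  by rewrite [`|b - _|]distrC; apply: le_trans (ler_normD _ _); rewrite addrA subrK.
have := tri _ _ _ _ E P1 Q1.
by rewrite /e -splitr ltxx.
Qed.

Lemma diff_bound n (f : 'rV[R]_n -> R) p z (v : 'rV[R]_n) (e : R) : 0 <= e ->
  differentiable f p -> differentiable f z ->
  (forall i, `|'D_(delta_mx 0 i) f p - 'D_(delta_mx 0 i) f z| <= e) ->
  `|'d f z v - 'd f p v| <= n%:R * e * `|v|.
Proof.
move=> e0 dp dz he.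
have -> : 'd f z v - 'd f p v = \sum_i v 0 i *: 'D_(delta_mx 0 i) f z
    - \sum_i v 0 i *: 'D_(delta_mx 0 i) f p.
  by congr (_ - _); exact: diff_partial.
rewrite -sumrB; apply: le_trans (ler_norm_sum _ _ _) _.
apply: (@le_trans _ _ (\sum_(i < n) e * `|v|)).
  apply: ler_sum => i _; rewrite -scalerBr normrZ mulrC ler_pM//; last exact: rV_norm_coord.
  by rewrite distrC.
by rewrite sumr_const card_ord -mulrA mulr_natl.
Qed.

(** Strict differentiability. On the segment from [y] to [x] the mean value theorem yields, for each
    component, the differential at an intermediate point, whose partial derivatives are within [e']
    of those at [p]. *)
Lemma strict_diff m k (f : 'rV[R]_m -> 'rV[R]_k) p (e : R) : smooth_at f p -> 0 < e ->
  exists2 d : R, 0 < d & forall x y, `|x - p| < d -> `|y - p| < d ->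
    `|f x - f y - 'd f p (x - y)| <= e * `|x - y|.
Proof.
(* Summing over the [m] partial derivatives loses a factor [m]; the successor avoids a division by
   zero when [m = 0]. *)
move=> sf e0; pose e' := e / m.+1%:R.
have e'0 : 0 < e' by rewrite divr_gt0.
have sfj j : smooth_at (fun y => f y 0 j) p by move/smooth_at_row: sf.
have n1 : \forall z \near p, smooth_at f z by exact: smooth_at_near.
have : \forall z \near p, forall ji : 'I_k * 'I_m,
    `|'D_(delta_mx 0 ji.2) (fun y => f y 0 ji.1) p - 'D_(delta_mx 0 ji.2) (fun y => f y 0 ji.1) z| < e'.
  apply: (@near_forall _ _ p (fun ji => [set z |
    `|'D_(delta_mx 0 ji.2) (fun y => f y 0 ji.1) p - 'D_(delta_mx 0 ji.2) (fun y => f y 0 ji.1) z| < e'])).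
  move=> [j i] /=.
  have := differentiable_continuous (smooth_at_differentiable (smooth_at_partial i (sfj j))).
  by move=> c; exact: (@cvgr_dist_lt _ _ _ _ _ _ _ c _ e'0).
move=> /(filterI n1) /near_ballP [d d0 hd]; exists d => // x y xd yd.
apply: rV_norm_le => [|j]; first by rewrite mulr_ge0 // ltW.
have seg (t : R) : 0 <= t <= 1 -> `|y + t *: (x - y) - p| < d.
  move=> /andP[t0 t1].
  have -> : y + t *: (x - y) - p = (1 - t) *: (y - p) + t *: (x - p).
    by rewrite !scalerBr scalerBl !scale1r scalerBl; apply/rowP => l; rewrite !mxE; ring.
  apply: le_lt_trans (ler_normD _ _) _; rewrite !normrZ (ger0_norm t0) ger0_norm ?subr_ge0//.
  apply: (@le_lt_trans _ _ (Num.max `|y - p| `|x - p|)); last by rewrite gt_max yd xd.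
  rewrite -[leRHS]mul1r -{2}(subrK t 1) [leRHS]mulrDl lerD// ler_wpM2l ?subr_ge0//.
    by rewrite le_max lexx.
  by rewrite le_max lexx orbT.
have df : differentiable f p by exact: smooth_at_differentiable.
have pd : `|p - p| < d by rewrite subrr normr0.
rewrite 3!mxE mxE diff_coord//.
have dseg z : `|z - p| < d -> differentiable (fun y => f y 0 j) z.
  by move=> /hd [/smooth_at_differentiable/differentiable_rowP].
have [|t [t01]] := @mvt_segment m (fun y => f y 0 j) y (x - y).
  by move=> t t01; exact/dseg/seg.
rewrite [y + (x - y)]addrC subrK => ->.
set z := y + _; have zd : `|z - p| < d by exact: seg.
have hz i : `|'D_(delta_mx 0 i) (fun y => f y 0 j) p - 'D_(delta_mx 0 i) (fun y => f y 0 j) z| <= e'.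
  by rewrite ltW//; have [_ /(_ (j, i))] := hd z zd.
apply: le_trans (diff_bound _ (ltW e'0) (dseg p pd) (dseg z zd) hz) _.
rewrite ler_wpM2r// /e' mulrCA ler_piMr//; first exact: ltW.
by rewrite ler_pdivrMr// mul1r ler_nat.
Qed.

End MeanValue.

(** * Submersions between open sets *)

Section Slice.
Context {R : realType}.

Lemma linear_bound m (W : normedModType R) (f : {linear 'rV[R]_m -> W}) :
  exists2 c : R, 0 < c & forall v, `|f v| <= c * `|v|.
Proof.
exists (\sum_i `|f (delta_mx 0 i)| + 1) => [|v]; first by rewrite ltr_wpDl// sumr_ge0.
rewrite {1}[v]row_sum_delta linear_sum; apply: le_trans (ler_norm_sum _ _ _) _.
rewrite mulrDl mulr_suml; apply: ler_wpDr; first by rewrite mul1r.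
by apply: ler_sum => i _; rewrite linearZ normrZ mulrC ler_wpM2l// rV_norm_coord.
Qed.

Lemma linear_rV_continuous m (W : normedModType R) (f : {linear 'rV[R]_m -> W}) :
  continuous f.
Proof.
have [c c0 hc] := linear_bound f.
apply/linear_bounded_continuous/linear_boundedP.
exists c; split; first exact: num_real.
by move=> r cr x; apply: le_trans (hc x) _; apply: ler_wpM2r => //; exact: ltW.
Qed.

Lemma continuous_dist (V W : normedModType R) (f : V -> W) c w :
  {for w, continuous f} -> {for w, continuous (fun x => `|f x - c|)}.
Proof. by move=> cf; apply: cvg_norm; apply: cvgB => //; exact: cvg_cst. Qed.

Lemma closed_ball_rV_compact k (r : R) : compact [set w : 'rV[R]_k | `|w| <= r].
Proof.
apply: bounded_closed_compact.
  exists r; split; first exact: num_real.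
  by move=> s rs w /= wr; rewrite (le_trans wr)// ltW.
rewrite (_ : [set w | _] = (fun w : 'rV[R]_k => `|w|) @^-1` [set x | x <= r])//.
apply: closed_comp; last exact: closed_le.
by move=> w _; exact: norm_continuous.
Qed.

(* [K] is a right inverse of the differential.  The equation [phi (z + w K) = c] is solved for a small
   [w] by minimising [|phi (z + w K) - c|] over a ball: a Newton step would halve a nonzero minimum. *)
Lemma submersion_slice m n (phi : 'rV[R]_m -> 'rV[R]_n) p (K : 'M[R]_(n, m)) :
  smooth_at phi p -> (forall w, 'd phi p (w *m K) = w) ->
  exists2 C : R, 0 < C & exists2 d : R, 0 < d &
    (forall z z' w w', `|z - p| < d -> `|z' - p| < d -> `|w| < d -> `|w'| < d ->
       `|w - w'| <= C * (`|phi (z + w *m K) - phi (z' + w' *m K)| + `|z - z'|)) /\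
    forall e : R, 0 < e -> exists2 d' : R, 0 < d' &
      forall z c, `|z - p| < d' -> `|c - phi p| < d' ->
        exists w, [/\ phi (z + w *m K) = c, `|w| < e & `|w| <= C * `|phi z - c|].
Proof.
move=> sphi phiK.
have [k k0 hk] := linear_bound (mulmxr K : {linear 'rV[R]_n -> 'rV[R]_m}).
have [l l0 hl] := linear_bound ('d phi p).
move: ('d phi p) phiK hl (@strict_diff R m n phi p) => D phiK hl strict.
(* With [e1 * k = 1/2], the error of the linear approximation along [K] is at most half of
   [|w - w'|]. This gives both the Lipschitz estimate for [w] and the halving by a Newton step. *)
pose e1 := (2 * k)^-1; have e10 : 0 < e1 by rewrite invr_gt0 mulr_gt0.
have e1k : e1 * k = 2^-1 by rewrite /e1 invfM -mulrA mulVf ?mulr1 ?gt_eqF.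
have [d2 d20 hd2] := strict e1 sphi e10.
have [d3 d30 hd3] := near_ballP (smooth_at_near sphi).
pose d1 := Num.min d2 d3.
have d10 : 0 < d1 by rewrite lt_min d20 d30.
have hd1 x y : `|x - p| < d1 -> `|y - p| < d1 -> `|phi x - phi y - D (x - y)| <= e1 * `|x - y|.
  by rewrite !lt_min => /andP[? _] /andP[? _]; exact: hd2.
have sd1 x : `|x - p| < d1 -> {for x, continuous phi}.
  by rewrite lt_min => /andP[_ /hd3 /smooth_at_differentiable /differentiable_continuous].
(* Since [(1 + k) * d = d1], the point [z + w K] stays within [d1] of [p]. *)
pose d := d1 / (1 + k); have d0 : 0 < d by rewrite divr_gt0// addr_gt0.
have in_d1 z w : `|z - p| < d -> `|w| < d -> `|z + w *m K - p| < d1.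
  move=> zd wd; rewrite addrAC; apply: le_lt_trans (ler_normD _ _) _.
  have -> : d1 = d + k * d by rewrite /d; field; rewrite gt_eqF// addr_gt0.
  rewrite ltrD//; apply: le_lt_trans (hk w) _; by rewrite ltr_pM2l.
have step z z' w w' : `|z - p| < d -> `|z' - p| < d -> `|w| < d -> `|w'| < d ->
    `|w - w'| <= 2 * `|phi (z + w *m K) - phi (z' + w' *m K)| + (2 * e1 + 2 * l) * `|z - z'|.
  move=> zd z'd wd w'd.
  have := hd1 _ _ (in_d1 _ _ zd wd) (in_d1 _ _ z'd w'd).
  set a := phi _ - phi _.
  have -> : z + w *m K - (z' + w' *m K) = (z - z') + (w - w') *m K.
    by rewrite mulmxBl opprD addrACA.
  rewrite linearD /= phiK => h.
  have h1 : `|z - z' + (w - w') *m K| <= `|z - z'| + k * `|w - w'|.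
    by apply: le_trans (ler_normD _ _) _; rewrite lerD2l; exact: hk.
  have h2 : `|w - w'| <= `|a| + `|a - (D (z - z') + (w - w'))| + `|D (z - z')|.
    have {1}-> : w - w' = a - (a - (D (z - z') + (w - w'))) - D (z - z').
      by rewrite subKr [RHS]addrC addKr.
    apply: le_trans (ler_normB _ _) _; rewrite lerD2r.
    by apply: le_trans (ler_normB _ _) _; rewrite lerD2l.
  have h3 := hl (z - z').
  have h4 : e1 * `|z - z' + (w - w') *m K| <= e1 * `|z - z'| + 2^-1 * `|w - w'|.
    by rewrite -e1k -mulrA -mulrDr ler_pM2l.
  lra.
pose C := 4 + 2 * e1 + 2 * l.
have C0 : 0 < C by rewrite /C; lra.
exists C => //; exists d => //; split=> [z z' w w' zd z'd wd w'd|e e0].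
  apply: le_trans (step z z' w w' zd z'd wd w'd) _.
  by rewrite mulrDr lerD// ler_wpM2r// /C; lra.
pose rho := Num.min e d / 2.
have rho0 : 0 < rho by rewrite divr_gt0// lt_min e0 d0.
have rhoed : rho < Num.min e d by rewrite /rho ltr_pdivrMr// ltr_pMr ?ltr1n// lt_min e0 d0.
have /andP[rhoe rhod] : (rho < e) && (rho < d) by rewrite -lt_min.
(* This makes the initial error [a = |phi z - c|] at most [rho / 5]. The minimiser then has norm at
   most [4 a], and the Newton step adds at most [a], so the improved point is still in the ball of
   radius [rho] and contradicts a nonzero minimum. *)
pose d' := Num.min d (rho / (5 * (l + e1 + 1))).
have den0 : 0 < 5 * (l + e1 + 1) by rewrite mulr_gt0// addr_gt0// addr_gt0.
have d'0 : 0 < d' by rewrite lt_min d0/= divr_gt0.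
exists d' => // z c; rewrite lt_min => /andP[zd zr] cd'.
have cr : `|c - phi p| < rho / (5 * (l + e1 + 1)) by move: cd'; rewrite lt_min => /andP[].
pose a := `|phi z - c|.
have pd : `|p - p| < d by rewrite subrr normr0.
have d0n : `|0 : 'rV[R]_n| < d by rewrite normr0.
have a5 : 5 * a <= rho.
  have /= := hd1 _ _ (in_d1 z 0 zd d0n) (in_d1 p 0 pd d0n); rewrite mul0mx !addr0 => h1.
  have h2 := hl (z - p).
  have h3 : a <= `|phi z - phi p - D (z - p)| + `|D (z - p)| + `|c - phi p|.
    rewrite /a; have -> : phi z - c = phi z - phi p - D (z - p) + D (z - p) - (c - phi p).
      by rewrite subrK opprB addrA subrK.
    apply: le_trans (ler_normB _ _) _; rewrite lerD2r; exact: ler_normD.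
  have h4 : a <= (l + e1 + 1) * (rho / (5 * (l + e1 + 1))).
    apply: le_trans h3 _; rewrite mulrDl mul1r lerD//; last exact: ltW.
    apply: le_trans (lerD h1 h2) _; rewrite -mulrDl [e1 + l]addrC ler_wpM2l//; last exact: ltW.
    by rewrite ltW// addr_gt0.
  have -> : rho = 5 * ((l + e1 + 1) * (rho / (5 * (l + e1 + 1)))).
    by field; rewrite gt_eqF// !addr_gt0.
  by rewrite ler_pM2l.
have a0 : 0 <= a by rewrite normr_ge0.
pose F (w : 'rV[R]_n) : R := `|phi (z + w *m K) - c|.
pose A := [set w : 'rV[R]_n | `|w| <= rho].
have [|||w0 w0A w0min] := @EVT_min_rV R n F A.
- by exists 0; rewrite /A /= normr0 ltW.
- exact: closed_ball_rV_compact.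
- apply: continuous_in_subspaceT => w; rewrite inE => wA.
  have wd : `|w| < d by exact: le_lt_trans wA rhod.
  have c1 : {for w, continuous (fun w : 'rV[R]_n => z + w *m K)}.
    apply: differentiable_continuous; apply: differentiableD; first exact: differentiable_cst.
    by apply: (@linear_differentiable _ _ _ (mulmxr K)); exact: linear_rV_continuous.
  have c2 : {for w, continuous (phi \o (fun w : 'rV[R]_n => z + w *m K))}.
    by apply: continuous_comp => //; exact/sd1/in_d1.
  have c3 := @continuous_dist _ _ _ c w c2; rewrite /F; exact: c3.
have {}w0A : `|w0| <= rho by move: w0A; rewrite inE.
have w0d : `|w0| < d by exact: le_lt_trans w0A rhod.
have Fw0 : F w0 <= a.
  have := w0min 0; rewrite /F mul0mx addr0; apply; rewrite inE /A /= normr0 ltW//.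
have w04 : `|w0| <= 4 * a.
  have := step z z w0 0 zd zd w0d d0n; rewrite subr0 subrr normr0 mulr0 addr0 mul0mx addr0.
  have : `|phi (z + w0 *m K) - phi z| <= F w0 + a.
    have -> : phi (z + w0 *m K) - phi z = (phi (z + w0 *m K) - c) - (phi z - c).
      by rewrite opprB addrA subrK.
    exact: ler_normB.
  lra.
pose w1 := w0 - (phi (z + w0 *m K) - c).
have w1r : `|w1| <= rho.
  apply: le_trans (ler_normB _ _) _; rewrite -/(F w0); lra.
have w1d : `|w1| < d by exact: le_lt_trans w1r rhod.
have Fw1 : F w0 <= F w1 by apply: w0min; rewrite inE.
have Fhalf : F w1 <= 2^-1 * F w0.
  have := hd1 _ _ (in_d1 z w1 zd w1d) (in_d1 z w0 zd w0d).
  have -> : z + w1 *m K - (z + w0 *m K) = (w1 - w0) *m K.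
    by rewrite opprD addrACA subrr add0r -mulmxBl.
  rewrite phiK; have -> : w1 - w0 = - (phi (z + w0 *m K) - c) by rewrite /w1 addrC addKr.
  rewrite opprK addrA subrK -/(F w1) => h; apply: le_trans h _.
  rewrite -e1k -mulrA ler_pM2l//; apply: le_trans (hk _) _.
  by rewrite normrN.
have F0 : F w0 = 0.
  apply/eqP; rewrite eq_le normr_ge0 andbT; lra.
exists w0; split.
- by apply/eqP; rewrite -subr_eq0 -normr_eq0; apply/eqP.
- exact: le_lt_trans w0A rhoe.
- by apply: le_trans w04 _; rewrite ler_wpM2r// /C; lra.
Qed.

End Slice.

(** * Level sets of submersions and descent of differentiability *)

Section Submersions.
Context {R : realType}.

Lemma near_and (T : topologicalType) (x : T) (P Q : set T) :
  (\forall y \near x, P y) -> (\forall y \near x, Q y) -> \forall y \near x, P y /\ Q y.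
Proof. exact: filterI. Qed.

Lemma diff_near (V W : normedModType R) (f : V -> W) q (e : R) : differentiable f q -> 0 < e ->
  \forall x \near q, `|f x - f q - 'd f q (x - q)| <= e * `|x - q|.
Proof.
move=> /diff_locallyP [_ /eqaddoP] /(_ e) /[apply].
move=> h; have : \forall x \near q, `|(f \o shift q - (cst (f q) + 'd f q)) (x - q)| <= e * `|x - q|.
  by rewrite (near_shift 0) subr0; apply: filterS h => x /=; rewrite addrK.
by apply: filterS => x; rewrite !fctE /= subrK opprD addrA.
Qed.

Lemma is_diff_near (V W : normedModType R) (f : V -> W) (L : {linear V -> W}) q :
  continuous L ->
  (forall e : R, 0 < e -> \forall x \near q, `|f x - f q - L (x - q)| <= e * `|x - q|) ->
  is_diff q f L.
Proof.
move=> cL h; have key : f \o shift q = cst (f q) + L +o_ 0 id.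
  apply/eqaddoP => e e0; have := h e e0; rewrite (near_shift 0) subr0.
  by apply: filterS => x /=; rewrite !fctE /= addrK opprD addrA.
have E := diff_unique cL key.
by split; [apply/diff_locallyP; rewrite E|rewrite E].
Qed.

Lemma is_derive_zero (h : R -> R) (t : R) :
  (forall e : R, 0 < e -> \forall s \near t, `|h s - h t| <= e * `|s - t|) -> is_derive t 1 h 0.
Proof.
move=> h0; have [dh Eh] : is_diff t h (\0 : {linear R -> R}).
  apply: is_diff_near => [|e e0]; first exact: cst_continuous.
  by apply: filterS (h0 e e0) => s /=; rewrite subr0.
by split; [exact: diff_derivable|rewrite deriveE// Eh].
Qed.

Lemma diff_lipschitz_at m (W : normedModType R) (f : 'rV[R]_m -> W) q : differentiable f q ->
  exists2 c : R, 0 < c & \forall x \near q, `|f x - f q| <= c * `|x - q|.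
Proof.
move=> df; have [a a0 ha] := linear_bound ('d f q).
exists (1 + a); first by rewrite addr_gt0.
apply: filterS (diff_near df ltr01) => x h; rewrite mulrDl.
by rewrite -[X in `|X|](subrK ('d f q (x - q))) (le_trans (ler_normD _ _))// lerD.
Qed.

(** For [x] on the level of [q], the vector [D (x - q)] is of smaller order than [x - q]. As the
    kernel of [D] lies in that of [G], one has [G = G (D _ *m K)], so [G (x - q)] is of smaller
    order too. The two terms of [1 + a * k] share [e] between this contribution and the remainder of
    [f]. *)
Lemma level_littleo m n (phi : 'rV[R]_m -> 'rV[R]_n) (f : 'rV[R]_m -> R) q (K : 'M[R]_(n, m)) :
  differentiable phi q -> differentiable f q ->
  (forall w, 'd phi q (w *m K) = w) -> (forall v, 'd phi q v = 0 -> 'd f q v = 0) ->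
  forall e : R, 0 < e -> \forall x \near q, phi x = phi q -> `|f x - f q| <= e * `|x - q|.
Proof.
move=> dphi df phiK ker e e0.
have [k k0 hk] := linear_bound (mulmxr K : {linear 'rV[R]_n -> 'rV[R]_m}).
have [a a0 ha] := linear_bound ('d f q).
have np := fun c => diff_near (e := c) dphi; have nf := fun c => diff_near (e := c) df.
move: ('d phi q) ('d f q) phiK ker np nf a a0 ha => D G phiK ker np nf a a0 ha.
pose c := e / (1 + a * k).
have den0 : 0 < 1 + a * k by rewrite addr_gt0// mulr_gt0.
have c0 : 0 < c by rewrite divr_gt0.
apply: filterS2 (np c c0) (nf c c0) => x h1 h2 phix.
rewrite phix subrr sub0r normrN in h1.
have GE : G (x - q) = G (D (x - q) *m K).
  apply/eqP; rewrite -subr_eq0 -linearB; apply/eqP/ker.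
  by rewrite linearB /= phiK subrr.
have h3 : `|G (x - q)| <= a * (k * (c * `|x - q|)).
  rewrite GE; apply: le_trans (ha _) _; rewrite ler_pM2l//.
  by apply: le_trans (hk _) _; rewrite ler_pM2l.
have -> : e * `|x - q| = c * `|x - q| + a * (k * (c * `|x - q|)).
  by rewrite {1}(_ : e = c * (1 + a * k)); [ring|rewrite /c mulfVK// gt_eqF].
by rewrite -[X in `|X|](subrK (G (x - q))) (le_trans (ler_normD _ _))// lerD.
Qed.

(* The segment from [p] to [q] is pushed into the level set by the slice lemma.  The resulting curve is
   only Lipschitz, which suffices for [f] to have derivative zero along it. *)
Lemma level_constant m n (phi : 'rV[R]_m -> 'rV[R]_n) (f : 'rV[R]_m -> R) p (K : 'M[R]_(n, m)) :
  smooth_at phi p -> (forall w, 'd phi p (w *m K) = w) ->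
  (\forall q \near p, phi q = phi p -> [/\ differentiable f q,
     exists K' : 'M[R]_(n, m), forall w, 'd phi q (w *m K') = w &
     forall v, 'd phi q v = 0 -> 'd f q v = 0]) ->
  \forall q \near p, phi q = phi p -> f q = f p.
Proof.
move=> sphi phiK hyp.
have [k k0 hk] := linear_bound (mulmxr K : {linear 'rV[R]_n -> 'rV[R]_m}).
have [C C0 [d d0 [lip solve]]] := submersion_slice sphi phiK.
have [d4 d40 hd4] := near_ballP (filterI hyp (smooth_at_near sphi)).
pose e := Num.min d (d4 / (2 * k)).
have e0 : 0 < e by rewrite lt_min d0 divr_gt0// mulr_gt0.
have [d' d'0 hd'] := solve e e0.
(* The last halving admits every parameter with [|t| < 2], an open interval containing [[0, 1]], so
   that two-sided derivatives make sense at both ends. *)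
pose r := Num.min (Num.min d' d) (d4 / 2) / 2.
have r0 : 0 < r by rewrite divr_gt0// !lt_min d'0 d0 divr_gt0.
apply: filterS (near_ball p r0) => q qr phiq.
pose z (t : R) := p + t *: (q - p).
have zs (t : R) : `|t| < 2 -> [/\ `|z t - p| < d', `|z t - p| < d & `|z t - p| < d4 / 2].
  move=> t2; have : `|z t - p| < Num.min (Num.min d' d) (d4 / 2).
    rewrite /z addrC addKr normrZ; have -> : Num.min (Num.min d' d) (d4 / 2) = 2 * r by rewrite /r [2 * _]mulrC divfK.
    by apply: ltr_pM.
  by rewrite !lt_min => /andP[/andP[]].
have /choice [w hw] : forall t : R, exists w, `|t| < 2 -> phi (z t + w *m K) = phi p /\ `|w| < e.
  move=> t; have [t2|t2] := ltP `|t| 2; last by exists 0.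
  have [h1 h2 h3] := zs t t2.
  have [|w [w1 w2 _]] := hd' (z t) (phi p) h1; first by rewrite subrr normr0.
  by exists w.
have wd t : `|t| < 2 -> `|w t| < d by move=> /hw [_]; rewrite lt_min => /andP[].
pose ga t := z t + w t *m K.
have gad t : `|t| < 2 -> `|ga t - p| < d4.
  move=> t2; have [_ _ h3] := zs t t2; rewrite /ga addrAC.
  have h4 : `|w t *m K| < d4 / 2.
    apply: le_lt_trans (hk _) _; have [_] := hw t t2; rewrite lt_min => /andP[_].
    by rewrite invfM mulrA ltr_pdivlMr// mulrC.
  by rewrite (le_lt_trans (ler_normD _ _))// [ltRHS](splitr d4) ltrD.
pose L := `|q - p| + k * (C * `|q - p|).
have gaL t s : `|t| < 2 -> `|s| < 2 -> `|ga s - ga t| <= L * `|s - t|.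
  move=> t2 s2; have [_ h2 _] := zs t t2; have [_ h2' _] := zs s s2.
  have zz : `|z s - z t| = `|s - t| * `|q - p|.
    by rewrite /z opprD addrACA subrr add0r -scalerBl normrZ.
  have := lip _ _ _ _ h2' h2 (wd _ s2) (wd _ t2).
  rewrite (hw s s2).1 (hw t t2).1 subrr normr0 add0r zz => h.
  have -> : ga s - ga t = (z s - z t) + (w s - w t) *m K by rewrite mulmxBl opprD addrACA.
  apply: le_trans (ler_normD _ _) _; rewrite zz /L mulrDl [`|s - t| * _]mulrC lerD2l.
  apply: le_trans (hk _) _; rewrite -mulrA ler_pM2l// -mulrA [`|q - p| * _]mulrC.
  by move: h; rewrite mulrA.
(* The corrections [w t] are merely chosen. Where [z t] already lies on the level set, comparison
   with the correction 0 in the Lipschitz estimate forces [w t = 0]; hence the curve runs from [p]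
   to [q]. *)
have w_uniq y : `|y - p| < d -> phi y = phi p -> forall t, `|t| < 2 -> z t = y -> w t = 0.
  move=> yd phiy t t2 zy; have d0n : `|0 : 'rV[R]_n| < d by rewrite normr0.
  have := lip _ _ _ _ yd yd (wd t t2) d0n; rewrite -{1}zy (hw t t2).1 mul0mx addr0 phiy.
  by rewrite !subrr !normr0 addr0 mulr0 subr0 normr_le0 => /eqP.
have ga0 : ga 0 = p.
  have z0 : z 0 = p by rewrite /z scale0r addr0.
  by rewrite /ga (w_uniq p _ _ 0)// ?z0 ?mul0mx ?addr0 ?subrr ?normr0.
have ga1 : ga 1 = q.
  have z1 : z 1 = q by rewrite /z scale1r addrC subrK.
  have n1 : `|1 : R| < 2 by rewrite normr1 ltr1n.
  have [_ h _] := zs 1 n1; rewrite z1 in h.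
  by rewrite /ga (w_uniq q _ _ 1)// ?z1 ?mul0mx ?addr0.
have L0 : 0 <= L.
  by apply: addr_ge0 => //; apply: mulr_ge0; [exact: ltW|apply: mulr_ge0 => //; exact: ltW].
(* Along the curve [phi] is constant, so the increment of [f] is a small multiple of
   [|ga s - ga t|], which is at most [L * |s - t|]. *)
have der (t : R) : `|t| < 2 -> is_derive t 1 (f \o ga) 0.
  move=> t2; apply: is_derive_zero => c c0.
  have [h1 h2] := hd4 _ (gad t t2).
  have [df [K' hK'] kerf] := h1 (hw t t2).1.
  have dphi := smooth_at_differentiable h2.
  have c'0 : 0 < c / (L + 1) by rewrite divr_gt0// ltr_wpDl.
  have nt2 : \forall s \near t, `|s| < 2.
    by apply: (@cvgr_lt _ _ (nbhs t) _ (fun s : R => `|s|) `|t|) => //; exact: norm_continuous.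
  have cga : ga s @[s --> t] --> ga t.
    apply/cvgrPdist_lt => u u0.
    have u1 : 0 < u / (L + 1) by rewrite divr_gt0// ltr_wpDl.
    apply: filterS2 nt2 (near_ball t u1) => s s2 st.
    rewrite distrC; apply: le_lt_trans (gaL _ _ t2 s2) _.
    apply: (@le_lt_trans _ _ ((L + 1) * `|s - t|)); first by rewrite ler_wpM2r// lerDl.
    by rewrite mulrC -ltr_pdivlMr// ltr_wpDl.
  have := cga _ (level_littleo dphi df hK' kerf c'0).
  move=> h; apply: filterS2 nt2 h => s s2 /= h.
  apply: le_trans (h _) _; first by rewrite (hw s s2).1 (hw t t2).1.
  apply: (@le_trans _ _ (c / (L + 1) * (L * `|s - t|))).
    by rewrite ler_wpM2l ?gaL// ltW.
  have L1 : (L + 1)^-1 * L <= 1 by rewrite mulrC ler_pdivrMr ?mul1r ?lerDl// ltr_wpDl.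
  rewrite mulrA ler_wpM2r// -mulrA ler_piMr//; exact: ltW.
have in2 (t : R) : t \in `[0, 1] -> `|t| < 2.
  rewrite in_itv /= => /andP[t0 t1]; rewrite ger0_norm//.
  by apply: le_lt_trans t1 _; rewrite ltr1n.
have [t t01||t _] := @MVT_segment R (f \o ga) (fun=> 0) 0 1 ler01.
- by apply/der/in2; move: t01; rewrite !in_itv /= => /andP[/ltW -> /ltW ->].
- apply: continuous_in_subspaceT => t; rewrite inE /= => t01.
  apply: differentiable_continuous; apply/derivable1_diffP.
  by have [] := der t (in2 t t01).
by rewrite mul0r /= ga0 ga1 => /eqP; rewrite subr_eq0 => /eqP.
Qed.

(** The slice equation at [z = p]. The linear bound on the lift, rather than mere openness of [phi],
    is what carries differentiability down. *)
Lemma submersion_lift m n (phi : 'rV[R]_m -> 'rV[R]_n) p (K : 'M[R]_(n, m)) :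
  smooth_at phi p -> (forall w, 'd phi p (w *m K) = w) ->
  exists2 C : R, 0 < C & \forall c \near phi p, exists q, phi q = c /\ `|q - p| <= C * `|c - phi p|.
Proof.
move=> sphi phiK.
have [k k0 hk] := linear_bound (mulmxr K : {linear 'rV[R]_n -> 'rV[R]_m}).
have [C C0 [d d0 [_ /(_ _ d0) [d' d'0 solve]]]] := submersion_slice sphi phiK.
exists (k * C); first by rewrite mulr_gt0.
apply: filterS (near_ball _ d'0) => c cd; have [|w [w1 _ w2]] := solve p c _ cd.
  by rewrite subrr normr0.
exists (p + w *m K); split=> //; rewrite addrC addKr; apply: le_trans (hk _) _.
by rewrite -mulrA ler_pM2l// distrC.
Qed.

(** The candidate derivative of [f] is [G (_ *m K)], with [G] the differential of [f \o phi]. A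
    point [y] near [phi p] is lifted to [q] with [|q - p| <= C * |y - phi p|], so an error small
    against [|q - p|] is small against [|y - phi p|]. *)
Lemma submersion_descend m n (phi : 'rV[R]_m -> 'rV[R]_n) (f : 'rV[R]_n -> R) p (K : 'M[R]_(n, m)) :
  smooth_at phi p -> (forall w, 'd phi p (w *m K) = w) ->
  differentiable (f \o phi) p -> differentiable f (phi p).
Proof.
move=> sphi phiK dg; set g := f \o phi in dg.
have dphi := smooth_at_differentiable sphi.
have [C C0 lift] := submersion_lift sphi phiK.
have [k k0 hk] := linear_bound (mulmxr K : {linear 'rV[R]_n -> 'rV[R]_m}).
have [b b0 gb] := diff_lipschitz_at dg.
have np := fun c => diff_near (e := c) dphi; have ng := fun c => diff_near (e := c) dg.
have [a a0 ha] := linear_bound ('d g p).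
move: ('d phi p) ('d g p) phiK np ng ha => D G phiK np ng ha.
have gq (P : set 'rV[R]_m) : (\forall q \near p, P q) ->
    \forall c \near phi p, exists q, [/\ phi q = c, `|q - p| <= C * `|c - phi p| & P q].
  move=> /near_ballP [d d0 dP].
  have dC : 0 < d / C by rewrite divr_gt0.
  apply: filterS (filterI lift (near_ball (phi p) dC)) => c [[q [q1 q2]] cd]; exists q; split=> //.
  by apply: dP; apply: le_lt_trans q2 _; rewrite mulrC -ltr_pdivlMr.
(* If [D v = 0], then [phi (p + t v)] differs from [phi p] by a term of smaller order than [t]. Its
   lift [q] is equally close to [p] and [g] takes the same value at [q] as at [p + t v], so
   [t *: G v] is of smaller order than [t]. *)
have ker v : D v = 0 -> G v = 0.
  move=> Dv; have [->|v0] := eqVneq v 0; first by rewrite linear0.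
  apply/eqP; rewrite -normr_le0; apply/ler_addgt0Pl => e e0; rewrite addr0.
  pose c := e / ((1 + b * C) * `|v|).
  have den0 : 0 < 1 + b * C by rewrite addr_gt0// mulr_gt0.
  have v0' : 0 < `|v| by rewrite normr_gt0.
  have c0 : 0 < c by rewrite divr_gt0// mulr_gt0.
  have cphi := differentiable_continuous dphi.
  have h := near_and (np c c0) (near_and (ng c c0) (cphi _ (gq _ gb))).
  have [d d0 hd] := near_ballP h.
  pose t := d / (2 * `|v|).
  have t0 : 0 < t by rewrite divr_gt0// mulr_gt0.
  have ptd : `|p + t *: v - p| < d.
    rewrite addrC addKr normrZ gtr0_norm// /t invfM mulrA mulfVK ?gt_eqF//.
    by rewrite ltr_pdivrMr// ltr_pMr// ltr1n.
  have ptE : p + t *: v - p = t *: v by rewrite addrC addKr.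
  have Dt : D (t *: v) = 0 by rewrite linearZ /= Dv scaler0.
  have [h1 [h2 [q [q1 q2 q3]]]] := hd _ ptd.
  rewrite ptE Dt subr0 normrZ (gtr0_norm t0) in h1.
  rewrite ptE normrZ (gtr0_norm t0) in h2.
  have gE : g q = g (p + t *: v) by rewrite /g /= q1.
  rewrite gE in q3.
  have h4 : `|t *: G v| <= c * (t * `|v|) + b * (C * (c * (t * `|v|))).
    have -> : t *: G v = (g (p + t *: v) - g p) - (g (p + t *: v) - g p - G (t *: v)).
      by rewrite subKr linearZ.
    apply: le_trans (ler_normB _ _) _; rewrite addrC; apply: lerD => //.
    apply: le_trans q3 _; rewrite ler_pM2l//; apply: le_trans q2 _.
    by rewrite ler_pM2l.
  rewrite normrZ (gtr0_norm t0) in h4.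
  have h5 : c * (t * `|v|) + b * (C * (c * (t * `|v|))) = t * e.
    by rewrite /c; field; rewrite !gt_eqF.
  by move: h4; rewrite h5 ler_pM2l.
have GE v : G v = G (D v *m K).
  apply/eqP; rewrite -subr_eq0 -linearB; apply/eqP/ker.
  by rewrite linearB /= phiK subrr.
pose L : {linear 'rV[R]_n -> R} := G \o (mulmxr K : {linear 'rV[R]_n -> 'rV[R]_m}).
suff [] : is_diff (phi p) f L by [].
apply: is_diff_near; first exact: linear_rV_continuous.
move=> e e0.
pose c := e / ((1 + a * k) * C).
have den0 : 0 < 1 + a * k by rewrite addr_gt0// mulr_gt0.
have c0 : 0 < c by rewrite divr_gt0// mulr_gt0.
apply: filterS (gq _ (filterI (np c c0) (ng c c0))) => y [q [qy qC [h1 h2]]].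
rewrite -qy /= in h1 h2 qC *.
have -> : f (phi q) - f (phi p) - G ((phi q - phi p) *m K)
    = g q - g p - G (q - p) - G ((phi q - phi p - D (q - p)) *m K).
  have alg (A X Y Z : R) : Z = X - Y -> A - X = A - Y - Z by move=> ->; ring.
  by apply: alg; rewrite (GE (q - p)) mulmxBl linearB.
have h3 : `|G ((phi q - phi p - D (q - p)) *m K)| <= a * (k * (c * `|q - p|)).
  apply: le_trans (ha _) _; rewrite ler_pM2l//; apply: le_trans (hk _) _.
  by rewrite ler_pM2l.
apply: le_trans (ler_normB _ _) _; apply: le_trans (lerD h2 h3) _.
have -> : c * `|q - p| + a * (k * (c * `|q - p|)) = (c * (1 + a * k)) * `|q - p| by ring.
have -> : e * `|phi q - phi p| = (c * (1 + a * k)) * (C * `|phi q - phi p|).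
  by rewrite /c; field; rewrite !gt_eqF.
by rewrite ler_pM2l// mulr_gt0.
Qed.

End Submersions.

(** * Matrices with smooth entries and descent of smoothness *)

Section SmoothMatrices.
Context {R : realType}.

Lemma smooth_at_det n k (A : 'rV[R]_n -> 'M[R]_k) x :
  (forall i j, smooth_at (fun y => A y i j) x) -> smooth_at (fun y => \det (A y)) x.
Proof.
move=> sA; rewrite /determinant; apply: smooth_at_sum => s _.
by apply: smooth_atM; [exact: smooth_at_cst|apply: smooth_at_prod].
Qed.

Lemma near_neq0 (V : normedModType R) (f : V -> R) x :
  {for x, continuous f} -> f x != 0 -> \forall y \near x, f y != 0.
Proof.
move=> cf fx0; apply: (cf [set z | z != 0]); apply: open_nbhs_nbhs.
by split=> //; exact: open_neq.
Qed.

Lemma near_unitmx n k (A : 'rV[R]_n -> 'M[R]_k) x :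
  (forall i j, smooth_at (fun y => A y i j) x) -> A x \in unitmx ->
  \forall y \near x, A y \in unitmx.
Proof.
move=> sA Ax; have sd := smooth_at_det sA.
have cd := differentiable_continuous (smooth_at_differentiable sd).
have d0 : \det (A x) != 0 by rewrite -unitfE -unitmxE.
by apply: filterS (near_neq0 cd d0) => y; rewrite unitmxE unitfE.
Qed.

Lemma smooth_at_invmx n k (A : 'rV[R]_n -> 'M[R]_k) x :
  (forall i j, smooth_at (fun y => A y i j) x) -> A x \in unitmx ->
  forall i j, smooth_at (fun y => invmx (A y) i j) x.
Proof.
move=> sA Ax i j.
apply: (@smooth_at_eq _ _ _ (fun y => (\det (A y))^-1 * cofactor (A y) j i)).
  by apply: filterS (near_unitmx sA Ax) => y; rewrite /invmx => ->; rewrite !mxE.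
apply: smooth_atM.
  by apply: smooth_at_inv; [rewrite -unitfE -unitmxE|exact: smooth_at_det].
apply: smooth_atM; first exact: smooth_at_cst.
apply: smooth_at_det => i' j'; apply: smooth_at_eq (sA (lift j i') (lift i j')).
by apply: near_all => y; rewrite !mxE.
Qed.

(* The partial derivatives of [f], composed with [phi], are smooth combinations of those of [f \o phi]. *)
Lemma smooth_at_descend m n (phi : 'rV[R]_m -> 'rV[R]_n) (f : 'rV[R]_n -> R) x (K : 'M[R]_(n, m)) :
  smooth_at phi x -> (forall w, 'd phi x (w *m K) = w) ->
  smooth_at (f \o phi) x -> smooth_at f (phi x).
Proof.
move=> sphi phiK sf.
pose J y : 'M[R]_(m, n) := \matrix_(i, j) 'D_(delta_mx 0 i) (fun z => phi z 0 j) y.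
have sphij j y : smooth_at phi y -> smooth_at (fun z => phi z 0 j) y by move/smooth_at_row.
have dJ y v : smooth_at phi y -> 'd phi y v = v *m J y.
  move=> sy; apply/rowP => j; rewrite diff_coord; last exact: smooth_at_differentiable.
  have dj : differentiable (fun z => phi z 0 j) y by exact/smooth_at_differentiable/sphij.
  by rewrite (diff_partial _ dj) !mxE; apply: eq_bigr => i _; rewrite mxE.
have sJ i j y : smooth_at phi y -> smooth_at (fun z => J z i j) y.
  move=> sy; apply: smooth_at_eq (smooth_at_partial i (sphij j y sy)).
  by apply: near_all => z; rewrite mxE.
pose P y := K *m J y.
have sP i j y : smooth_at phi y -> smooth_at (fun z => P z i j) y.
  move=> sy; apply: (@smooth_at_eq _ _ _ (fun z => \sum_l K i l * J z l j)).
    by apply: near_all => z; rewrite mxE.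
  by apply: smooth_at_sum => l _; apply: smooth_atM; [exact: smooth_at_cst|exact: sJ].
have P1 : P x = 1%:M.
  by apply/row_matrixP => i; rewrite !rowE mulmx1 /P mulmxA -dJ.
have Px : P x \in unitmx by rewrite P1 unitmx1.
have near_ok : \forall y \near x, smooth_at phi y /\ (P y \in unitmx /\ smooth_at (f \o phi) y).
  apply: near_and (smooth_at_near sphi) (near_and _ (smooth_at_near sf)).
  by apply: near_unitmx => // i j; exact: sP.
move: near_ok => /near_openP [U [oU Ux hU]].
(* At [x] the product [K *m J] is the identity, so it is invertible nearby; normalising [K] by its
   inverse yields a right inverse of the differential of [phi] that depends smoothly on the
   point. *)
pose K' y := invmx (P y) *m K.
have phiK' y w : U y -> 'd phi y (w *m K' y) = w.
  by move=> /hU [sy [Py _]]; rewrite dJ// /K' -!mulmxA mulVmx// mulmx1.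
have sK' i j y : U y -> smooth_at (fun z => K' z i j) y.
  move=> /hU [sy [Py _]].
  apply: (@smooth_at_eq _ _ _ (fun z => \sum_l invmx (P z) i l * K l j)).
    by apply: near_all => z; rewrite mxE.
  apply: smooth_at_sum => l _; apply: smooth_atM; last exact: smooth_at_cst.
  by apply: smooth_at_invmx => // a b; exact: sP.
have openU y : U y -> \forall c \near phi y, exists2 z, U z & phi z = c.
  move=> Uy; have [sy _] := hU y Uy.
  have [C C0 lift] := submersion_lift sy (fun w => phiK' y w Uy).
  have [d d0 dU] := near_ballP (open_nbhs_nbhs (conj oU Uy)).
  have dC : 0 < d / C by rewrite divr_gt0.
  apply: filterS (near_and lift (near_ball (phi y) dC)) => c [[q [q1 q2]] cd].
  by exists q => //; apply: dU; apply: le_lt_trans q2 _; rewrite mulrC -ltr_pdivlMr.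
apply/smooth_atP; exists (phi @` U); split; last first.
- move=> k; elim: k f sf hU => [|k IH] f sf hU.
    split=> // _ [y Uy <-]; have [sy [_ sfy]] := hU y Uy.
    by apply: (submersion_descend sy (fun w => phiK' y w Uy)); exact: smooth_at_differentiable.
  have df y : U y -> differentiable f (phi y).
    move=> Uy; have [sy [_ sfy]] := hU y Uy.
    by apply: (submersion_descend sy (fun w => phiK' y w Uy)); exact: smooth_at_differentiable.
  split=> [_ [y Uy <-]|i]; first exact: df.
  have sDi y : U y -> smooth_at ('D_(delta_mx 0 i) f \o phi) y.
    move=> Uy; have [sy [Py sfy]] := hU y Uy.
    apply: (@smooth_at_eq _ _ _ (fun z => \sum_j K' z i j * 'D_(delta_mx 0 j) (f \o phi) z)).
      apply: filterS (open_nbhs_nbhs (conj oU Uy)) => z Uz.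
      have [sz [Pz sfz]] := hU z Uz.
      have dz := smooth_at_differentiable sz.
      apply/esym; rewrite /= (deriveE _ (df z Uz)) -{1}(phiK' z (delta_mx 0 i) Uz).
      have -> : 'd f (phi z) ('d phi z (delta_mx 0 i *m K' z)) = 'd (f \o phi) z (delta_mx 0 i *m K' z).
        by rewrite (diff_comp dz (df z Uz)).
      rewrite (diff_partial _ (smooth_at_differentiable sfz)).
      by apply: eq_bigr => j _; rewrite -rowE mxE.
    apply: smooth_at_sum => j _; apply: smooth_atM; first exact: sK'.
    exact: smooth_at_partial.
  apply: IH => [|y Uy]; first exact: sDi.
  by have [sy [Py _]] := hU y Uy; split=> //; split=> //; exact: sDi.
- by exists x.
rewrite openE => _ [y Uy <-]; apply: filterS (openU y Uy) => c [z Uz <-].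
by exists z.
Qed.

End SmoothMatrices.

(** * Bump functions *)

Section Bump.
Context {R : realType}.

(* The derivatives of [exp (- 1 / t)] are linear combinations of these functions. *)
Definition flat (j : nat) (t : R) : R := if 0 < t then t^-1 ^+ j * expR (- t^-1) else 0.

(** From [expR (u / k) >= u / k] one gets [expR u >= (u / k) ^+ k], taken at [u = t^-1]. The choice
    [k = j + 2] leaves the factor [t ^+ 2], which makes the derivative at 0 exist and vanish. *)
Lemma flat_bound j : exists2 C : R, 0 < C & forall t, `|flat j t| <= C * `|t| ^+ 2.
Proof.
pose k := j.+2; exists (k%:R ^+ k); first by rewrite exprn_gt0// ltr0n.
move=> t; rewrite /flat; case: ifPn => t0; last by rewrite normr0 mulr_ge0// ?exprn_ge0// ler0n.
have u0 : 0 < t^-1 by rewrite invr_gt0.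
have h1 : (t^-1 / k%:R) ^+ k <= expR t^-1.
  have -> : t^-1 = k%:R * (t^-1 / k%:R) by rewrite mulrCA mulfV ?mulr1 ?pnatr_eq0.
  rewrite [k%:R * _ / _]mulrAC mulfV ?mul1r ?pnatr_eq0// expRM_natl.
  apply: lerXn2r; rewrite ?nnegrE ?expR_ge0 ?divr_ge0 ?ler0n ?ltW//.
  by apply: lt_le_trans (expR_ge1Dx _); rewrite ltrDr ltr01.
rewrite ger0_norm; last by rewrite mulr_ge0 ?expR_ge0// exprn_ge0// ltW.
rewrite expRN ler_pdivrMr ?expR_gt0// (gtr0_norm t0).
have -> : t^-1 ^+ j = k%:R ^+ k * t ^+ 2 * (t^-1 / k%:R) ^+ k.
  rewrite [k%:R ^+ k * _]mulrC -mulrA -exprMn [k%:R * _]mulrC divfK ?pnatr_eq0//.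
  rewrite /k !exprS; move: (t^-1 ^+ j) => a; rewrite expr0; field.
  by rewrite gt_eqF.
by rewrite ler_pM2l// mulr_gt0// exprn_gt0// ltr0n.
Qed.

Lemma is_derive_flat j (t : R) : is_derive t 1 (flat j) (- j%:R * flat j.+1 t + flat j.+2 t).
Proof.
have [t0|t0|->] := ltgtP t 0.
- rewrite {2 3}/flat !ltNge !(ltW t0) /= mulr0 addr0.
  have d0 : is_derive t 1 (fun _ : R => 0 : R) 0 by exact: is_derive_cst.
  apply: near_eq_is_derive d0.
  by apply: filterS (lt_nbhsl t0) => s s0; rewrite /flat ltNge (ltW s0).
- rewrite {2 3}/flat t0.
  have tn0 : t != 0 by rewrite gt_eqF.
  apply: (@near_eq_is_derive _ _ _ ((fun s : R => s^-1 ^+ j) * (expR \o (fun s : R => - s^-1)))).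
    by apply: filterS (lt_nbhsr t0) => s s0; rewrite /flat s0.
  have dV : is_derive t 1 (fun s : R => s^-1) (- t ^- 2).
    by apply: is_derive_eq; [exact: is_deriveV|rewrite /GRing.scale /= mulr1].
  have dVj : is_derive t 1 (fun s : R => s^-1 ^+ j) (j%:R * t^-1 ^+ j.-1 * - t ^- 2).
    have -> : (fun s : R => s^-1 ^+ j) = (fun s : R => s^-1) ^+ j.
      by apply/funext => s; elim: (j) => [|l IH]; rewrite ?expr0// !exprS IH.
    exact: is_deriveX.
  have dE : is_derive t 1 (expR \o (fun s : R => - s^-1)) (expR (- t^-1) * t ^- 2).
    apply: is_derive1_comp; rewrite -[X in is_derive _ _ _ X]opprK; exact: is_deriveN.
  apply: is_derive_eq; rewrite /GRing.scale /=.
  rewrite -!exprVn; case: j dVj => [|j] _ /=; first by rewrite expr0; ring.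
  by rewrite !exprS; ring.
- have [C C0 hC] := flat_bound j.
  rewrite /flat !ltxx mulr0 addr0; apply: is_derive_zero => e e0.
  have eC : 0 < e / C by rewrite divr_gt0.
  apply: filterS (near_ball (0 : R) eC) => s; rewrite !subr0 ltxx subr0 => sC.
  apply: le_trans (hC s) _; rewrite expr2 mulrA ler_wpM2r//.
  by rewrite mulrC -ler_pdivlMr// ltW.
Qed.

(** The family [flat j] is closed under differentiation up to linear combinations, so all [j] are
    treated together in the induction on the order. *)
Lemma Ck_flat k j n (U : set 'rV[R]_n) (q : 'rV[R]_n -> R) :
  open U -> Ck k U q -> Ck k U (flat j \o q).
Proof.
move=> oU; elim: k j => [|k IH] j Cq; have [dq dqk] := Cq.
  split=> // x Ux; apply: differentiable_comp; first exact: dq.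
  by apply/derivable1_diffP; have [] := is_derive_flat j (q x).
have dflat (t : R) : differentiable (flat j) t.
  by apply/derivable1_diffP; have [] := is_derive_flat j t.
split=> [x Ux|i]; first by apply: differentiable_comp; [exact: dq|exact: dflat].
apply: (@Ck_eq _ _ _ _ _ (fun x => (- j%:R * (flat j.+1 \o q) x + (flat j.+2 \o q) x) * 'D_(delta_mx 0 i) q x)) => // [x Ux|].
  have dqx := dq x Ux.
  rewrite (deriveE _ (differentiable_comp dqx (dflat (q x)))) (diff_comp dqx (dflat (q x))) /=.
  have [_ <-] := is_derive_flat j (q x).
  rewrite (deriveE _ dqx) (deriveE _ (dflat (q x))).
  move: ('d q x _) => h; rewrite mulrC -[h in RHS]mulr1.
  by rewrite -[h * 1]/(h *: (1 : R)) linearZ.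
apply: Ck_mul => //; last exact: dqk.
apply: Ck_add => //; last by apply: IH; exact: CkS.
by apply: Ck_mul => //; [exact: Ck_cst|apply: IH; exact: CkS].
Qed.

(** The function [q] is [(e / 2) ^+ 2] minus the squared Euclidean distance to [x0], and [b] is
    [flat 0 \o q] normalised at [x0]. The support condition concerns the maximum norm, which the
    Euclidean one dominates. *)
Lemma bump_exists n (x0 : 'rV[R]_n) (e : R) : 0 < e ->
  exists b : 'rV[R]_n -> R, [/\ forall x, smooth_at b x, b x0 = 1 &
    forall x, b x != 0 -> `|x - x0| < e].
Proof.
move=> e0; pose q (x : 'rV[R]_n) : R := (e / 2) ^+ 2 + \sum_i -1 * ((x 0 i + - x0 0 i) * (x 0 i + - x0 0 i)).
have sq x : smooth_at q x.
  apply: smooth_atD; first exact: smooth_at_cst.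
  have sc i : smooth_at (fun y : 'rV[R]_n => y 0 i + - x0 0 i) x.
    by apply: smooth_atD; [exact: smooth_at_coord|exact: smooth_at_cst].
  apply: smooth_at_sum => i _; apply: smooth_atM; first exact: smooth_at_cst.
  exact: smooth_atM.
have sf x : smooth_at (flat 0 \o q) x.
  have /smooth_atP [U [oU Ux Uq]] := sq x.
  by apply/smooth_atP; exists U; split=> // k; exact: Ck_flat.
have e2 : 0 < e / 2 by rewrite divr_gt0.
have f0 : flat 0 (q x0) != 0.
  rewrite /flat /q big1 ?addr0; last by move=> i _; rewrite subrr mulr0 mulr0.
  by rewrite exprn_gt0// expr0 mul1r gt_eqF ?expR_gt0.
exists (fun x => (flat 0 (q x0))^-1 * (flat 0 \o q) x); split.
- by move=> x; apply: smooth_atM => //; exact: smooth_at_cst.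
- by rewrite /= mulVf.
move=> x; rewrite mulf_eq0 negb_or => /andP[_] /=; rewrite /flat; case: ifPn; rewrite ?eqxx// => q0 _.
apply: (@le_lt_trans _ _ (e / 2)); last by rewrite ltr_pdivrMr// ltr_pMr ?ltr1n.
apply: rV_norm_le => [|i]; first exact: ltW.
rewrite -(@ler_pXn2r _ 2)// ?nnegrE ?ltW// real_normK ?num_real// !mxE.
move: q0; rewrite /q (bigD1 i)//= => q0.
have : \sum_(j < n | j != i) -1 * ((x 0 j + - x0 0 j) * (x 0 j + - x0 0 j)) <= 0.
  by apply: sumr_le0 => j _; rewrite mulN1r oppr_le0 -expr2 sqr_ge0.
rewrite expr2; lra.
Qed.

End Bump.

(** * Functions and vector fields on manifolds *)

Section Manifolds.
Context {R : realType}.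

Section OneManifold.
Context {n : nat} {M : manifold R n}.
Implicit Types (p q : M) (c d : chart R n M) (f g : M -> R).

Lemma cmap_near c p (P : set 'rV[R]_n) : cdom c p ->
  (\forall y \near cmap c p, P y) -> \forall q \near p, P (cmap c q).
Proof.
move=> cp; have := @cmap_continuous _ _ _ c.
by rewrite (continuous_open_subspace _ (cdom_open c)) => /(_ p (mem_set cp)) cc /cc.
Qed.

Lemma cdom_near c p : cdom c p -> \forall q \near p, cdom c q.
Proof. by move=> cp; apply: open_nbhs_nbhs; split=> //; exact: cdom_open. Qed.

Lemma cinv_near c p (Q : set M) : cdom c p -> (\forall q \near p, Q q) ->
  \forall y \near cmap c p, exists q, [/\ cdom c q, Q q & y = cmap c q].
Proof.
move=> cp Qp; have := @cinv_continuous _ _ _ c.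
have cpi : (cmap c @` cdom c) (cmap c p) by exists p.
rewrite (continuous_open_subspace _ (@cimage_open _ _ _ c)) => /(_ _ (mem_set cpi)) cc.
have h1 : \forall y \near cmap c p, Q (cinv c y).
  by apply: (cc Q); rewrite /= cmapK.
have h2 : \forall y \near cmap c p, (cmap c @` cdom c) y.
  by apply: open_nbhs_nbhs; split=> //; exact: (@cimage_open _ _ _ c).
apply: filterS (near_and h1 h2) => y [Qy [q cq qy]]; exists q; split=> //.
by move: Qy; rewrite -qy cmapK.
Qed.

Lemma cinv_eq_near c p (W : Type) (F G : M -> W) : cdom c p ->
  (\forall q \near p, F q = G q) -> \forall y \near cmap c p, F (cinv c y) = G (cinv c y).
Proof.
move=> cp /(cinv_near cp); apply: filterS => y [q [cq FG ->]].
by rewrite cmapK.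
Qed.

Lemma transition_smooth c d p : atlas c -> atlas d -> cdom c p -> cdom d p ->
  smooth_at (cmap d \o cinv c) (cmap c p).
Proof.
move=> ac ad cp dp; have h := atlas_compatible ac ad.
have : \forall y \near cmap c p, exists q, [/\ cdom c q, cdom c q /\ cdom d q & y = cmap c q].
  by apply: cinv_near => //; apply: near_and; exact: cdom_near.
by apply: filterS => y [q [cq dq ->]] s; apply: h; exists q.
Qed.

Definition smooth_fun_at f p := smooth_at (f \o cinv (chart_at p)) (cmap (chart_at p) p).

Lemma change_chart f c d p : atlas c -> atlas d -> cdom c p -> cdom d p ->
  smooth_at (f \o cinv c) (cmap c p) -> smooth_at (f \o cinv d) (cmap d p).
Proof.
move=> ac ad cp dp sf.
apply: (@smooth_at_eq _ _ _ ((f \o cinv c) \o (cmap c \o cinv d))).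
  have := cinv_near dp (cdom_near cp); apply: filterS => y [q [dq cq ->]] /=.
  by rewrite cmapK// cmapK.
apply: smooth_at_comp; first exact: transition_smooth.
by rewrite /= cmapK.
Qed.

Lemma smooth_fun_at_chart f c p : atlas c -> cdom c p -> smooth_fun_at f p <-> smooth_at (f \o cinv c) (cmap c p).
Proof.
move=> ac cp; split; apply: change_chart => //; try exact: chart_at_atlas; exact: chart_at_dom.
Qed.

Lemma smooth_fun_at_eq f g p : (\forall q \near p, f q = g q) -> smooth_fun_at f p -> smooth_fun_at g p.
Proof.
by move=> fg; apply: smooth_at_eq; apply: cinv_eq_near => //; exact: chart_at_dom.
Qed.

Lemma smooth_fun_at_near f p : smooth_fun_at f p -> \forall q \near p, smooth_fun_at f q.
Proof.
move=> sf; have cp := chart_at_dom p; have := smooth_at_near sf.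
move=> /(cmap_near cp) h; apply: filterS (near_and h (cdom_near cp)) => q [sq cq].
by apply/(smooth_fun_at_chart _ (chart_at_atlas p)).
Qed.

Lemma smooth_fun_at_cst (a : R) p : smooth_fun_at (fun=> a) p.
Proof. exact: smooth_at_cst. Qed.

Lemma smooth_fun_atD f g p : smooth_fun_at f p -> smooth_fun_at g p -> smooth_fun_at (fun q => f q + g q) p.
Proof. exact: smooth_atD. Qed.

Lemma smooth_fun_atM f g p : smooth_fun_at f p -> smooth_fun_at g p -> smooth_fun_at (fun q => f q * g q) p.
Proof. exact: smooth_atM. Qed.

Lemma smooth_fun_atB f g p : smooth_fun_at f p -> smooth_fun_at g p -> smooth_fun_at (fun q => f q - g q) p.
Proof.
move=> sf sg; apply: (@smooth_fun_at_eq (fun q => f q + -1 * g q)).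
  by apply: near_all => q; rewrite mulN1r.
by apply: smooth_fun_atD => //; apply: smooth_fun_atM => //; exact: smooth_fun_at_cst.
Qed.

Lemma smooth_fun_at_sum (I : Type) (r : seq I) (P : pred I) (f : I -> M -> R) p :
  (forall i, P i -> smooth_fun_at (f i) p) -> smooth_fun_at (fun q => \sum_(i <- r | P i) f i q) p.
Proof. by move=> sf; exact: smooth_at_sum. Qed.

Lemma smooth_fun_at_of_chart (g : 'rV[R]_n -> R) c p : atlas c -> cdom c p ->
  smooth_at g (cmap c p) -> smooth_fun_at (g \o cmap c) p.
Proof.
move=> ac cp sg; apply/(smooth_fun_at_chart _ ac cp); apply: smooth_at_eq sg.
have := cinv_near cp (cdom_near cp); apply: filterS => y [q [_ cq ->]] /=.
by rewrite cmapK.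
Qed.

Lemma smooth_fun_at_coord c p k : atlas c -> cdom c p -> smooth_fun_at (fun q => cmap c q 0 k) p.
Proof.
by move=> ac cp; apply: (smooth_fun_at_of_chart (g := fun y : 'rV[R]_n => y 0 k)) => //; exact: smooth_at_coord.
Qed.

Lemma image_open c (U : set M) : open U -> open (cmap c @` (cdom c `&` U)).
Proof.
move=> oU; rewrite openE => _ [q [cq Uq] <-].
have : \forall q' \near q, U q' by apply: open_nbhs_nbhs.
move=> /(cinv_near cq); apply: filterS => y [q' [cq' Uq' ->]].
by exists q'.
Qed.

Lemma smooth_funP (U : set M) f : open U -> smooth_fun U f <-> forall p, U p -> smooth_fun_at f p.
Proof.
move=> oU; split=> [sf p Up|sf c ac].
  have := sf _ (chart_at_atlas p); rewrite (smooth_onE _ (image_open oU)).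
  by apply; exists p => //; split=> //; exact: chart_at_dom.
apply/(smooth_onE _ (image_open oU)) => _ [p [cp Up] <-].
by apply/smooth_fun_at_chart => //; exact: sf.
Qed.

Lemma smooth_fun_rowP k (U : set M) (f : M -> 'rV[R]_k) : open U ->
  smooth_fun U f <-> forall p j, U p -> smooth_fun_at (fun q => f q 0 j) p.
Proof.
move=> oU; split=> [sf p j Up|sf c ac].
  have := sf _ (chart_at_atlas p); rewrite (smooth_onE _ (image_open oU)).
  move=> /(_ (cmap (chart_at p) p)) h; apply: (smooth_at_row _ _).1.
  by apply: h; exists p => //; split=> //; exact: chart_at_dom.
apply/(smooth_onE _ (image_open oU)) => _ [p [cp Up] <-].
by apply/smooth_at_row => j; apply/(smooth_fun_at_chart (fun q => f q 0 j)) => //; exact: sf.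
Qed.

Lemma smooth_fun_at_differentiable f c p : atlas c -> cdom c p -> smooth_fun_at f p ->
  differentiable (f \o cinv c) (cmap c p).
Proof. by move=> ac cp /(smooth_fun_at_chart _ ac cp); exact: smooth_at_differentiable. Qed.

Lemma cmap_differentiable c d p : atlas c -> atlas d -> cdom c p -> cdom d p ->
  differentiable (cmap d \o cinv c) (cmap c p).
Proof. by move=> *; apply: smooth_at_differentiable; exact: transition_smooth. Qed.

Lemma near_diff (V W : normedModType R) (f g : V -> W) (x v : V) :
  (\forall y \near x, f y = g y) -> differentiable f x -> 'd f x v = 'd g x v.
Proof.
move=> fg df; rewrite -(deriveE _ df) (near_eq_derive _ fg).
by rewrite deriveE//; exact: near_eq_differentiable fg df.
Qed.

Lemma dfun_chart f c p v : atlas c -> cdom c p -> smooth_fun_at f p ->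
  dfun f p v = 'd (f \o cinv c) (cmap c p) (dfun (cmap c) p v).
Proof.
move=> ac cp sf; rewrite /dfun.
have a0 := chart_at_atlas p; have d0 := chart_at_dom p.
have dt := cmap_differentiable a0 ac d0 cp.
have df : differentiable (f \o cinv c) ((cmap c \o cinv (chart_at p)) (cmap (chart_at p) p)).
  by rewrite /= cmapK//; exact: smooth_fun_at_differentiable.
have E : 'd ((f \o cinv c) \o (cmap c \o cinv (chart_at p))) (cmap (chart_at p) p) v
   = 'd (f \o cinv c) ((cmap c \o cinv (chart_at p)) (cmap (chart_at p) p))
        ('d (cmap c \o cinv (chart_at p)) (cmap (chart_at p) p) v).
  exact: (congr1 (fun L => L v) (diff_comp dt df)).
rewrite [in RHS](_ : cmap c p = (cmap c \o cinv (chart_at p)) (cmap (chart_at p) p)); last by rewrite /= cmapK.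
apply: etrans _ E; apply: near_diff; last first.
  by apply: smooth_fun_at_differentiable; [exact: a0|exact: d0|exact: sf].
have := cinv_near d0 (cdom_near cp); apply: filterS => y [q [dq cq ->]] /=.
by rewrite cmapK// cmapK.
Qed.

Lemma dfun_partial f c p v : atlas c -> cdom c p -> smooth_fun_at f p ->
  dfun f p v = \sum_k dfun (cmap c) p v 0 k * 'D_(delta_mx 0 k) (f \o cinv c) (cmap c p).
Proof.
by move=> ac cp sf; rewrite (dfun_chart _ ac cp sf) diff_partial//; exact: smooth_fun_at_differentiable.
Qed.

Lemma dfun_row k (f : M -> 'rV[R]_k) p v j : (forall j, smooth_fun_at (fun q => f q 0 j) p) ->
  dfun f p v 0 j = dfun (fun q => f q 0 j) p v.
Proof.
move=> sf; rewrite /dfun diff_coord//; apply/differentiable_rowP => i.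
by apply: (@smooth_fun_at_differentiable (fun q => f q 0 i)) => //; [exact: chart_at_atlas|exact: chart_at_dom].
Qed.

Lemma dfun_cmap c p v j : atlas c -> cdom c p ->
  dfun (cmap c) p v 0 j = dfun (fun q => cmap c q 0 j) p v.
Proof. by move=> ac cp; apply: dfun_row => k; exact: smooth_fun_at_coord. Qed.

Lemma dfun_eq f g p v : (\forall q \near p, f q = g q) -> smooth_fun_at f p -> dfun f p v = dfun g p v.
Proof.
move=> fg sf; apply: near_diff; last first.
  by apply: smooth_fun_at_differentiable => //; [exact: chart_at_atlas|exact: chart_at_dom].
by apply: cinv_eq_near => //; exact: chart_at_dom.
Qed.

Lemma dfunD f g p v : smooth_fun_at f p -> smooth_fun_at g p -> dfun (fun q => f q + g q) p v = dfun f p v + dfun g p v.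
Proof.
move=> sf sg; rewrite /dfun.
have df := smooth_fun_at_differentiable (chart_at_atlas p) (chart_at_dom p) sf.
have dg := smooth_fun_at_differentiable (chart_at_atlas p) (chart_at_dom p) sg.
by rewrite -[RHS]/(('d _ _ \+ 'd _ _) v) -(diffD df dg).
Qed.

Lemma dfunM f g p v : smooth_fun_at f p -> smooth_fun_at g p ->
  dfun (fun q => f q * g q) p v = f p * dfun g p v + g p * dfun f p v.
Proof.
move=> sf sg; rewrite /dfun.
have df := smooth_fun_at_differentiable (chart_at_atlas p) (chart_at_dom p) sf.
have dg := smooth_fun_at_differentiable (chart_at_atlas p) (chart_at_dom p) sg.
rewrite -[(fun q => _) \o _]/((f \o cinv (chart_at p)) * (g \o cinv (chart_at p))).
apply: etrans (congr1 (fun L => L v) (diffM df dg)) _.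
by rewrite !fctE /= cmapK//; exact: chart_at_dom.
Qed.

Lemma dfun_cst (a : R) p v : dfun (fun _ : M => a) p v = 0.
Proof. by rewrite /dfun -[(fun _ => a) \o _]/(cst a) diff_cst. Qed.

Lemma dfun_sum (I : Type) (r : seq I) (f : I -> M -> R) p v :
  (forall i, smooth_fun_at (f i) p) -> dfun (fun q => \sum_(i <- r) f i q) p v = \sum_(i <- r) dfun (f i) p v.
Proof.
move=> sf; elim: r => [|i r IH].
  transitivity (dfun (fun _ : M => 0 : R) p v); last by rewrite dfun_cst big_nil.
  by congr (dfun _ p v); apply/funext => q; rewrite big_nil.
have -> : (fun q => \sum_(j <- i :: r) f j q) = (fun q => f i q + \sum_(j <- r) f j q).
  by apply/funext => q; rewrite big_cons.
rewrite big_cons -IH; apply: dfunD; first exact: sf.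
by apply: smooth_fun_at_sum => j _; exact: sf.
Qed.

Lemma dfun_chart_at p v : dfun (cmap (chart_at p)) p v = v.
Proof.
have a0 := chart_at_atlas p; have d0 := chart_at_dom p.
rewrite /dfun -[RHS](_ : 'd (@idfun 'rV[R]_n) (cmap (chart_at p) p) v = v); last by rewrite diff_val.
apply: near_diff; last exact: cmap_differentiable.
have := cinv_near d0 (cdom_near d0); apply: filterS => y [q [_ dq ->]] /=.
by rewrite cmapK.
Qed.

(** The coordinates of [chart_at p] already separate tangent vectors. Identities between vectors,
    such as Jacobi's, are thereby checked on functions. *)
Lemma tangent_ext p (v w : 'rV[R]_n) :
  (forall f, smooth_fun_at f p -> dfun f p v = dfun f p w) -> v = w.
Proof.
move=> h; rewrite -(dfun_chart_at p v) -(dfun_chart_at p w); apply/rowP => k.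
have a0 := chart_at_atlas p; have d0 := chart_at_dom p.
by rewrite !dfun_cmap//; apply: h; exact: smooth_fun_at_coord.
Qed.

Definition smooth_vf_at (E : vfield M) p :=
  forall c, atlas c -> cdom c p -> forall k, smooth_fun_at (fun q => vapp E (cmap c) q 0 k) p.

Lemma smooth_vfP (U : set M) E : open U -> smooth_vf U E <-> forall p, U p -> smooth_vf_at E p.
Proof.
move=> oU; split=> [sE p Up c ac cp k|sE c ac].
  have := sE c ac; rewrite smooth_fun_rowP; first by apply.
  by apply: openI => //; exact: cdom_open.
apply/smooth_fun_rowP; first by apply: openI => //; exact: cdom_open.
by move=> p j [cp Up]; exact: sE.
Qed.

Lemma smooth_fun_at_vapp (E : vfield M) f p : smooth_vf_at E p -> smooth_fun_at f p -> smooth_fun_at (vapp E f) p.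
Proof.
move=> sE sf; have a0 := chart_at_atlas p; have d0 := chart_at_dom p.
set c := chart_at p in a0 d0.
apply: (@smooth_fun_at_eq (fun q => \sum_k vapp E (cmap c) q 0 k * ('D_(delta_mx 0 k) (f \o cinv c) \o cmap c) q)).
  apply: filterS (near_and (smooth_fun_at_near sf) (cdom_near d0)) => q [sq cq].
  by rewrite /vapp (dfun_partial _ a0 cq sq).
apply: smooth_fun_at_sum => k _; apply: smooth_fun_atM; first exact: sE.
by apply: smooth_fun_at_of_chart => //; apply: smooth_at_partial; apply/(smooth_fun_at_chart _ a0 d0).
Qed.

Lemma vapp_partial (E : vfield M) f c p : atlas c -> cdom c p -> smooth_fun_at f p ->
  vapp E f p = \sum_k vapp E (fun q => cmap c q 0 k) p * 'D_(delta_mx 0 k) (f \o cinv c) (cmap c p).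
Proof.
move=> ac cp sf; rewrite /vapp (dfun_partial _ ac cp sf).
by apply: eq_bigr => k _; rewrite dfun_cmap.
Qed.

(** [bracket] is defined through the coordinates of one chart. For a general [f], each iterated
    derivative splits into a part linear in the first partials of [f], which matches the definition,
    and a Hessian part, which cancels in the difference by symmetry of second derivatives. *)
Lemma dfun_bracket (E F : vfield M) f p : smooth_vf_at E p -> smooth_vf_at F p -> smooth_fun_at f p ->
  dfun f p (bracket E F p) = vapp E (vapp F f) p - vapp F (vapp E f) p.
Proof.
move=> sE sF sf; have a0 := chart_at_atlas p; have d0 := chart_at_dom p.
set c := chart_at p in a0 d0.
pose x k q := cmap c q 0 k.
have sx k q : cdom c q -> smooth_fun_at (x k) q by move=> cq; exact: smooth_fun_at_coord.
have coord (G : vfield M) : smooth_vf_at G p -> forall (G' : vfield M) k,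
    vapp G' (vapp G (cmap c)) p 0 k = vapp G' (vapp G (x k)) p.
  move=> sG G' k; rewrite /vapp dfun_row; last first.
    by move=> j; have := sG c a0 d0 j.
  apply: dfun_eq; last exact: sG.
  by apply: filterS (cdom_near d0) => q cq; rewrite dfun_cmap.
pose D k := 'D_(delta_mx 0 k) (f \o cinv c).
have sf' : smooth_at (f \o cinv c) (cmap c p) by apply/(smooth_fun_at_chart _ a0 d0).
have sD k : smooth_fun_at (D k \o cmap c) p by apply: smooth_fun_at_of_chart => //; exact: smooth_at_partial.
have Dc k l : 'D_(delta_mx 0 l) ((D k \o cmap c) \o cinv c) (cmap c p) = 'D_(delta_mx 0 l) (D k) (cmap c p).
  apply: near_eq_derive.
  have := cinv_near d0 (cdom_near d0); apply: filterS => y [q [_ cq ->]] /=.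
  by rewrite cmapK.
have second (G G' : vfield M) : smooth_vf_at G p -> smooth_vf_at G' p -> vapp G' (vapp G f) p =
    \sum_k vapp G' (vapp G (x k)) p * D k (cmap c p) +
    \sum_k \sum_l vapp G (x k) p * (vapp G' (x l) p * 'D_(delta_mx 0 l) (D k) (cmap c p)).
  move=> sG sG'.
  have sGx k : smooth_fun_at (vapp G (x k)) p by apply: smooth_fun_at_vapp => //; exact: sx.
  rewrite {1}/vapp (@dfun_eq _ (fun q => \sum_k vapp G (x k) q * (D k \o cmap c) q)); last exact: smooth_fun_at_vapp.
    rewrite dfun_sum; last by move=> k; exact: smooth_fun_atM.
    rewrite -big_split /=; apply: eq_bigr => k _.
    have := dfunM (G' p) (sGx k) (sD k); rewrite /= => ->.
    rewrite [LHS]addrC; congr (_ + _); first by rewrite mulrC.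
    rewrite -mulr_sumr; congr (_ * _).
    rewrite -/(vapp G' (D k \o cmap c) p) (vapp_partial _ a0 d0 (sD k)).
    by apply: eq_bigr => l _; rewrite (Dc k l).
  apply: filterS (near_and (smooth_fun_at_near sf) (cdom_near d0)) => q [sq cq].
  exact: vapp_partial.
rewrite (second F E)// (second E F)//.
rewrite (dfun_partial _ a0 d0 sf) dfun_chart_at.
rewrite opprD addrACA -[LHS]addr0; congr (_ + _).
  rewrite -sumrB; apply: eq_bigr => k _; rewrite -mulrBl; congr (_ * _).
  by rewrite /bracket !mxE !coord.
apply/esym/eqP; rewrite subr_eq0 exchange_big /=; apply/eqP.
apply: eq_bigr => k _; apply: eq_bigr => l _.
by rewrite mulrCA (partial_commute _ _ sf').
Qed.

End OneManifold.
End Manifolds.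

(** * Coordinate fields and global extension of tangent vectors *)

Section Extension.
Context {R : realType} {n : nat} {M : manifold R n}.
Implicit Types (p q : M) (c d : chart R n M) (f g : M -> R).

(* Has constant components [w] in the chart [c]; meaningful only on [cdom c]. *)
Definition coordinate_vf c (w : 'rV[R]_n) : vfield M :=
  fun q => 'd (cmap (chart_at q) \o cinv c) (cmap c q) w.

Lemma vapp_coordinate c w f q : atlas c -> cdom c q -> smooth_fun_at f q ->
  vapp (coordinate_vf c w) f q = 'd (f \o cinv c) (cmap c q) w.
Proof.
move=> ac cq sf; have a0 := chart_at_atlas q; have d0 := chart_at_dom q.
rewrite /vapp /dfun /coordinate_vf.
have dt := cmap_differentiable ac a0 cq d0.
have df : differentiable (f \o cinv (chart_at q)) ((cmap (chart_at q) \o cinv c) (cmap c q)).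
  by rewrite /= cmapK//; exact: smooth_fun_at_differentiable.
have E := congr1 (fun L => L w) (diff_comp dt df).
rewrite [in LHS](_ : cmap (chart_at q) q = (cmap (chart_at q) \o cinv c) (cmap c q)); last by rewrite /= cmapK.
apply: etrans (esym E) _; apply/esym; apply: near_diff; last by apply: smooth_fun_at_differentiable.
have := cinv_near cq (cdom_near d0); apply: filterS => y [q' [cq' dq' ->]] /=.
by rewrite cmapK// cmapK.
Qed.

Lemma coordinate_vf_surj c (v : 'rV[R]_n) p : atlas c -> cdom c p ->
  coordinate_vf c (dfun (cmap c) p v) p = v.
Proof.
move=> ac cp; apply: tangent_ext => f sf.
have := vapp_coordinate (dfun (cmap c) p v) ac cp sf; rewrite /vapp => ->.
exact: esym (dfun_chart v ac cp sf).
Qed.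

Lemma dfun_coordinate c (w : 'rV[R]_n) q : atlas c -> cdom c q ->
  dfun (cmap c) q (coordinate_vf c w q) = w.
Proof.
move=> ac cq; apply/rowP => k.
have sk : smooth_fun_at (fun q => cmap c q 0 k) q by exact: smooth_fun_at_coord.
apply: etrans (dfun_cmap _ _ ac cq) _; apply: etrans (vapp_coordinate w ac cq sk) _.
apply: etrans (_ : _ = 'd (fun y : 'rV[R]_n => y 0 k) (cmap c q) w) _.
  apply: near_diff; last exact: smooth_fun_at_differentiable.
  have := cinv_near cq (cdom_near cq); apply: filterS => y [q' [_ cq' ->]] /=.
  by rewrite cmapK.
have := @diff_coord _ _ n id (cmap c q) w k.
by rewrite diff_val => <-.
Qed.

Lemma smooth_vf_at_coordinate c w p : atlas c -> cdom c p -> smooth_vf_at (coordinate_vf c w) p.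
Proof.
move=> ac cp d ad dp k.
have sd : smooth_at (fun y => cmap d (cinv c y) 0 k) (cmap c p).
  by apply/(smooth_fun_at_chart (fun q => cmap d q 0 k)) => //; exact: smooth_fun_at_coord.
apply: (@smooth_fun_at_eq _ _ _ (fun q => \sum_i w 0 i * ('D_(delta_mx 0 i) (fun y => cmap d (cinv c y) 0 k) \o cmap c) q)).
  apply: filterS (near_and (cdom_near cp) (cdom_near dp)) => q [cq dq].
  rewrite /vapp dfun_cmap// -/(vapp _ _ q) vapp_coordinate//; last exact: smooth_fun_at_coord.
  by rewrite diff_partial//; apply: smooth_fun_at_differentiable => //; exact: smooth_fun_at_coord.
apply: smooth_fun_at_sum => i _; apply: smooth_fun_atM; first exact: smooth_fun_at_cst.
by apply: smooth_fun_at_of_chart => //; exact: smooth_at_partial.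
Qed.

Lemma smooth_vf_at_scale (a : M -> R) (E : vfield M) p : smooth_fun_at a p -> smooth_vf_at E p ->
  smooth_vf_at (fun q => a q *: E q) p.
Proof.
move=> sa sE c ac cp k; apply: (@smooth_fun_at_eq _ _ _ (fun q => a q * vapp E (cmap c) q 0 k)).
  by apply: near_all => q; rewrite /vapp linearZ mxE.
by apply: smooth_fun_atM => //; exact: sE.
Qed.

Lemma smooth_vf_at_add (E F : vfield M) p : smooth_vf_at E p -> smooth_vf_at F p -> smooth_vf_at (fun q => E q + F q) p.
Proof.
move=> sE sF c ac cp k; apply: (@smooth_fun_at_eq _ _ _ (fun q => vapp E (cmap c) q 0 k + vapp F (cmap c) q 0 k)).
  by apply: near_all => q; rewrite /vapp linearD mxE.
by apply: smooth_fun_atD; [exact: sE|exact: sF].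
Qed.

Lemma smooth_vf_at_eq (E F : vfield M) p : (\forall q \near p, E q = F q) -> smooth_vf_at E p -> smooth_vf_at F p.
Proof.
move=> EF sE c ac cp k; apply: smooth_fun_at_eq (sE c ac cp k).
by apply: filterS EF => q; rewrite /vapp => ->.
Qed.

Lemma smooth_vf_at_zero p : smooth_vf_at (fun=> 0 : 'rV[R]_n) p.
Proof.
move=> c ac cp k; apply: smooth_fun_at_eq (smooth_fun_at_cst 0 p).
by apply: near_all => q; rewrite /vapp linear0 mxE.
Qed.

(** A coordinate field through [v] is multiplied by a bump function supported inside the chart and
    extended by zero. The only question is smoothness at points outside the chart domain. *)
Lemma global_extension p (v : 'rV[R]_n) :
  exists2 E : vfield M, (forall q, smooth_vf_at E q) & E p = v.
Proof.
set c := chart_at p; have ac : atlas c := chart_at_atlas p; have cp : cdom c p := chart_at_dom p.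
have [d d0 dU] := near_ballP (open_nbhs_nbhs (conj (@cimage_open _ _ _ c) (imageP (cmap c) cp))).
have d2 : 0 < d / 2 by rewrite divr_gt0.
have [b [sb b1 bsupp]] := bump_exists (cmap c p) d2.
pose E : vfield M := fun q => if `[< cdom c q >] then b (cmap c q) *: coordinate_vf c (dfun (cmap c) p v) q else 0.
have E_in q : cdom c q -> E q = b (cmap c q) *: coordinate_vf c (dfun (cmap c) p v) q.
  by move=> cq; rewrite /E; case: asboolP.
exists E; last by rewrite E_in// b1 scale1r coordinate_vf_surj.
move=> q; have [cq|ncq] := pselect (cdom c q).
  apply: (@smooth_vf_at_eq (fun q => (b \o cmap c) q *: coordinate_vf c (dfun (cmap c) p v) q)).
    by apply: filterS (cdom_near cq) => q' cq'; rewrite E_in.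
  by apply: smooth_vf_at_scale; [exact: smooth_fun_at_of_chart|exact: smooth_vf_at_coordinate].
pose B := [set y : 'rV[R]_n | `|y - cmap c p| <= d / 2].
have B_image : B `<=` cmap c @` cdom c.
  by move=> y yB; apply: dU; apply: le_lt_trans yB _; rewrite ltr_pdivrMr// ltr_pMr// ltr1n.
have compB : compact B.
  have -> : B = (fun w => w + cmap c p) @` [set w : 'rV[R]_n | `|w| <= d / 2].
    apply/seteqP; split=> [y yB|_ [w wB <-]]; last by rewrite /B /= addrK.
    by exists (y - cmap c p) => //; rewrite subrK.
  apply: continuous_compact; last exact: closed_ball_rV_compact.
  apply: continuous_subspaceT => w; apply: differentiable_continuous.
  by apply: differentiableD.
(* The preimage of the closed ball is compact, hence closed because [M] is Hausdorff. A point
   outside the chart domain therefore has a neighbourhood missing it, and there the extended field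
   is zero. *)
have clK : closed (cinv c @` B).
  apply: compact_closed; first exact: manifold_hausdorff.
  apply: continuous_compact => //.
  by apply: continuous_subspaceW B_image _; exact: cinv_continuous.
have nK : ~ (cinv c @` B) q.
  move=> [y /B_image [q' cq' <-]]; rewrite cmapK// => qq'; apply: ncq; by rewrite -qq'.
suff near0 : \forall q' \near q, (0 : 'rV[R]_n) = E q'.
  exact: (smooth_vf_at_eq near0 (@smooth_vf_at_zero q)).
have : \forall q' \near q, (~` (cinv c @` B)) q'.
  by apply: open_nbhs_nbhs; split=> //; exact: closed_openC.
apply: filterS => q' nKq'; rewrite /E; case: asboolP => // cq'.
have [->|bn0] := eqVneq (b (cmap c q')) 0; first by rewrite scale0r.
exfalso; apply: nKq'; exists (cmap c q'); last by rewrite cmapK.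
by rewrite /B /= ltW// bsupp.
Qed.

End Extension.

(** * Smooth maps, their differentials and their fibres *)

Section SmoothMaps.
Context {R : realType} {m n : nat} {M : manifold R m} {B : manifold R n} {prj : M -> B}.
Context (spi : smooth_map prj).

Lemma near_prj p (Q : set B) : (\forall b \near prj p, Q b) -> \forall q \near p, Q (prj q).
Proof. by move=> h; exact: (spi.1 p Q h). Qed.

Lemma smooth_fun_at_prj_coord d p k : atlas d -> cdom d (prj p) -> smooth_fun_at (fun q => cmap d (prj q) 0 k) p.
Proof.
move=> ad dp; have := spi.2 d ad; rewrite smooth_fun_rowP.
  by move=> /(_ p k dp).
by apply: open_comp; [move=> x _; exact: spi.1|exact: cdom_open].
Qed.

Lemma local_rep_smooth c d p : atlas c -> atlas d -> cdom c p -> cdom d (prj p) ->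
  smooth_at (cmap d \o prj \o cinv c) (cmap c p).
Proof.
move=> ac ad cp dp; apply/smooth_at_row => k.
by apply/(smooth_fun_at_chart (fun q => cmap d (prj q) 0 k)) => //; exact: smooth_fun_at_prj_coord.
Qed.

Lemma smooth_fun_at_comp (f : B -> R) p : smooth_fun_at f (prj p) -> smooth_fun_at (f \o prj) p.
Proof.
move=> sf; set c := chart_at p; set d := chart_at (prj p).
have [ac cp] : atlas c /\ cdom c p by split; [exact: chart_at_atlas|exact: chart_at_dom].
have [ad dp] : atlas d /\ cdom d (prj p) by split; [exact: chart_at_atlas|exact: chart_at_dom].
apply/(smooth_fun_at_chart _ ac cp).
apply: (@smooth_at_eq _ _ _ ((f \o cinv d) \o (cmap d \o prj \o cinv c))).
  have := cinv_near cp (near_prj (cdom_near dp)); apply: filterS => y [q [cq dq ->]] /=.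
  by rewrite cmapK// cmapK.
apply: smooth_at_comp; first exact: local_rep_smooth.
by rewrite /= cmapK.
Qed.

Lemma tangent_map_row p v k :
  tangent_map prj p v 0 k = dfun (fun q => cmap (chart_at (prj p)) (prj q) 0 k) p v.
Proof.
rewrite /tangent_map dfun_row// => j.
by apply: smooth_fun_at_prj_coord; [exact: chart_at_atlas|exact: chart_at_dom].
Qed.

Lemma dfun_comp (f : B -> R) p v : smooth_fun_at f (prj p) ->
  dfun (f \o prj) p v = dfun f (prj p) (tangent_map prj p v).
Proof.
move=> sf; set d := chart_at (prj p); set c := chart_at p.
have [ac cp] : atlas c /\ cdom c p by split; [exact: chart_at_atlas|exact: chart_at_dom].
have [ad dp] : atlas d /\ cdom d (prj p) by split; [exact: chart_at_atlas|exact: chart_at_dom].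
have dphi := smooth_at_differentiable (local_rep_smooth ac ad cp dp).
have df : differentiable (f \o cinv d) ((cmap d \o prj \o cinv c) (cmap c p)).
  by rewrite /= cmapK//; exact: smooth_fun_at_differentiable.
have E := congr1 (fun L => L v) (diff_comp dphi df).
have dpE : cmap d (prj p) = (cmap d \o prj \o cinv c) (cmap c p) by rewrite /= cmapK.
transitivity ('d ((f \o cinv d) \o (cmap d \o prj \o cinv c)) (cmap c p) v); last first.
  by apply: etrans E _; rewrite -dpE.
rewrite /dfun; apply: near_diff; last by apply: smooth_fun_at_differentiable => //; exact: smooth_fun_at_comp.
have := cinv_near cp (near_prj (cdom_near dp)); apply: filterS => y [q [cq dq ->]] /=.
by rewrite cmapK// cmapK.
Qed.

Lemma tangent_map_onto_matrix p : (forall w, exists v, tangent_map prj p v = w) ->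
  exists K : 'M[R]_(n, m), forall w, tangent_map prj p (w *m K) = w.
Proof.
move=> onto; have /choice [s hs] : forall i : 'I_n, exists v, tangent_map prj p v = delta_mx 0 i.
  by move=> i; exact: onto.
exists (\matrix_i s i) => w; rewrite mulmx_sum_row linear_sum [RHS]row_sum_delta.
by apply: eq_bigr => i _; rewrite linearZ /= rowK hs.
Qed.

Lemma smooth_fun_at_descend (f : B -> R) p : (forall w, exists v, tangent_map prj p v = w) ->
  smooth_fun_at (f \o prj) p -> smooth_fun_at f (prj p).
Proof.
move=> /tangent_map_onto_matrix [K hK] sf; set d := chart_at (prj p); set c := chart_at p.
have [ac cp] : atlas c /\ cdom c p by split; [exact: chart_at_atlas|exact: chart_at_dom].
have [ad dp] : atlas d /\ cdom d (prj p) by split; [exact: chart_at_atlas|exact: chart_at_dom].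
have sphi := local_rep_smooth ac ad cp dp.
rewrite /smooth_fun_at -/d; have -> : cmap d (prj p) = (cmap d \o prj \o cinv c) (cmap c p) by rewrite /= cmapK.
apply: smooth_at_descend sphi hK _.
apply: (@smooth_at_eq _ _ _ ((f \o prj) \o cinv c)).
  have := cinv_near cp (near_prj (cdom_near dp)); apply: filterS => y [q [cq dq ->]] /=.
  by rewrite cmapK// cmapK.
by apply/(smooth_fun_at_chart _ ac cp).
Qed.

Context (onto : forall p w, exists v, tangent_map prj p v = w).

Lemma fibre_locally_constant (f : M -> R) b p : (forall q, smooth_fun_at f q) -> prj p = b ->
  (forall q v, prj q = b -> tangent_map prj q v = 0 -> dfun f q v = 0) ->
  \forall q \near p, prj q = b -> f q = f p.
Proof.
move=> sf pb ker; set d := chart_at (prj p); set c := chart_at p.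
have [ac cp] : atlas c /\ cdom c p by split; [exact: chart_at_atlas|exact: chart_at_dom].
have [ad dp] : atlas d /\ cdom d (prj p) by split; [exact: chart_at_atlas|exact: chart_at_dom].
have sphi := local_rep_smooth ac ad cp dp.
have [K hK] := tangent_map_onto_matrix (onto p).
(* [tangent_map] at [q] uses the chart selected at [prj q]. On the fibre over [b] this is always the
   same chart [d], so one local representative computes it at all these points. *)
have dd q : cdom c q -> cdom d (prj q) -> prj q = b ->
   forall v, tangent_map prj q v = 'd (cmap d \o prj \o cinv c) (cmap c q) (dfun (cmap c) q v).
  move=> cq dq qb v; apply/rowP => k.
  have sq : smooth_fun_at (fun q => cmap d (prj q) 0 k) q by exact: smooth_fun_at_prj_coord.
  rewrite tangent_map_row {1}qb -pb -/d (dfun_chart _ ac cq sq).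
  by rewrite diff_coord//; apply: smooth_at_differentiable; exact: local_rep_smooth.
have h : \forall y \near cmap c p, (cmap d \o prj \o cinv c) y = (cmap d \o prj \o cinv c) (cmap c p) ->
    (f \o cinv c) y = (f \o cinv c) (cmap c p).
  apply: (level_constant sphi hK).
  have := cinv_near cp (near_and (cdom_near cp) (near_prj (cdom_near dp))).
  apply: filterS => y [q [cq [_ dq] ->]] /=; rewrite !cmapK// => E.
  have qb : prj q = b by rewrite -(cmapK dq) E cmapK.
  have dqE := dd q cq dq qb.
  split.
  - exact: smooth_fun_at_differentiable.
  - have [Kq hKq] := tangent_map_onto_matrix (onto q).
    exists (Kq *m lin1_mx (dfun (cmap c) q)) => w.
    by rewrite mulmxA mul_rV_lin1 -dqE hKq.
  - move=> u; rewrite -(dfun_coordinate u ac cq) -dqE => hv.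
    by rewrite -dfun_chart//; exact: ker.
apply: filterS (near_and (cmap_near cp h) (cdom_near cp)) => q [+ cq] qb.
by rewrite /= !cmapK// qb pb; exact.
Qed.

(** The points of the fibre where [f] takes the value [f p] form a nonempty subset that is
    relatively open, by local constancy, and relatively closed, by continuity. *)
Lemma fibre_constant (f : M -> R) b : connected (prj @^-1` [set b]) -> (forall q, smooth_fun_at f q) ->
  (forall q v, prj q = b -> tangent_map prj q v = 0 -> dfun f q v = 0) ->
  forall p q, prj p = b -> prj q = b -> f p = f q.
Proof.
move=> conn sf ker p q pb qb.
have loc := fun p pb => @fibre_locally_constant f b p sf pb ker.
pose C := [set q | f q = f p].
suff E : (prj @^-1` [set b]) `&` C = prj @^-1` [set b].
  have : (prj @^-1` [set b]) q by [].
  by rewrite -E => -[_ ->].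
apply: conn.
- by exists p.
(* Relative openness needs an open set of [M] with the right trace: [D] collects the points near
   which [f] equals [f p] on the fibre. *)
- pose D : set M := [set x : M | \forall y \near x, prj y = b -> f y = f p].
  exists D; first by rewrite openE => x Dx; exact: nbhs_interior.
  apply/seteqP; split=> [x [xb fx]|x [xb Dx]]; split=> //.
    by rewrite /D /=; apply: filterS (loc x xb) => y h yb; rewrite h.
  by have := nbhs_singleton Dx; exact.
- exists C => //.
  have -> : C = f @^-1` [set f p] by [].
  apply: closed_comp; last exact: closed_eq.
  move=> x _; have := smooth_fun_at_differentiable (chart_at_atlas x) (chart_at_dom x) (sf x).
  move=> /differentiable_continuous cf.
  have cx : {for x, continuous (cmap (chart_at x))}.
    by move=> P; exact: cmap_near (chart_at_dom x).
  move=> P Px.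
  have : \forall y \near cmap (chart_at x) x, P ((f \o cinv (chart_at x)) y).
    by apply: cf; rewrite /= cmapK//; exact: chart_at_dom.
  move=> /(cmap_near (chart_at_dom x)) h.
  by apply: filterS (near_and h (cdom_near (chart_at_dom x))) => y [+ cy]; rewrite /= cmapK.
Qed.

End SmoothMaps.

(** * Horizontal and vertical vectors *)

Section LinearAlgebra.
Context {R : realType} {m : nat}.
Implicit Types (G : 'M[R]_m) (u v w : 'rV[R]_m).

Lemma mxformDl G u v w : mxform G (u + v) w = mxform G u w + mxform G v w.
Proof. by rewrite /mxform !mulmxDl mxE. Qed.

Lemma mxformDr G u v w : mxform G u (v + w) = mxform G u v + mxform G u w.
Proof. by rewrite /mxform linearD mulmxDr mxE. Qed.

Lemma mxformZl G a u v : mxform G (a *: u) v = a * mxform G u v.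
Proof. by rewrite /mxform -!scalemxAl mxE. Qed.

Lemma mxformZr G a u v : mxform G u (a *: v) = a * mxform G u v.
Proof. by rewrite /mxform linearZ -scalemxAr mxE. Qed.

Lemma mxform0l G v : mxform G 0 v = 0.
Proof. by rewrite -(scale0r 0) mxformZl mul0r. Qed.

Lemma mxform0r G u : mxform G u 0 = 0.
Proof. by rewrite -(scale0r 0) mxformZr mul0r. Qed.

Lemma mxformNl G u v : mxform G (- u) v = - mxform G u v.
Proof. by rewrite -scaleN1r mxformZl mulN1r. Qed.

Lemma mxformNr G u v : mxform G u (- v) = - mxform G u v.
Proof. by rewrite -scaleN1r mxformZr mulN1r. Qed.

Lemma mxformBl G u v w : mxform G (u - v) w = mxform G u w - mxform G v w.
Proof. by rewrite mxformDl mxformNl. Qed.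

Lemma mxform_scale a G u v : mxform (a *: G) u v = a * mxform G u v.
Proof. by rewrite /mxform -scalemxAr -scalemxAl mxE. Qed.

Lemma mxformC G u v : G^T = G -> mxform G u v = mxform G v u.
Proof.
move=> sG; rewrite /mxform -[in LHS](trmxK (u *m G *m v^T)) mxE.
by rewrite !trmx_mul trmxK sG mulmxA.
Qed.

Lemma mxform_nondeg G u : G \in unitmx -> (forall v, mxform G u v = 0) -> u = 0.
Proof.
move=> Gu h; rewrite -(mulmxK Gu u).
suff -> : u *m G = 0 by rewrite mul0mx.
apply/rowP => i; rewrite [RHS]mxE -(h (delta_mx 0 i)) /mxform.
rewrite [RHS]mxE (bigD1 i)//= big1 ?addr0; last by move=> j ji; rewrite !mxE (negbTE ji) andbF mulr0.
by rewrite !mxE !eqxx mulr1.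
Qed.

(* Dimension count: a positive and a negative semidefinite subspace meet trivially. *)
Lemma definite_rank_le G k l (A : 'M[R]_(k, m)) (B : 'M[R]_(l, m)) :
  (forall u, (u <= A)%MS -> u != 0 -> 0 < mxform G u u) ->
  (forall u, (u <= B)%MS -> mxform G u u <= 0) -> (\rank A + \rank B <= m)%N.
Proof.
move=> pA nB; have cap0 : (A :&: B)%MS = 0.
  apply/eqP/rowV0P => u; rewrite sub_capmx => /andP[uA uB]; apply/eqP.
  apply: contraT => u0; have := lt_le_trans (pA u uA u0) (nB u uB).
  by rewrite ltxx.
rewrite -mxrank_sum_cap cap0 mxrank0 addn0; exact: rank_leq_col.
Qed.

End LinearAlgebra.

Section Splitting.
Context {R : realType} {m n : nat} {M : manifold R m} {B : manifold R n}.
Context {g : metric M} {g' : metric B} {prj : M -> B}.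
Context (sub : semi_riemannian_submersion g g' prj).
Implicit Types (p q : M) (u v w : 'rV[R]_m).

Local Notation vertical := (vertical_mx prj).
Local Notation horizontal := (horizontal_mx g prj).
Local Notation hproj := (hproj g prj).
Local Notation vproj := (vproj g prj).

Lemma verticalP p u : reflect (tangent_map prj p u = 0) (u <= vertical p)%MS.
Proof. by rewrite /vertical_mx; apply: (iffP sub_kermxP); rewrite mul_rV_lin1. Qed.

Lemma horizontalP p u :
  reflect (forall v, (v <= vertical p)%MS -> mxform (g p) u v = 0) (u <= horizontal p)%MS.
Proof.
rewrite /horizontal_mx; apply: (iffP sub_kermxP) => [h v /submxP[D ->]|h].
  by rewrite /mxform trmx_mul mulmxA -[u *m _ *m _]mulmxA h mul0mx mxE.
rewrite mulmxA; apply/rowP => i; rewrite [RHS]mxE -(h (row i (vertical p)) (row_sub _ _)) /mxform.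
by rewrite !mxE; apply: eq_bigr => j _; rewrite !mxE.
Qed.

Lemma vertical_horizontal_cap p : (vertical p :&: horizontal p)%MS = 0.
Proof.
apply/eqP/rowV0P => u; rewrite sub_capmx => /andP[uV /horizontalP uH].
exact: (submersion_fibre_nondegenerate sub) uV uH.
Qed.

Lemma rank_vertical p : \rank (vertical p) = (m - n)%N.
Proof.
rewrite mxrank_ker; congr (_ - _)%N; apply/eqP; rewrite -/(row_full _) -sub1mx.
apply/row_subP => i.
have [u <-] := submersion_onto sub p (row i 1%:M).
by rewrite -mul_rV_lin1 submxMl.
Qed.

Lemma rank_horizontal p : \rank (horizontal p) = (m - \rank (vertical p))%N.
Proof.
rewrite /horizontal_mx mxrank_ker; congr (_ - _)%N.
rewrite -mxrank_tr trmx_mul trmxK mxrankMfree// row_free_unit unitmx_tr.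
exact: metric_nondegenerate.
Qed.

(** Nondegeneracy of [g] fixes the dimension of the horizontal space as the complementary one, and
    nondegeneracy of the fibres makes the intersection trivial. *)
Lemma vertical_horizontal_full p u : (u <= vertical p + horizontal p)%MS.
Proof.
apply: submx_full; rewrite /row_full -(addn0 (\rank _)).
have <- : \rank (vertical p :&: horizontal p)%MS = 0%N by rewrite vertical_horizontal_cap mxrank0.
by rewrite mxrank_sum_cap rank_horizontal subnKC// rank_leq_row.
Qed.

Lemma hprojDvproj p u : hproj p u + vproj p u = u.
Proof.
rewrite addrC /hproj /vproj; apply: add_proj_mx; first exact: vertical_horizontal_cap.
exact: vertical_horizontal_full.
Qed.

Lemma vproj_vertical p u : (vproj p u <= vertical p)%MS.
Proof. exact: proj_mx_sub. Qed.

Lemma hproj_horizontal p u : (hproj p u <= horizontal p)%MS.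
Proof. exact: proj_mx_sub. Qed.

Lemma hproj_id p u : (u <= horizontal p)%MS -> hproj p u = u.
Proof. by move=> uH; apply: proj_mx_id => //; rewrite capmxC vertical_horizontal_cap. Qed.

Lemma vproj_id p u : (u <= vertical p)%MS -> vproj p u = u.
Proof. by move=> uV; apply: proj_mx_id => //; exact: vertical_horizontal_cap. Qed.

Lemma vproj_0 p u : (u <= horizontal p)%MS -> vproj p u = 0.
Proof. by move=> uH; apply: proj_mx_0 => //; exact: vertical_horizontal_cap. Qed.

Lemma hproj_0 p u : (u <= vertical p)%MS -> hproj p u = 0.
Proof. by move=> uV; apply: proj_mx_0 => //; rewrite capmxC vertical_horizontal_cap. Qed.

Lemma hv_orth p u v : (u <= horizontal p)%MS -> (v <= vertical p)%MS -> mxform (g p) u v = 0.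
Proof. by move=> /horizontalP; exact. Qed.

Lemma metricC p u v : mxform (g p) u v = mxform (g p) v u.
Proof. by apply: mxformC; exact: (Defs.metric_sym g p). Qed.

Lemma vh_orth p u v : (u <= vertical p)%MS -> (v <= horizontal p)%MS -> mxform (g p) u v = 0.
Proof. by move=> uV vH; rewrite metricC hv_orth. Qed.

Lemma form_hproj p u w : (w <= horizontal p)%MS -> mxform (g p) (hproj p u) w = mxform (g p) u w.
Proof.
by move=> wH; rewrite -{2}(hprojDvproj p u) mxformDl (vh_orth (vproj_vertical _ _) wH) addr0.
Qed.

Lemma form_vproj p u w : (w <= vertical p)%MS -> mxform (g p) (vproj p u) w = mxform (g p) u w.
Proof.
by move=> wV; rewrite -{2}(hprojDvproj p u) mxformDl (hv_orth (hproj_horizontal _ _) wV) add0r.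
Qed.

Lemma tangent_hproj p u : tangent_map prj p (hproj p u) = tangent_map prj p u.
Proof.
rewrite -{2}(hprojDvproj p u) linearD /=.
by have /verticalP -> := vproj_vertical p u; rewrite addr0.
Qed.

(** The vertical part of [v] contributes to neither side. With [v] arbitrary, products with a
    horizontal vector can be computed on [B]. *)
Lemma horizontal_form_tangent p u v : (u <= horizontal p)%MS ->
  mxform (g' (prj p)) (tangent_map prj p u) (tangent_map prj p v) = mxform (g p) u v.
Proof.
move=> uH; rewrite -(tangent_hproj p v) (submersion_isometric sub) ?hproj_horizontal//.
by rewrite metricC form_hproj// metricC.
Qed.

Lemma horizontal_inj p u v : (u <= horizontal p)%MS -> (v <= horizontal p)%MS ->
  tangent_map prj p u = tangent_map prj p v -> u = v.
Proof.
move=> uH vH uv; apply/eqP; rewrite -subr_eq0; apply/eqP.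
have : (u - v <= vertical p :&: horizontal p)%MS.
  rewrite sub_capmx; apply/andP; split; last by rewrite addmx_sub ?eqmx_opp.
  by apply/verticalP; rewrite linearB /= uv subrr.
by rewrite vertical_horizontal_cap submx0 => /eqP.
Qed.

Lemma horizontal_lift_exists p (w : 'rV[R]_n) : exists2 u, (u <= horizontal p)%MS & tangent_map prj p u = w.
Proof.
have [u <-] := submersion_onto sub p w.
by exists (hproj p u); [exact: hproj_horizontal|exact: tangent_hproj].
Qed.

End Splitting.

(** * The index condition and definiteness of the fibres *)

Section Index.
Context {R : realType} {m n : nat} {M : manifold R m} {B : manifold R n}.
Context {g : metric M} {g' : metric B} {prj : M -> B}.
Context (sub : semi_riemannian_submersion g g' prj).

(* [A] is spanned by the vectors of one sign in the orthonormal basis [P]. *)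
Lemma index_subspace (k : nat) (G : 'M[R]_k) (P : 'M[R]_k) (neg : {set 'I_k}) (b : bool) :
  P *m G *m P^T = diag_mx (\row_i (-1) ^+ (i \in neg)) ->
  exists A : 'M[R]_k, \rank A = #|[set i | (i \in neg) == b]%SET| /\
   forall u, (u <= A)%MS -> u != 0 -> 0 < (-1) ^+ b * mxform G u u.
Proof.
move=> PG.
have Pu : P \in unitmx.
  have : \det (P *m G *m P^T) != 0.
    rewrite PG det_diag; apply/prodf_neq0 => i _; rewrite mxE.
    by rewrite signr_eq0.
  by rewrite !det_mulmx !mulf_eq0 !negb_or => /andP[/andP[d _] _]; rewrite unitmxE unitfE.
pose S := [set i | (i \in neg) == b]%SET.
pose X : 'M[R]_(#|S|, k) := \matrix_(i, j) (enum_val i == j)%:R.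
have XX : X *m X^T = 1%:M.
  apply/matrixP => i j; rewrite !mxE (bigD1 (enum_val i))//= big1 => [|l li]; last first.
    by rewrite !mxE eq_sym (negbTE li) mul0r.
  by rewrite !mxE eqxx mul1r addr0 (inj_eq enum_val_inj) eq_sym.
have Xfree : row_free (X *m P).
  by apply/row_freeP; exists (invmx P *m X^T); rewrite mulmxA mulmxK.
exists <<X *m P>>%MS; split; first by rewrite genmxE; apply/eqP.
move=> u; rewrite genmxE => /submxP[D ->]; rewrite mulmxA.
have : forall i, (i \in neg) != b -> (D *m X) 0 i = 0.
  move=> i h; rewrite mxE big1// => l _; rewrite !mxE.
  case: eqP => [E|_]; last by rewrite mulr0.
  by have := enum_valP l; rewrite E finset.inE (negbTE h).
move: (D *m X) => y yE u0.
have -> : mxform G (y *m P) (y *m P) = \sum_i (-1) ^+ (i \in neg) * (y 0 i) ^+ 2.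
  rewrite /mxform trmx_mul !mulmxA -[y *m P *m G]mulmxA -[y *m _ *m P^T]mulmxA PG.
  by rewrite mul_mx_diag !mxE; apply: eq_bigr => i _; rewrite !mxE expr2; ring.
rewrite mulr_sumr.
have -> : \sum_i (-1) ^+ b * ((-1) ^+ (i \in neg) * y 0 i ^+ 2) = \sum_i y 0 i ^+ 2.
  apply: eq_bigr => i _; have [->|h] := eqVneq (i \in neg) b.
    by rewrite mulrA -signr_addb addbb mul1r.
  by rewrite yE// expr0n /= !mulr0.
have y0 : y != 0 by apply: contraNneq u0 => ->; rewrite mul0mx.
have /rV0Pn [i yi] := y0.
rewrite (bigD1 i)//=; apply: ltr_wpDr; first by apply: sumr_ge0 => j _; exact: sqr_ge0.
by rewrite lt_def sqr_ge0 sqrf_eq0 yi.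
Qed.

(** Dimensions are counted for both signs. For [b = true] the bound reads [s + (n - s') + 1 <= m],
    that is [s - s' < r]; for [b = false] it reads [(m - s) + s' + 1 <= m], that is [s' < s]. Either
    value allowed for [s] violates one of them. *)
Lemma fibre_anisotropic r s s' : m = (n + r)%N -> has_index g s -> has_index g' s' ->
  s = s' \/ s = (s' + r)%N -> forall p u, (u <= vertical_mx prj p)%MS ->
  mxform (g p) u u = 0 -> u = 0.
Proof.
move=> mE iM iB ss p u uV uu; apply/eqP; apply: contraT => u0.
have [PM [negM [PGM cM]]] := iM p; have [PB [negB [PGB cB]]] := iB (prj p).
(* The form of sign [b] is definite on a subspace of [T_p M], and that of sign [~~ b]
   on a horizontal subspace; the isotropic vector [u] enlarges the latter. *)
have key (b : bool) : (#|[set i | (i \in negM) == b]%SET| + (#|[set i | (i \in negB) == ~~ b]%SET| + 1) <= m)%N.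
  have [A [rA pA]] := index_subspace b PGM.
  have [C [rC pC]] := index_subspace (~~ b) PGB.
  have [K hK] := tangent_map_onto_matrix (submersion_onto sub p).
  (* [L] is the matrix of the horizontal lift. It is injective and isometric, hence carries the
     definite subspace [C] of the base into the horizontal space without changing its rank. *)
  pose L : 'M[R]_(n, m) := \matrix_i hproj g prj p (delta_mx 0 i *m K).
  have LE w : w *m L = hproj g prj p (w *m K).
    rewrite /hproj mulmx_sum_row [in RHS](row_sum_delta w) !mulmx_suml.
    by apply: eq_bigr => i _; rewrite rowK -!scalemxAl.
  have LT w : tangent_map prj p (w *m L) = w by rewrite LE (tangent_hproj sub).
  have LH (w : 'rV[R]_n) : (w *m L <= horizontal_mx g prj p)%MS by rewrite LE hproj_horizontal.
  have Lfree : row_free L.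
    apply/row_freeP; exists (lin1_mx (tangent_map prj p)).
    by apply/row_matrixP => i; rewrite !rowE mulmxA mul_rV_lin1 LT mulmx1.
  have CLH (w : 'rV[R]_m) : (w <= C *m L)%MS -> (w <= horizontal_mx g prj p)%MS.
    by move=> /submxP[D ->]; rewrite mulmxA.
  have rS : \rank (C *m L + u)%MS = (\rank C + 1)%N.
    have cap0 : (C *m L :&: u)%MS = 0.
      apply/eqP/rowV0P => w; rewrite sub_capmx => /andP[/CLH wH wu].
      apply/eqP; rewrite -submx0 -(vertical_horizontal_cap sub p) sub_capmx wH.
      by rewrite (submx_trans wu uV).
    have := mxrank_sum_cap (C *m L) u; rewrite cap0 mxrank0 addn0 => ->.
    by rewrite mxrankMfree// rank_rV u0.
  rewrite -rA -rC -rS; apply: (@definite_rank_le _ _ ((-1) ^+ b *: g p)) => w.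
    by move=> wA w0; rewrite mxform_scale; exact: pA.
  move=> /sub_addsmxP [[D1 D2] /= ->].
  have -> : mxform ((-1) ^+ b *: g p) (D1 *m (C *m L) + D2 *m u) (D1 *m (C *m L) + D2 *m u)
     = (-1) ^+ b * mxform (g' (prj p)) (D1 *m C) (D1 *m C).
    rewrite mxform_scale; congr (_ * _).
    have D1H : (D1 *m (C *m L) <= horizontal_mx g prj p)%MS by apply: CLH; exact: submxMl.
    have D2V : (D2 *m u <= vertical_mx prj p)%MS by exact: submx_trans (submxMl _ _) uV.
    rewrite !mxformDl !mxformDr (hv_orth D1H D2V) (vh_orth D2V D1H) add0r addr0.
    rewrite -(submersion_isometric sub D1H D1H) mulmxA LT.
    rewrite [D2]mx11_scalar mul_scalar_mx mxformZl mxformZr uu !mulr0 addr0//.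
  have [->|w0] := eqVneq (D1 *m C) 0; first by rewrite mxform0l mulr0.
  have := pC (D1 *m C) (submxMl _ _) w0; case: (b) => /=; rewrite ?expr0 ?expr1 ?mul1r ?mulN1r ?oppr_gt0 ?oppr_le0; exact: ltW.
have cT (k : nat) (N : {set 'I_k}) : #|[set i | (i \in N) == true]%SET| = #|N|.
  by apply: eq_card => i; rewrite finset.inE eqb_id.
have cF (k : nat) (N : {set 'I_k}) : (#|[set i | (i \in N) == false]%SET| + #|N| = k)%N.
  rewrite addnC -[RHS](card_ord k) -(cardsC N); congr (_ + _)%N.
  by apply: eq_card => i; rewrite !finset.inE eqbF_neg.
have k1 := key true; have k2 := key false; rewrite /= !cT in k1 k2.
have c1 := cF _ negM; have c2 := cF _ negB; rewrite cM in k1 c1; rewrite cB in k2 c2.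
move: k1 k2 c1 c2 mE ss => {}k1 {}k2 {}c1 {}c2 {}mE.
move: (#|_|) (#|_|) k1 k2 c1 c2 => a c k1 k2 c1 c2; clear -k1 k2 c1 c2 mE.
by case=> ss; lia.
Qed.

End Index.

Opaque tangent_map dfun.

(** * Basic vector fields *)

Section MetricDual.
Context {R : realType} {n : nat} {M : manifold R n} (g : metric M).

Lemma smooth_vfT (E : vfield M) : smooth_vf setT E <-> forall p, smooth_vf_at E p.
Proof.
rewrite smooth_vfP; last exact: openT.
by split=> [h p|h p _]; exact: h.
Qed.

Lemma smooth_funT (f : M -> R) : smooth_fun setT f <-> forall p, smooth_fun_at f p.
Proof.
rewrite smooth_funP; last exact: openT.
by split=> [h p|h p _]; exact: h.
Qed.

Lemma smooth_fun_at_metric (E F : vfield M) p : smooth_vf setT E -> smooth_vf setT F ->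
  smooth_fun_at (fun q => mxform (g q) (E q) (F q)) p.
Proof. by move=> sE sF; move/smooth_funT: (metric_smooth g openT sE sF); exact. Qed.

Lemma smooth_vf_at_sum (I : Type) (r : seq I) (E : I -> vfield M) p :
  (forall i, smooth_vf_at (E i) p) -> smooth_vf_at (fun q => \sum_(i <- r) E i q) p.
Proof.
move=> sE; elim: r => [|i r IH].
  by apply: (smooth_vf_at_eq _ (@smooth_vf_at_zero _ _ _ p)); apply: near_all => q; rewrite big_nil.
apply: (smooth_vf_at_eq _ (smooth_vf_at_add (sE i) IH)).
by apply: near_all => q; rewrite big_cons.
Qed.

Lemma smooth_fun_at_invmx k (A : M -> 'M[R]_k) p : (forall i j, smooth_fun_at (fun q => A q i j) p) ->
  A p \in unitmx -> forall i j, smooth_fun_at (fun q => invmx (A q) i j) p.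
Proof.
move=> sA Ap i j; apply: (smooth_at_invmx (A := A \o cinv (chart_at p))); last first.
  by rewrite /= cmapK//; exact: chart_at_dom.
by move=> i' j'; exact: sA.
Qed.

Lemma near_unitmx_manifold k (A : M -> 'M[R]_k) p : (forall i j, smooth_fun_at (fun q => A q i j) p) ->
  A p \in unitmx -> \forall q \near p, A q \in unitmx.
Proof.
move=> sA Ap; have := @near_unitmx _ _ _ (A \o cinv (chart_at p)) (cmap (chart_at p) p).
have d0 := chart_at_dom p.
move=> /(_ (fun i j => sA i j)); rewrite /= cmapK// => /(_ Ap) /(cmap_near d0) h.
by apply: filterS (near_and h (cdom_near d0)) => q [+ cq]; rewrite cmapK.
Qed.

(* In a frame [P], the field [L] is [b (P G P^T)^-1 P] with [b] its vector of products with the frame. *)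
Lemma metric_dual_smooth (L : vfield M) p :
  (forall E, smooth_vf setT E -> smooth_fun_at (fun q => mxform (g q) (L q) (E q)) p) -> smooth_vf_at L p.
Proof.
move=> sL; have /choice [E hE] : forall i : 'I_n, exists E : vfield M,
    smooth_vf setT E /\ E p = delta_mx 0 i.
  by move=> i; have [E sE Ep] := global_extension p (delta_mx 0 i); exists E; split=> //; exact/smooth_vfT.
pose P q : 'M[R]_n := \matrix_i E i q.
pose Ga q := P q *m g q *m (P q)^T.
have GaE q i j : Ga q i j = mxform (g q) (E i q) (E j q).
  rewrite /Ga /mxform -[E i q](rowK (fun i => E i q)) -[E j q](rowK (fun i => E i q)) -/(P q).
  rewrite -row_mul [RHS]mxE; apply: etrans (_ : _ = \sum_k (P q *m g q) i k * (P q)^T k j) _.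
    by rewrite [LHS]mxE.
  by apply: eq_bigr => k _; rewrite [(row i _) _ _]mxE [(P q)^T _ _]mxE [(row j _)^T _ _]mxE [(row j _) _ _]mxE.
have sGa i j : smooth_fun_at (fun q => Ga q i j) p.
  apply: (smooth_fun_at_eq _ (smooth_fun_at_metric p (hE i).1 (hE j).1)).
  by apply: near_all => q; rewrite GaE.
have Pp : P p = 1%:M by apply/row_matrixP => i; rewrite rowK (hE i).2 rowE mulmx1.
have Gap : Ga p \in unitmx.
  by rewrite /Ga Pp mul1mx trmx1 mulmx1; exact: metric_nondegenerate.
pose b q : 'rV[R]_n := \row_j mxform (g q) (L q) (E j q).
have bE q : b q = L q *m g q *m (P q)^T.
  apply/rowP => j; rewrite [LHS]mxE /mxform [LHS]mxE [RHS]mxE; apply: eq_bigr => k _.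
  by rewrite [(P q)^T _ _]mxE [(P q) _ _]mxE [(E j q)^T _ _]mxE.
have LE : \forall q \near p, \sum_i (\sum_j b q 0 j * invmx (Ga q) j i) *: E i q = L q.
  apply: filterS (near_unitmx_manifold sGa Gap) => q Gaq.
  have Pq : P q \in unitmx.
    move: Gaq; rewrite /Ga !unitmxE !det_mulmx !unitfE !mulf_eq0 !negb_or.
    by move=> /andP[/andP[]].
  transitivity (b q *m invmx (Ga q) *m P q).
    by rewrite mulmx_sum_row; apply: eq_bigr => i _; rewrite rowK mxE.
  have gq : g q \in unitmx by exact: metric_nondegenerate.
  have PTq : (P q)^T \in unitmx by rewrite unitmx_tr.
  have : Ga q = P q *m (g q *m (P q)^T) by rewrite mulmxA.
  rewrite bE => E1.
  have -> : L q *m g q *m (P q)^T = L q *m invmx (P q) *m Ga q.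
    by rewrite E1 !mulmxA mulmxKV.
  by rewrite mulmxK// mulmxKV.
apply: smooth_vf_at_eq LE _; apply: smooth_vf_at_sum => i; apply: smooth_vf_at_scale; last by have [/smooth_vfT] := hE i.
apply: smooth_fun_at_sum => j _; apply: smooth_fun_atM; last exact: smooth_fun_at_invmx.
apply: (smooth_fun_at_eq _ (sL _ (hE j).1)).
by apply: near_all => q; rewrite mxE.
Qed.

End MetricDual.

Lemma bracket_zero {R : realType} {n : nat} {M : manifold R n} (E : vfield M) p :
  smooth_vf_at E p -> bracket E (fun=> 0) p = 0.
Proof.
move=> sE; apply: (@tangent_ext _ _ _ p) => f sf.
have s0 : smooth_vf_at (fun _ : M => 0 : 'rV[R]_n) p by exact: smooth_vf_at_zero.
rewrite dfun_bracket// [in RHS]linear0.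
have -> : vapp (fun _ : M => 0 : 'rV[R]_n) f = fun=> 0 by apply/funext => q; rewrite /vapp linear0.
by rewrite {1}/vapp dfun_cst /vapp linear0 subr0.
Qed.

Section BasicFields.
Context {R : realType} {m n : nat} {M : manifold R m} {B : manifold R n}.
Context {g : metric M} {g' : metric B} {prj : M -> B}.
Context (sub : semi_riemannian_submersion g g' prj).
Implicit Types (p q : M) (E F X Y Z V W : vfield M).

Local Notation vertical := (vertical_mx prj).
Local Notation horizontal := (horizontal_mx g prj).

(* Smoothness of a section [w] of the pullback of the tangent bundle of [B] along [prj]. *)
Definition smooth_along (w : M -> 'rV[R]_n) p := forall d, atlas d -> cdom d (prj p) ->
  forall k, smooth_fun_at (fun q => dfun (cmap d) (prj q) (w q) 0 k) p.

Let sprj : smooth_map prj := submersion_smooth sub.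

Lemma smooth_along_comp (X' : vfield B) p : smooth_vf setT X' -> smooth_along (X' \o prj) p.
Proof.
move=> /smooth_vfT sX d ad dp k.
exact: (smooth_fun_at_comp sprj (sX (prj p) d ad dp k)).
Qed.

Lemma smooth_along_tangent E p : smooth_vf_at E p -> smooth_along (fun q => tangent_map prj q (E q)) p.
Proof.
move=> sE d ad dp k.
have sd q : cdom d (prj q) -> smooth_fun_at ((fun b => cmap d b 0 k) \o prj) q.
  by move=> dq; apply: smooth_fun_at_comp => //; exact: smooth_fun_at_coord.
apply: smooth_fun_at_eq (smooth_fun_at_vapp sE (sd p dp)).
apply: filterS (near_prj sprj (cdom_near dp)) => q dq.
by rewrite /vapp dfun_comp//; [rewrite dfun_cmap|exact: smooth_fun_at_coord].
Qed.

(** Both sections are expanded in the coordinate frame of one chart around [prj p]; their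
    coefficients are smooth by assumption, and the Gram matrix of the frame is pulled back from
    [B]. *)
Lemma smooth_along_metric (w1 w2 : M -> 'rV[R]_n) p : smooth_along w1 p -> smooth_along w2 p ->
  smooth_fun_at (fun q => mxform (g' (prj q)) (w1 q) (w2 q)) p.
Proof.
move=> s1 s2; set d := chart_at (prj p).
have [ad dp] : atlas d /\ cdom d (prj p) by split; [exact: chart_at_atlas|exact: chart_at_dom].
pose e a : vfield B := coordinate_vf d (delta_mx 0 a).
have se a : smooth_vf (cdom d) (e a).
  by apply/smooth_vfP; [exact: cdom_open|move=> b db; exact: smooth_vf_at_coordinate].
have sg a b : smooth_fun_at (fun c => mxform (g' c) (e a c) (e b c)) (prj p).
  have := metric_smooth g' (cdom_open d) (se a) (se b).
  by rewrite smooth_funP; [apply|exact: cdom_open].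
have exp (w : 'rV[R]_n) q : cdom d (prj q) -> w = \sum_a dfun (cmap d) (prj q) w 0 a *: e a (prj q).
  move=> dq; apply: etrans (esym (coordinate_vf_surj w ad dq)) _.
  have lin (D : {linear 'rV[R]_n -> 'rV[R]_n}) u : D u = \sum_a u 0 a *: D (delta_mx 0 a).
    by rewrite {1}(row_sum_delta u) linear_sum; apply: eq_bigr => a _; rewrite linearZ.
  exact: lin.
apply: (@smooth_fun_at_eq _ _ _ (fun q => \sum_a \sum_b (dfun (cmap d) (prj q) (w1 q) 0 a *
    dfun (cmap d) (prj q) (w2 q) 0 b) * ((fun c => mxform (g' c) (e a c) (e b c)) \o prj) q)).
  apply: filterS (near_prj sprj (cdom_near dp)) => q dq.
  rewrite [in RHS](exp (w1 q) q dq) [in RHS](exp (w2 q) q dq) /=.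
  have sumL (I : Type) (r : seq I) (G : 'M[R]_n) (f : I -> 'rV[R]_n) v :
      mxform G (\sum_(i <- r) f i) v = \sum_(i <- r) mxform G (f i) v.
    by elim: r => [|i r IH]; rewrite ?big_nil ?mxform0l// !big_cons mxformDl IH.
  have sumR (I : Type) (r : seq I) (G : 'M[R]_n) (f : I -> 'rV[R]_n) v :
      mxform G v (\sum_(i <- r) f i) = \sum_(i <- r) mxform G v (f i).
    by elim: r => [|i r IH]; rewrite ?big_nil ?mxform0r// !big_cons mxformDr IH.
  rewrite sumL; apply: eq_bigr => a _; rewrite sumR; apply: eq_bigr => b _.
  by rewrite mxformZl mxformZr mulrA.
apply: smooth_fun_at_sum => a _; apply: smooth_fun_at_sum => b _.
apply: smooth_fun_atM; first by apply: smooth_fun_atM; [exact: s1|exact: s2].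
exact: (smooth_fun_at_comp sprj (sg a b)).
Qed.

(** The products of [L] with smooth fields are products on [B] of projections, hence smooth, and
    metric duality recovers [L]. Smoothness of horizontal parts and of horizontal lifts follows from
    this. *)
Lemma smooth_vf_at_horizontal L p : horizontal_on g prj setT L ->
  smooth_along (fun q => tangent_map prj q (L q)) p -> smooth_vf_at L p.
Proof.
move=> hL sL; apply: (metric_dual_smooth (g := g)) => E /smooth_vfT sE.
apply: (smooth_fun_at_eq _ (smooth_along_metric sL (smooth_along_tangent (sE p)))).
by apply: near_all => q; apply: (horizontal_form_tangent sub); exact: hL.
Qed.

Lemma smooth_hpart E : smooth_vf setT E -> smooth_vf setT (hpart g prj E).
Proof.
move=> /smooth_vfT sE; apply/smooth_vfT => p; apply: smooth_vf_at_horizontal.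
  by move=> q _; exact: hproj_horizontal.
have -> : (fun q => tangent_map prj q (hpart g prj E q)) = fun q => tangent_map prj q (E q).
  by apply/funext => q; exact: (tangent_hproj sub).
exact: smooth_along_tangent.
Qed.

Lemma smooth_add E F : smooth_vf setT E -> smooth_vf setT F -> smooth_vf setT (fun q => E q + F q).
Proof. by move=> /smooth_vfT sE /smooth_vfT sF; apply/smooth_vfT => p; exact: smooth_vf_at_add. Qed.

Lemma smooth_opp E : smooth_vf setT E -> smooth_vf setT (fun q => - E q).
Proof.
move=> /smooth_vfT sE; apply/smooth_vfT => p.
apply: (smooth_vf_at_eq _ (smooth_vf_at_scale (@smooth_fun_at_cst _ _ _ (-1) p) (sE p))).
by apply: near_all => q; rewrite scaleN1r.
Qed.

Lemma smooth_sub E F : smooth_vf setT E -> smooth_vf setT F -> smooth_vf setT (fun q => E q - F q).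
Proof. by move=> sE sF; apply: smooth_add => //; exact: smooth_opp. Qed.

Lemma vpartE E : vpart g prj E = fun q => E q - hpart g prj E q.
Proof.
apply/funext => q; rewrite /vpart /hpart -{2}(hprojDvproj sub q (E q)) addrC addKr//.
Qed.

Lemma smooth_vpart E : smooth_vf setT E -> smooth_vf setT (vpart g prj E).
Proof. by move=> sE; rewrite vpartE; apply: smooth_sub => //; exact: smooth_hpart. Qed.

Lemma basic_lift (X' : vfield B) : smooth_vf setT X' ->
  exists2 X, basic g prj X & forall p, tangent_map prj p (X p) = X' (prj p).
Proof.
move=> sX'.
have /choice [X hX] : forall p, exists u, (u <= horizontal p)%MS /\ tangent_map prj p u = X' (prj p).
  by move=> p; have [u uH uw] := horizontal_lift_exists sub p (X' (prj p)); exists u.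
have hor : horizontal_on g prj setT X by move=> p _; have [] := hX p.
have tX p : tangent_map prj p (X p) = X' (prj p) by have [] := hX p.
exists X => //; split=> //; last by exists X'.
apply/smooth_vfT => p; apply: smooth_vf_at_horizontal => //.
have -> : (fun q => tangent_map prj q (X q)) = X' \o prj by apply/funext => q; exact: tX.
exact: smooth_along_comp.
Qed.

Lemma basic_with_projection (b : B) (w : 'rV[R]_n) :
  exists2 X, basic g prj X & forall p, prj p = b -> tangent_map prj p (X p) = w.
Proof.
have [X' /smooth_vfT sX' X'b] := global_extension b w.
have [X bX tX] := basic_lift sX'.
by exists X => // p pb; rewrite tX pb.
Qed.

Lemma basic_through p (u : 'rV[R]_m) : (u <= horizontal p)%MS -> exists2 X, basic g prj X & X p = u.
Proof.
move=> uH; have [X bX tX] := basic_with_projection (prj p) (tangent_map prj p u).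
exists X => //; apply: (horizontal_inj sub) uH _; last exact: tX.
by case: bX => _ hX _; exact: hX.
Qed.

Lemma basic_form_constant X Y : basic g prj X -> basic g prj Y ->
  constant_along_fibres prj (fun p => mxform (g p) (X p) (Y p)).
Proof.
move=> [_ hX [X' _ tX]] [_ hY [Y' _ tY]] p q pq.
rewrite -(submersion_isometric sub (hX p I) (hY p I)) -(submersion_isometric sub (hX q I) (hY q I)).
have fX r : mxform (g' (prj r)) (tangent_map prj r (X r)) (tangent_map prj r (Y r))
    = mxform (g' (prj r)) (X' (prj r)) (Y' (prj r)).
  by congr (mxform _ _ _); [exact: tX|exact: tY].
by apply: etrans (fX p) _; apply: etrans (esym (fX q)); rewrite pq.
Qed.

(** The projection of [W p] is determined by its products with vectors of the base, and each of
    these is the projection of a basic [Z]. Fibrewise products thus make the projection depend on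
    [prj p] alone. *)
Lemma basicP W : smooth_vf setT W -> horizontal_on g prj setT W ->
  (forall Z, basic g prj Z -> constant_along_fibres prj (fun p => mxform (g p) (W p) (Z p))) ->
  basic g prj W.
Proof.
move=> sW hW cW; split=> //.
(* [s] is an arbitrary section of [prj], in general discontinuous. Smoothness of the field on [B]
   comes from descent along [prj], not from [s]. *)
have /choice [s hs] := submersion_surjective sub.
have tW p : tangent_map prj p (W p) = tangent_map prj (s (prj p)) (W (s (prj p))).
  apply/eqP; rewrite -subr_eq0; apply/eqP.
  apply: (mxform_nondeg (metric_nondegenerate g' (prj p))) => z.
  have [Z bZ tZ] := basic_with_projection (prj p) z.
  have E : prj (s (prj p)) = prj p by rewrite hs.
  rewrite mxformBl; apply/eqP; rewrite subr_eq0; apply/eqP.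
  have fW r : prj r = prj p ->
      mxform (g' (prj p)) (tangent_map prj r (W r)) z = mxform (g r) (W r) (Z r).
    move=> rp; apply: etrans (horizontal_form_tangent sub _ (hW r I)).
    by congr (mxform _ _ _); [rewrite rp|exact: esym (tZ r rp)].
  apply: etrans (fW p erefl) _; apply: etrans (esym (fW _ E)).
  by apply: cW => //; rewrite E.
exists (fun b => tangent_map prj (s b) (W (s b))) => //.
apply/smooth_vfT => b d ad db k.
have {1}<- := hs b; apply: (smooth_fun_at_descend sprj); first exact: (submersion_onto sub).
have dsb : cdom d (prj (s b)) by rewrite hs.
have sWs : smooth_vf_at W (s b) by move/smooth_vfT: sW; exact.
apply: smooth_fun_at_eq (smooth_along_tangent sWs ad dsb k).
by apply: near_all => q; exact: (congr1 (fun u => dfun (cmap d) (prj q) u 0 k) (tW q)).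
Qed.

Lemma constant_descends (f : M -> R) : (forall p, smooth_fun_at f p) -> constant_along_fibres prj f ->
  exists2 f' : B -> R, (forall b, smooth_fun_at f' b) & f = f' \o prj.
Proof.
move=> sf cf; have /choice [s hs] := submersion_surjective sub.
have E : f = (f \o s) \o prj by apply/funext => p; apply: cf; rewrite /= hs.
exists (f \o s) => // b; rewrite -(hs b); apply: (smooth_fun_at_descend sprj); first exact: (submersion_onto sub).
by rewrite -E.
Qed.

(** Writing [f = f' \o prj] with [f'] smooth, the derivative of [f] along [X] is that of [f'] along
    the projected field, pulled back. *)
Lemma vapp_basic_constant X (f : M -> R) : basic g prj X -> (forall p, smooth_fun_at f p) ->
  constant_along_fibres prj f -> constant_along_fibres prj (vapp X f).
Proof.
move=> [_ _ [X' _ tX]] sf cf; have [f' sf' ->] := constant_descends sf cf => p q pq.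
have fX r : vapp X (f' \o prj) r = dfun f' (prj r) (X' (prj r)).
  by apply: etrans (dfun_comp sprj _ (sf' _)) _; congr (dfun _ _ _); exact: tX.
by apply: etrans (fX p) _; apply: etrans (esym (fX q)); rewrite pq.
Qed.

Lemma dfun_vertical_constant (f : M -> R) p (u : 'rV[R]_m) : (u <= vertical p)%MS ->
  (forall q, smooth_fun_at f q) -> constant_along_fibres prj f -> dfun f p u = 0.
Proof.
move=> /verticalP tu sf cf; have [f' sf' ->] := constant_descends sf cf.
by rewrite dfun_comp// tu linear0.
Qed.

Lemma bracket_projection X Y (X' Y' : vfield B) p : smooth_vf setT X -> smooth_vf setT Y ->
  smooth_vf setT X' -> smooth_vf setT Y' ->
  (forall q, tangent_map prj q (X q) = X' (prj q)) ->
  (forall q, tangent_map prj q (Y q) = Y' (prj q)) ->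
  tangent_map prj p (bracket X Y p) = bracket X' Y' (prj p).
Proof.
move=> /smooth_vfT sX /smooth_vfT sY /smooth_vfT sX' /smooth_vfT sY' tX tY.
apply: (@tangent_ext _ _ _ (prj p)) => f sf.
have cf : smooth_fun_at (f \o prj) p by exact: smooth_fun_at_comp.
rewrite -dfun_comp// dfun_bracket//  dfun_bracket//.
have der (U V : vfield M) (U' V' : vfield B) : (forall q, tangent_map prj q (U q) = U' (prj q)) ->
    (forall q, tangent_map prj q (V q) = V' (prj q)) -> smooth_vf_at V' (prj p) ->
    vapp U (vapp V (f \o prj)) p = vapp U' (vapp V' f) (prj p).
  move=> tU tV sV'; have sVf : smooth_fun_at (vapp V' f) (prj p) by exact: smooth_fun_at_vapp.
  transitivity (dfun (vapp V' f \o prj) p (U p)); last by rewrite dfun_comp// tU.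
  apply/esym; apply: dfun_eq; last exact: smooth_fun_at_comp.
  by apply: filterS (near_prj sprj (smooth_fun_at_near sf)) => q sq; rewrite /vapp dfun_comp//= tV.
by rewrite (der X Y X' Y')// (der Y X Y' X').
Qed.

(** [V] is related to the zero field of [B], so the bracket is related to a bracket with zero. *)
Lemma bracket_vertical X V p : basic g prj X -> smooth_vf setT V -> vertical_on prj setT V ->
  (bracket X V p <= vertical p)%MS.
Proof.
move=> [sX _ [X' sX' tX]] sV vV; apply/verticalP.
have s0 : smooth_vf setT (fun _ : B => 0 : 'rV[R]_n) by apply/smooth_vfT => b; exact: smooth_vf_at_zero.
have tV q : tangent_map prj q (V q) = 0 by apply/verticalP; exact: vV.
rewrite (bracket_projection p sX sV sX' s0 tX tV); apply: bracket_zero.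
by move/smooth_vfT: sX'; exact.
Qed.

End BasicFields.

Opaque mxform.

(** * The Levi-Civita connection *)

Section LeviCivita.
Context {R : realType} {n : nat} {M : manifold R n} {g : metric M}.
Context {nabla : vfield M -> vfield M -> vfield M} (lc : levi_civita g nabla).
Implicit Types (E F G X Y Z W : vfield M) (p q : M).

Lemma smooth_zero : smooth_vf setT (fun _ : M => 0 : 'rV[R]_n).
Proof. by apply/smooth_vfT => p; exact: smooth_vf_at_zero. Qed.

Lemma nablaS E F : smooth_vf setT E -> smooth_vf setT F -> smooth_vf setT (nabla E F).
Proof. exact: (nabla_smooth lc openT). Qed.

Lemma nablaDl E E' F p : smooth_vf setT E -> smooth_vf setT E' -> smooth_vf setT F ->
  nabla (fun q => E q + E' q) F p = nabla E F p + nabla E' F p.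
Proof. by move=> sE sE' sF; exact: (nabla_addl lc openT sE sE' sF I). Qed.

Lemma nablaDr E F F' p : smooth_vf setT E -> smooth_vf setT F -> smooth_vf setT F' ->
  nabla E (fun q => F q + F' q) p = nabla E F p + nabla E F' p.
Proof. by move=> sE sF sF'; exact: (nabla_addr lc openT sE sF sF' I). Qed.

Lemma nabla0r E p : smooth_vf setT E -> nabla E (fun=> 0) p = 0.
Proof.
move=> sE; apply: (@addrI _ (nabla E (fun=> 0) p)); rewrite addr0 -nablaDr//; try exact: smooth_zero.
by congr (nabla _ _ _); apply/funext => q; rewrite addr0.
Qed.

Lemma nabla0l F p : smooth_vf setT F -> nabla (fun=> 0) F p = 0.
Proof.
move=> sF; apply: (@addrI _ (nabla (fun=> 0) F p)); rewrite addr0 -nablaDl//; try exact: smooth_zero.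
by congr (nabla _ _ _); apply/funext => q; rewrite addr0.
Qed.

Lemma nablaNr E F p : smooth_vf setT E -> smooth_vf setT F ->
  nabla E (fun q => - F q) p = - nabla E F p.
Proof.
move=> sE sF; have sN := smooth_opp sF.
apply: (@addrI _ (nabla E F p)); rewrite subrr -nablaDr// -[RHS](nabla0r p sE).
by congr (nabla _ _ _); apply/funext => q; rewrite subrr.
Qed.

Lemma nablaNl E F p : smooth_vf setT E -> smooth_vf setT F ->
  nabla (fun q => - E q) F p = - nabla E F p.
Proof.
move=> sE sF; have sN := smooth_opp sE.
apply: (@addrI _ (nabla E F p)); rewrite subrr -nablaDl// -[RHS](nabla0l p sF).
by congr (nabla _ _ _); apply/funext => q; rewrite subrr.
Qed.

Lemma nablaBr E F F' p : smooth_vf setT E -> smooth_vf setT F -> smooth_vf setT F' ->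
  nabla E (fun q => F q - F' q) p = nabla E F p - nabla E F' p.
Proof. by move=> sE sF sF'; rewrite nablaDr ?nablaNr//; exact: smooth_opp. Qed.

Lemma nablaBl E E' F p : smooth_vf setT E -> smooth_vf setT E' -> smooth_vf setT F ->
  nabla (fun q => E q - E' q) F p = nabla E F p - nabla E' F p.
Proof. by move=> sE sE' sF; rewrite nablaDl ?nablaNl//; exact: smooth_opp. Qed.

Lemma bracketE E F : smooth_vf setT E -> smooth_vf setT F ->
  bracket E F = fun q => nabla E F q - nabla F E q.
Proof.
move=> sE sF; apply/funext => q.
by rewrite (nabla_torsion_free lc openT sE sF I).
Qed.

Lemma smooth_bracket E F : smooth_vf setT E -> smooth_vf setT F -> smooth_vf setT (bracket E F).
Proof. by move=> sE sF; rewrite bracketE//; apply: smooth_sub; exact: nablaS. Qed.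

Lemma smooth_curvature E F G : smooth_vf setT E -> smooth_vf setT F -> smooth_vf setT G ->
  smooth_vf setT (curvature nabla E F G).
Proof.
move=> sE sF sG; rewrite /curvature; apply: smooth_sub; last by apply: nablaS => //; exact: smooth_bracket.
by apply: smooth_sub; do !apply: nablaS.
Qed.

Lemma vapp_form E F G p : smooth_vf setT E -> smooth_vf setT F -> smooth_vf setT G ->
  vapp E (fun q => mxform (g q) (F q) (G q)) p =
    mxform (g p) (nabla E F p) (G p) + mxform (g p) (F p) (nabla E G p).
Proof. by move=> sE sF sG; exact: (nabla_metric lc openT sE sF sG I). Qed.

Lemma vapp_bracket E F (f : M -> R) p : smooth_vf setT E -> smooth_vf setT F -> smooth_fun_at f p ->
  vapp (bracket E F) f p = vapp E (vapp F f) p - vapp F (vapp E f) p.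
Proof. by move=> /smooth_vfT sE /smooth_vfT sF sf; exact: dfun_bracket. Qed.

Lemma vappB E (f h : M -> R) p : smooth_fun_at f p -> smooth_fun_at h p ->
  vapp E (fun q => f q - h q) p = vapp E f p - vapp E h p.
Proof.
move=> sf sh; apply/eqP; rewrite eq_sym subr_eq; apply/eqP.
apply: etrans (dfunD (E p) (smooth_fun_atB sf sh) sh).
by congr (dfun _ p _); apply/funext => q; rewrite subrK.
Qed.

(** Applied to a function, the three double commutators expand into twelve third-order derivatives
    that cancel in pairs. *)
Lemma jacobi X Y Z p : smooth_vf setT X -> smooth_vf setT Y -> smooth_vf setT Z ->
  bracket X (bracket Y Z) p + bracket Y (bracket Z X) p + bracket Z (bracket X Y) p = 0.
Proof.
move=> sX sY sZ; apply: (@tangent_ext _ _ _ p) => f sf.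
have expand (U V W : vfield M) : smooth_vf setT U -> smooth_vf setT V -> smooth_vf setT W ->
    dfun f p (bracket U (bracket V W) p) =
    vapp U (vapp V (vapp W f)) p - vapp U (vapp W (vapp V f)) p
    - (vapp V (vapp W (vapp U f)) p - vapp W (vapp V (vapp U f)) p).
  move=> sU sV sW; have sVW := smooth_bracket sV sW.
  have sv (E : vfield M) (h : M -> R) q : smooth_vf setT E -> smooth_fun_at h q -> smooth_fun_at (vapp E h) q.
    by move=> /smooth_vfT sE sh; exact: smooth_fun_at_vapp.
  transitivity (vapp U (vapp (bracket V W) f) p - vapp (bracket V W) (vapp U f) p).
    by apply: vapp_bracket.
  congr (_ - _); last exact: vapp_bracket sV sW (sv _ _ _ sU sf).
  have s1 := sv _ _ _ sV (sv _ _ _ sW sf).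
  have s2 := sv _ _ _ sW (sv _ _ _ sV sf).
  apply: etrans (vappB U s1 s2).
  apply: dfun_eq; last exact: sv sVW sf.
  by apply: filterS (smooth_fun_at_near sf) => q sq; exact: vapp_bracket.
move: (expand X Y Z sX sY sZ) (expand Y Z X sY sZ sX) (expand Z X Y sZ sX sY).
move: (bracket X (bracket Y Z) p) (bracket Y (bracket Z X) p) (bracket Z (bracket X Y) p) => u v w e1 e2 e3.
have alg (b1 b2 b3 a1 a2 a3 a4 a5 a6 : R) : b1 = a1 - a2 - (a3 - a4) ->
    b2 = a3 - a5 - (a6 - a2) -> b3 = a6 - a4 - (a1 - a5) -> b1 + b2 + b3 = 0.
  by move=> -> -> ->; ring.
have lin : dfun f p (u + v + w) = dfun f p u + dfun f p v + dfun f p w by rewrite !linearD.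
by rewrite lin linear0; exact: alg e1 e2 e3.
Qed.

(** Torsion-freeness rewrites [[U, [V, W]]] through second covariant derivatives; the cyclic sum of
    these expressions regroups into the cyclic sum of curvatures, and Jacobi's identity applies. *)
Lemma bianchi X Y Z p : smooth_vf setT X -> smooth_vf setT Y -> smooth_vf setT Z ->
  curvature nabla X Y Z p + curvature nabla Y Z X p + curvature nabla Z X Y p = 0.
Proof.
move=> sX sY sZ; rewrite -(jacobi p sX sY sZ).
have br (U V W : vfield M) : smooth_vf setT U -> smooth_vf setT V -> smooth_vf setT W ->
    bracket U (bracket V W) p = nabla U (nabla V W) p - nabla U (nabla W V) p - nabla (bracket V W) U p.
  move=> sU sV sW; rewrite (bracketE sU (smooth_bracket sV sW)); congr (_ - _).
  rewrite (bracketE sV sW) nablaBr//; exact: nablaS.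
rewrite !br// /curvature.
move: (nabla X (nabla Y Z) p) (nabla X (nabla Z Y) p) (nabla Y (nabla Z X) p)
  (nabla Y (nabla X Z) p) (nabla Z (nabla X Y) p) (nabla Z (nabla Y X) p) => a1 a2 a3 a4 a5 a6.
move: (nabla _ _ p) (nabla _ _ p) (nabla _ _ p) => b1 b2 b3.
by apply/rowP => i; rewrite !mxE; ring.
Qed.

(** The operator [[X, Y] - (X Y - Y X)] annihilates the function [g Z W]. Expanding by compatibility
    with the metric, the products of two first derivatives cancel and the curvature terms remain. *)
Lemma curvature_skew X Y Z W p : smooth_vf setT X -> smooth_vf setT Y ->
    smooth_vf setT Z -> smooth_vf setT W ->
  mxform (g p) (curvature nabla X Y Z p) (W p) = - mxform (g p) (curvature nabla X Y W p) (Z p).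
Proof.
move=> sX sY sZ sW; pose f q := mxform (g q) (Z q) (W q).
have sf q : smooth_fun_at f q by exact: smooth_fun_at_metric.
have second (U V : vfield M) : smooth_vf setT U -> smooth_vf setT V -> vapp U (vapp V f) p =
    mxform (g p) (nabla U (nabla V Z) p) (W p) + mxform (g p) (nabla V Z p) (nabla U W p) +
    (mxform (g p) (nabla U Z p) (nabla V W p) + mxform (g p) (Z p) (nabla U (nabla V W) p)).
  move=> sU sV; have sVZ := nablaS sV sZ; have sVW := nablaS sV sW.
  have -> : vapp V f = fun q => mxform (g q) (nabla V Z q) (W q) + mxform (g q) (Z q) (nabla V W q).
    by apply/funext => q; exact: vapp_form.
  rewrite /vapp dfunD; [|exact: smooth_fun_at_metric|exact: smooth_fun_at_metric].
  by congr (_ + _); exact: vapp_form.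
have sB := smooth_bracket sX sY.
have := vapp_bracket sX sY (sf p); rewrite (second X Y)// (second Y X)// vapp_form//.
rewrite /curvature !mxformBl.
rewrite (metricC p (Z p) (nabla X (nabla Y W) p)) (metricC p (Z p) (nabla Y (nabla X W) p)).
rewrite (metricC p (Z p) (nabla (bracket X Y) W p)).
lra.
Qed.

End LeviCivita.

Lemma mulr2n_inj (R : realType) (a b : R) : a *+ 2 = b *+ 2 -> a = b.
Proof. by move=> e; lra. Qed.

(** * O'Neill's formulas *)

Section ONeill.
Context {R : realType} {m n : nat} {M : manifold R m} {B : manifold R n}.
Context {g : metric M} {g' : metric B} {prj : M -> B}.
Context (sub : semi_riemannian_submersion g g' prj).
Context {nabla : vfield M -> vfield M -> vfield M} (lc : levi_civita g nabla).
Implicit Types (E F X Y Z U V W : vfield M) (p q : M).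

Local Notation vertical := (vertical_mx prj).
Local Notation horizontal := (horizontal_mx g prj).
Local Notation smooth := (smooth_vf setT).
Local Notation ip p := (mxform (g p)).
Local Notation "'basic'" := (basic g prj).
Local Notation fibrewise := (constant_along_fibres prj).

(* For basic [X] and [Y] this is O'Neill's [A_X Y]. *)
Definition vnabla X Y : vfield M := vpart g prj (nabla X Y).
Definition hnabla X Y : vfield M := hpart g prj (nabla X Y).

Lemma basic_smooth X : basic X -> smooth X. Proof. by case. Qed.

Lemma basic_horizontal X p : basic X -> (X p <= horizontal p)%MS.
Proof. by case=> _ hX _; exact: hX. Qed.

Lemma nabla_split X Y : nabla X Y = fun q => hnabla X Y q + vnabla X Y q.
Proof. by apply/funext => q; rewrite /hnabla /vnabla /hpart /vpart (hprojDvproj sub). Qed.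

Lemma vnabla_vertical X Y p : (vnabla X Y p <= vertical p)%MS.
Proof. exact: vproj_vertical. Qed.

Lemma hnabla_horizontal X Y p : (hnabla X Y p <= horizontal p)%MS.
Proof. exact: hproj_horizontal. Qed.

Lemma smooth_vnabla X Y : smooth X -> smooth Y -> smooth (vnabla X Y).
Proof. by move=> sX sY; apply: (smooth_vpart sub); exact: (nablaS lc). Qed.

Lemma smooth_hnabla X Y : smooth X -> smooth Y -> smooth (hnabla X Y).
Proof. by move=> sX sY; apply: (smooth_hpart sub); exact: (nablaS lc). Qed.

Lemma vertical_through p (u : 'rV[R]_m) : (u <= vertical p)%MS ->
  exists V, [/\ smooth V, vertical_on prj setT V & V p = u].
Proof.
move=> uV; have [E /smooth_vfT sE Ep] := global_extension p u.
exists (vpart g prj E); split; first exact: (smooth_vpart sub).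
  by move=> q _; exact: vproj_vertical.
by rewrite /vpart Ep (vproj_id sub).
Qed.

Lemma vapp_zero_fun V (f : M -> R) p : (forall q, f q = 0) -> vapp V f p = 0.
Proof.
move=> f0; have -> : f = fun=> 0 by apply/funext.
by rewrite /vapp dfun_cst.
Qed.

(** The derivative along [E] of [g X V = 0]. *)
Lemma form_nabla_horizontal X V p : smooth X -> smooth V -> vertical_on prj setT V ->
  (forall q, (X q <= horizontal q)%MS) -> forall E, smooth E ->
  ip p (nabla E X p) (V p) = - ip p (X p) (nabla E V p).
Proof.
move=> sX sV vV hX E sE; apply/eqP; rewrite -addr_eq0 -(vapp_form lc)//; apply/eqP.
by apply: vapp_zero_fun => q; apply: hv_orth; [exact: hX|exact: vV].
Qed.

Lemma vnabla_form X Y V p : (V p <= vertical p)%MS -> ip p (vnabla X Y p) (V p) = ip p (nabla X Y p) (V p).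
Proof. exact: (form_vproj sub). Qed.

Lemma hnabla_form X Y p (w : 'rV[R]_m) : (w <= horizontal p)%MS ->
  ip p (hnabla X Y p) w = ip p (nabla X Y p) w.
Proof. exact: (form_hproj sub). Qed.

(* Holds because [[X, V]] is vertical. *)
Lemma nabla_basic_vertical X V p (w : 'rV[R]_m) : basic X -> smooth V -> vertical_on prj setT V ->
  (w <= horizontal p)%MS -> ip p (nabla X V p) w = ip p (nabla V X p) w.
Proof.
move=> bX sV vV wH; apply/eqP; rewrite -subr_eq0 -mxformBl.
rewrite (nabla_torsion_free lc openT (basic_smooth bX) sV I).
by rewrite (vh_orth (bracket_vertical sub p bX sV vV) wH).
Qed.

Lemma vertical_eq0 p (u : 'rV[R]_m) : (u <= vertical p)%MS ->
  (forall V, smooth V -> vertical_on prj setT V -> ip p u (V p) = 0) -> u = 0.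
Proof.
move=> uV h; apply: (submersion_fibre_nondegenerate sub uV) => v vV.
by have [V [sV vVV <-]] := vertical_through vV; exact: h.
Qed.

(** Against a vertical [V], the sum of both sides is [- g Y (nabla_X V) - g X (nabla_Y V)]. Since
    [X] and [Y] may be exchanged with [V] up to vertical brackets, this is minus the derivative of
    [g X Y] along [V], which vanishes because [g X Y] is fibrewise. *)
Lemma vnabla_anti X Y p : basic X -> basic Y -> vnabla X Y p = - vnabla Y X p.
Proof.
move=> bX bY; apply/eqP; rewrite -addr_eq0; apply/eqP.
have sX := basic_smooth bX; have sY := basic_smooth bY.
apply: (@vertical_eq0 p); first by apply: addmx_sub; exact: vnabla_vertical.
move=> V sV vV; have Vp := vV p I.
rewrite mxformDl !vnabla_form//.
rewrite (form_nabla_horizontal p sY sV vV (fun q => basic_horizontal q bY) sX).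
rewrite (form_nabla_horizontal p sX sV vV (fun q => basic_horizontal q bX) sY).
rewrite (metricC p (Y p)) (metricC p (X p)) (nabla_basic_vertical bX sV vV (basic_horizontal p bY)).
rewrite (nabla_basic_vertical bY sV vV (basic_horizontal p bX)) (metricC p (nabla V Y p)).
have := dfun_vertical_constant sub Vp (fun q => smooth_fun_at_metric g q sX sY) (basic_form_constant sub bX bY).
rewrite -/(vapp V _ p) (vapp_form lc)//; lra.
Qed.

Lemma vnabla_self X p : basic X -> vnabla X X p = 0.
Proof.
move=> bX; have e := vnabla_anti p bX bX.
apply/rowP => i; have := congr1 (fun u : 'rV[R]_m => u 0 i) e; rewrite !mxE.
by move: (vnabla X X p 0 i) => a; lra.
Qed.

(** Koszul's formula. Each of its terms is either the derivative of a fibrewise function along a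
    basic field, or the product of a basic field with a bracket of basic fields, which projects to
    [B]. *)
Lemma nabla_form_fibrewise X Y Z : basic X -> basic Y -> basic Z ->
  fibrewise (fun p => ip p (nabla X Y p) (Z p)).
Proof.
move=> bX bY bZ p q pq.
have cv (U V W : vfield M) : basic U -> basic V -> basic W ->
    fibrewise (vapp U (fun r => ip r (V r) (W r))).
  move=> bU bV bW; apply: (vapp_basic_constant sub bU); last exact: (basic_form_constant sub).
  by move=> r; apply: smooth_fun_at_metric; exact: basic_smooth.
have cb (U V W : vfield M) : basic U -> basic V -> basic W ->
    fibrewise (fun r => ip r (bracket U V r) (W r)).
  move=> [sU hU [U' sU' tU]] [sV hV [V' sV' tV]] [sW hW [W' sW' tW]] a b ab.
  have fB r : ip r (bracket U V r) (W r) = mxform (g' (prj r)) (W' (prj r)) (bracket U' V' (prj r)).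
    rewrite metricC -(horizontal_form_tangent sub _ (hW r I)).
    by congr (mxform _ _ _); [exact: tW|exact: (bracket_projection sub r sU sV sU' sV' tU tV)].
  by rewrite (fB a) (fB b) ab.
have koszul r : ip r (nabla X Y r) (Z r) *+ 2 = vapp X (fun r => ip r (Y r) (Z r)) r
    + vapp Y (fun r => ip r (Z r) (X r)) r - vapp Z (fun r => ip r (X r) (Y r)) r
    + ip r (bracket X Y r) (Z r) - ip r (bracket X Z r) (Y r) - ip r (bracket Y Z r) (X r).
  have [[sX sY] sZ] := (basic_smooth bX, basic_smooth bY, basic_smooth bZ).
  rewrite !(vapp_form lc)// !(bracketE lc)// !mxformBl.
  rewrite (metricC r (Y r) (nabla X Z r)) (metricC r (Z r) (nabla Y X r)) (metricC r (X r) (nabla Z Y r)).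
  lra.
apply: mulr2n_inj; apply: etrans (koszul p) (etrans _ (esym (koszul q))).
have alg (a a' b b' c c' d d' e e' f f' : R) : a = a' -> b = b' -> c = c' -> d = d' -> e = e' ->
    f = f' -> a + b - c + d - e - f = a' + b' - c' + d' - e' - f'.
  by do 6!move->.
exact: (alg _ _ _ _ _ _ _ _ _ _ _ _ (cv X Y Z bX bY bZ p q pq) (cv Y Z X bY bZ bX p q pq)
  (cv Z X Y bZ bX bY p q pq) (cb X Y Z bX bY bZ p q pq) (cb X Z Y bX bZ bY p q pq)
  (cb Y Z X bY bZ bX p q pq)).
Qed.

(** Allows [h nabla_X Y] to serve again as an argument of the formulas for basic fields, in place of
    the lifted covariant derivative of the base. *)
Lemma hnabla_basic X Y : basic X -> basic Y -> basic (hnabla X Y).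
Proof.
move=> bX bY; apply: (basicP sub).
- by apply: smooth_hnabla; exact: basic_smooth.
- by move=> p _; exact: hnabla_horizontal.
move=> Z bZ p q pq; rewrite !hnabla_form; try exact: basic_horizontal.
exact: nabla_form_fibrewise.
Qed.

(* The vertical part of [[X, Y]] is [2 A_X Y]. *)
Lemma nabla_bracket X Y Z p : basic X -> basic Y -> smooth Z ->
  nabla (bracket X Y) Z p = nabla (hnabla X Y) Z p - nabla (hnabla Y X) Z p
    + nabla (vnabla X Y) Z p *+ 2.
Proof.
move=> bX bY sZ; have [sX sY] := (basic_smooth bX, basic_smooth bY).
have [s1 s2] := (smooth_hnabla sX sY, smooth_hnabla sY sX).
have [s3 s4] := (smooth_vnabla sX sY, smooth_vnabla sY sX).
have -> : bracket X Y = fun q => (hnabla X Y q - hnabla Y X q) + (vnabla X Y q + vnabla X Y q).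
  apply/funext => q; rewrite (bracketE lc)// (nabla_split X Y) (nabla_split Y X).
  by rewrite (vnabla_anti q bY bX) opprD opprK addrACA.
rewrite (nablaDl lc)//; [|exact: smooth_sub|exact: smooth_add].
by rewrite (nablaBl lc)// (nablaDl lc)// mulr2n.
Qed.

(* O'Neill's curvature formula. *)
Lemma curvature_form X Y : basic X -> basic Y ->
  fibrewise (fun p => ip p (curvature nabla X Y X p) (Y p) - 3 * ip p (vnabla X Y p) (vnabla X Y p)).
Proof.
move=> bX bY; have [sX sY] := (basic_smooth bX, basic_smooth bY).
have [s1 s2] := (smooth_hnabla sY sX, smooth_hnabla sX sX).
have [s3 s4] := (smooth_vnabla sX sY, smooth_vnabla sY sX).
have vA U V : vertical_on prj setT (vnabla U V) by move=> q _; exact: vnabla_vertical.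
(* The coefficient 3 is 1 + 2: one [|A_X Y|^2] from differentiating the vertical part of [nabla_Y X]
   along [X], two from the vertical part [2 A_X Y] of the bracket. The terms left over involve basic
   fields only. *)
have key p : ip p (curvature nabla X Y X p) (Y p) - 3 * ip p (vnabla X Y p) (vnabla X Y p) =
    ip p (nabla X (hnabla Y X) p) (Y p) - ip p (nabla Y (hnabla X X) p) (Y p)
    - ip p (nabla (hnabla X Y) X p) (Y p) + ip p (nabla (hnabla Y X) X p) (Y p).
  have hY := basic_horizontal p bY.
  rewrite /curvature !mxformBl nabla_bracket// mxformDl mxformBl mulr2n mxformDl.
  have e1 : nabla X (nabla Y X) p = nabla X (hnabla Y X) p + nabla X (vnabla Y X) p.
    by rewrite [in LHS](nabla_split Y X) (nablaDr lc).
  have e2 : nabla Y (nabla X X) p = nabla Y (hnabla X X) p.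
    congr (nabla _ _ _); rewrite (nabla_split X X); apply/funext => q.
    by rewrite vnabla_self// addr0.
  have e3 : ip p (nabla X (vnabla Y X) p) (Y p) = ip p (vnabla X Y p) (vnabla X Y p).
    have := form_nabla_horizontal p sY s4 (vA Y X) (fun q => basic_horizontal q bY) sX.
    rewrite -vnabla_form//; last exact: vnabla_vertical.
    rewrite (metricC p (Y p)) {1}(vnabla_anti p bY bX) mxformNr; lra.
  have e4 : ip p (nabla (vnabla X Y) X p) (Y p) = - ip p (vnabla X Y p) (vnabla X Y p).
    rewrite -nabla_basic_vertical//.
    have := form_nabla_horizontal p sY s3 (vA X Y) (fun q => basic_horizontal q bY) sX.
    rewrite -vnabla_form//; last exact: vnabla_vertical.
    rewrite (metricC p (Y p)); lra.
  rewrite e1 e2 mxformDl e3 e4.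
  have alg (a b c d e : R) : a + e - b - (c - d + (- e + - e)) - 3 * e = a - b - c + d by lra.
  exact: alg.
move=> p q pq; rewrite (key p) (key q).
have c U V : basic U -> basic V -> ip p (nabla U V p) (Y p) = ip q (nabla U V q) (Y q).
  by move=> bU bV; exact: nabla_form_fibrewise.
have alg (a a' b b' e e' d d' : R) : a = a' -> b = b' -> e = e' -> d = d' ->
    a - b - e + d = a' - b' - e' + d'.
  by do 4!move->.
by apply: (alg); apply: c => //; exact: hnabla_basic.
Qed.

Context (R_constant : forall X Y, basic X -> basic Y -> fibrewise (curvature4 g nabla X Y X Y)).

Lemma vnabla_norm_fibrewise X Y : basic X -> basic Y ->
  fibrewise (fun p => ip p (vnabla X Y p) (vnabla X Y p)).
Proof.
move=> bX bY p q pq.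
have alg (a a' b b' : R) : a - 3 * b = a' - 3 * b' -> - a = - a' -> b = b' by lra.
exact: alg (curvature_form bX bY pq) (R_constant bX bY pq).
Qed.

Lemma basic_add X Y : basic X -> basic Y -> basic (fun q => X q + Y q).
Proof.
move=> bX bY; apply: (basicP sub).
- by apply: smooth_add; exact: basic_smooth.
- by move=> p _; apply: addmx_sub; exact: basic_horizontal.
move=> Z bZ p q pq; rewrite !mxformDl.
by rewrite (basic_form_constant sub bX bZ pq) (basic_form_constant sub bY bZ pq).
Qed.

Lemma vnabla_form_fibrewise X Y Z : basic X -> basic Y -> basic Z ->
  fibrewise (fun p => ip p (vnabla X Y p) (vnabla X Z p)).
Proof.
move=> bX bY bZ p q pq; have [[sX sY] sZ] := (basic_smooth bX, basic_smooth bY, basic_smooth bZ).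
have addA r : vnabla X (fun q => Y q + Z q) r = vnabla X Y r + vnabla X Z r.
  by rewrite /vnabla /vpart (nablaDr lc)// /vproj mulmxDl.
have polar x : ip x (vnabla X Y x) (vnabla X Z x) *+ 2 =
    ip x (vnabla X (fun q => Y q + Z q) x) (vnabla X (fun q => Y q + Z q) x)
    - ip x (vnabla X Y x) (vnabla X Y x) - ip x (vnabla X Z x) (vnabla X Z x).
  rewrite !addA !mxformDl !mxformDr (metricC x (vnabla X Z x) (vnabla X Y x)).
  have alg (a b c : R) : b *+ 2 = a + b + (b + c) - a - c by lra.
  exact: alg.
apply: mulr2n_inj; apply: etrans (polar p) (etrans _ (esym (polar q))).
have alg (a a' b b' c c' : R) : a = a' -> b = b' -> c = c' -> a - b - c = a' - b' - c'.
  by do 3!move->.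
exact: (alg _ _ _ _ _ _ (vnabla_norm_fibrewise bX (basic_add bY bZ) pq)
  (vnabla_norm_fibrewise bX bY pq) (vnabla_norm_fibrewise bX bZ pq)).
Qed.

Context {r : nat} {H : vfield M} (umbilic : totally_umbilic_fibres g prj nabla r H).

Lemma oneillT_vertical U V p : smooth U -> smooth V -> vertical_on prj setT U -> vertical_on prj setT V ->
  oneillT g prj nabla U V p = hproj g prj p (nabla U V p).
Proof.
move=> sU sV vU vV.
have vp (E : vfield M) : vertical_on prj setT E -> vpart g prj E = E.
  by move=> vE; apply/funext => q; rewrite /vpart (vproj_id sub)//; exact: vE.
have hp (E : vfield M) : vertical_on prj setT E -> hpart g prj E = fun=> 0.
  by move=> vE; apply/funext => q; rewrite /hpart (hproj_0 sub)//; exact: vE.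
by rewrite /oneillT !vp// hp// (nabla0r lc)// /vproj mul0mx addr0.
Qed.

(** Skew-symmetry of [T_U] moves the derivative from [Z] to [V], where [h nabla_U V = T_U V] is
    given by umbilicity. *)
Lemma umbilic_form U V Z p : smooth U -> smooth V -> vertical_on prj setT U -> vertical_on prj setT V ->
  basic Z -> ip p (nabla U Z p) (V p) = - (r%:R^-1 * ip p (U p) (V p) * ip p (H p) (Z p)).
Proof.
move=> sU sV vU vV bZ.
rewrite (form_nabla_horizontal p (basic_smooth bZ) sV vV (fun q => basic_horizontal q bZ) sU).
rewrite metricC -(form_hproj sub _ (basic_horizontal p bZ)) -oneillT_vertical//.
by rewrite (umbilic openT sU sV vU vV I) mxformZl.
Qed.

(** The inner derivatives are split into horizontal and vertical parts. Derivatives of [Z] along the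
    horizontal part of the bracket become [A_Z] by antisymmetry of [A]; those along its vertical
    part [2 A_X Y] are evaluated by umbilicity, whence the last term. *)
Lemma curvature_vertical X Y Z V p : basic X -> basic Y -> basic Z -> smooth V -> vertical_on prj setT V ->
  ip p (curvature nabla X Y Z p) (V p) =
    ip p (nabla X (vnabla Y Z) p) (V p) - ip p (nabla Y (vnabla X Z) p) (V p)
  + ip p (vnabla X (hnabla Y Z) p) (V p) - ip p (vnabla Y (hnabla X Z) p) (V p)
  + ip p (vnabla Z (hnabla X Y) p) (V p) - ip p (vnabla Z (hnabla Y X) p) (V p)
  + 2 * (r%:R^-1 * ip p (vnabla X Y p) (V p) * ip p (H p) (Z p)).
Proof.
move=> bX bY bZ sV vV; have [[sX sY] sZ] := (basic_smooth bX, basic_smooth bY, basic_smooth bZ).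
have Vp := vV p I.
have vA U W : vertical_on prj setT (vnabla U W) by move=> q _; exact: vnabla_vertical.
rewrite /curvature !mxformBl nabla_bracket// mxformDl mxformBl mulr2n mxformDl.
rewrite (umbilic_form p (smooth_vnabla sX sY) sV (vA X Y) vV bZ).
have e U W E : basic U -> basic W -> basic E -> ip p (nabla U (nabla W E) p) (V p) =
    ip p (vnabla U (hnabla W E) p) (V p) + ip p (nabla U (vnabla W E) p) (V p).
  move=> bU bW bE; have [[sU sW] sE] := (basic_smooth bU, basic_smooth bW, basic_smooth bE).
  rewrite [in LHS](nabla_split W E) (nablaDr lc)//; [|exact: smooth_hnabla|exact: smooth_vnabla].
  by rewrite mxformDl vnabla_form.
have f U W : basic U -> basic W -> ip p (nabla (hnabla U W) Z p) (V p) = - ip p (vnabla Z (hnabla U W) p) (V p).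
  by move=> bU bW; rewrite -vnabla_form// vnabla_anti// ?mxformNl//; exact: hnabla_basic.
rewrite !e// !f//; lra.
Qed.

(* Bianchi's identity trades the derivatives of [A_Y Z] and [A_X Z] along [X] and [Y] for that of
   [A_X Y] along [Z]. *)
Lemma curvature_vnabla X Y Z p : basic X -> basic Y -> basic Z ->
  ip p (curvature nabla X Y (vnabla X Y) p) (Z p) =
    ip p (nabla Z (vnabla X Y) p) (vnabla X Y p)
  - ip p (vnabla X (hnabla Z Y) p) (vnabla X Y p) - ip p (vnabla Y (hnabla Z X) p) (vnabla Y X p)
  - r%:R^-1 * (ip p (vnabla X Y p) (vnabla X Y p) * ip p (H p) (Z p)
             + ip p (vnabla Y Z p) (vnabla Y X p) * ip p (H p) (X p)
             + ip p (vnabla X Z p) (vnabla X Y p) * ip p (H p) (Y p)).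
Proof.
move=> bX bY bZ; have [[sX sY] sZ] := (basic_smooth bX, basic_smooth bY, basic_smooth bZ).
have sA := smooth_vnabla sX sY.
have vA : vertical_on prj setT (vnabla X Y) by move=> q _; exact: vnabla_vertical.
have bi : ip p (curvature nabla X Y Z p) (vnabla X Y p) + ip p (curvature nabla Y Z X p) (vnabla X Y p)
    + ip p (curvature nabla Z X Y p) (vnabla X Y p) = 0.
  by rewrite -!mxformDl (bianchi lc)// mxform0l.
have c1 := curvature_vertical p bX bY bZ sA vA.
have c2 := curvature_vertical p bY bZ bX sA vA.
have c3 := curvature_vertical p bZ bX bY sA vA.
have anti U W E : basic U -> basic W -> basic E ->
    ip p (nabla U (vnabla W E) p) (vnabla X Y p) = - ip p (nabla U (vnabla E W) p) (vnabla X Y p).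
  move=> bU bW bE; rewrite -mxformNl -(nablaNr lc); [|exact: basic_smooth|by apply: smooth_vnabla; exact: basic_smooth].
  by congr (ip p (nabla _ _ p) _); apply/funext => q; exact: vnabla_anti.
have a1 := anti X Z Y bX bZ bY; have a2 := anti Y Z X bY bZ bX; have a3 := anti Z Y X bZ bY bX.
have n1 u : ip p u (vnabla Y X p) = - ip p u (vnabla X Y p) by rewrite (vnabla_anti p bY bX) mxformNr.
have n2 : ip p (vnabla X Z p) (vnabla X Y p) = - ip p (vnabla Z X p) (vnabla X Y p).
  by rewrite (vnabla_anti p bX bZ) mxformNl.
(* As the three curvatures sum to zero, [2 C1 = C1 - C2 - C3]. In this combination [t1], [t2], [x1],
   [y1], [z1] and [z2] cancel while [t3], [x2] and [y2] are doubled, so halving also removes the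
   factor 2 of the umbilic terms. *)
have alg (C1 C2 C3 t1 t1' t2 t2' t3 t3' x1 x2 y1 y2 z1 z2 w1 w2 w3 h1 h2 h3 y2' w2' w3' k : R) :
    C1 + C2 + C3 = 0 ->
    C1 = t1 - t2 + x1 - y1 + z1 - z2 + 2 * (k * w1 * h3) ->
    C2 = t2' - t3' + y2 - z2 + x1 - x2 + 2 * (k * w2 * h1) ->
    C3 = t3 - t1' + z1 - x2 + y2 - y1 + 2 * (k * w3 * h2) ->
    t1' = - t1 -> t2' = - t2 -> t3' = - t3 -> y2' = - y2 -> w2' = - w2 -> w3' = - w3 ->
    - C1 = t3 - x2 - y2' - k * (w1 * h3 + w2' * h1 + w3' * h2).
  by move=> e0 e1 e2 e3 f1 f2 f3 -> -> ->; move: e0; rewrite e1 e2 e3 f1 f2 f3; lra.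
exact: etrans (curvature_skew lc p sX sY sA sZ) (alg _ _ _ _ _ _ _ _ _ _ _ _ _ _ _ _ _ _ _ _ _ _ _ _ _
  bi c1 c2 c3 a1 a2 a3 (n1 _) (n1 _) n2).
Qed.

End ONeill.

(** * The mean curvature field *)

Section MeanCurvature.
Context {R : realType} {m n r s s' : nat} {M : manifold R m} {B : manifold R n}.
Context {g : metric M} {g' : metric B} {prj : M -> B}.
Context {nabla : vfield M -> vfield M -> vfield M} {H : vfield M}.
Context (dim_fibres : m = (n + r)%N) (r_gt0 : (0 < r)%N).
Context (sub : semi_riemannian_submersion g g' prj).
Context (conn : forall b : B, connected (prj @^-1` [set b])).
Context (lc : levi_civita g nabla) (H_smooth : smooth_vf setT H).
Context (umbilic : totally_umbilic_fibres g prj nabla r H).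
Context (index_M : has_index g s) (index_B : has_index g' s').
Context (R_constant : forall X Y : vfield M, basic g prj X -> basic g prj Y ->
  constant_along_fibres prj (curvature4 g nabla X Y X Y)).
Context (H_parallel : parallel_along_fibres g prj nabla H).
Context (index_fibres : s = s' \/ s = (s' + r)%N).
Implicit Types (E F X Y Z U V W : vfield M) (p q : M).

Local Notation vertical := (vertical_mx prj).
Local Notation horizontal := (horizontal_mx g prj).
Local Notation smooth := (smooth_vf setT).
Local Notation ip p := (mxform (g p)).
Local Notation "'basic'" := (basic g prj).
Local Notation fibrewise := (constant_along_fibres prj).
Local Notation vnabla := (@vnabla R m n M B g prj nabla).
Local Notation hnabla := (@hnabla R m n M B g prj nabla).

Lemma anisotropic p (u : 'rV[R]_m) : (u <= vertical p)%MS -> ip p u u = 0 -> u = 0.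
Proof. exact: (fibre_anisotropic sub dim_fibres index_M index_B index_fibres). Qed.

Lemma oneillA_basic X Y : basic X -> basic Y -> oneillA g prj nabla X Y = vnabla X Y.
Proof.
move=> bX bY.
have -> : oneillA g prj nabla X Y = fun p => hproj g prj p (nabla X (fun=> 0) p) + vnabla X Y p.
  apply/funext => p; rewrite /oneillA.
  have hp (E : vfield M) : basic E -> hpart g prj E = E.
    by move=> bE; apply/funext => q; rewrite /hpart (hproj_id sub)//; exact: basic_horizontal.
  have -> : vpart g prj Y = fun=> 0.
    by apply/funext => q; rewrite /vpart (vproj_0 sub)//; exact: basic_horizontal.
  by rewrite !hp.
apply/funext => p; rewrite (nabla0r lc); last exact: basic_smooth bX.
by rewrite /hproj mul0mx add0r.
Qed.

Lemma hpart_form_fibrewise E X : basic (hpart g prj E) -> basic X -> fibrewise (fun p => ip p (E p) (X p)).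
Proof.
move=> bE bX p q pq; rewrite -(form_hproj sub _ (basic_horizontal p bX)).
rewrite -(form_hproj sub _ (basic_horizontal q bX)); exact: (basic_form_constant sub bE bX pq).
Qed.

Lemma r_neq0 : r%:R != 0 :> R.
Proof. by rewrite pnatr_eq0 -lt0n. Qed.

Lemma mean_curvature_horizontal p : (H p <= horizontal p)%MS.
Proof.
have : vertical p != 0.
  by rewrite -mxrank_eq0 (rank_vertical sub) dim_fibres addKn -lt0n.
case/rowV0Pn => u uV u0; have [V [sV vV Vp]] := vertical_through sub uV.
have c0 : r%:R^-1 * ip p (V p) (V p) != 0.
  rewrite mulf_neq0 ?invr_eq0 ?r_neq0//; apply: contra u0; rewrite Vp => /eqP e.
  by apply/eqP; exact: (anisotropic uV e).
have := umbilic openT sV sV vV vV (p := p) I; rewrite (oneillT_vertical sub lc p sV sV vV vV) => e.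
have -> : H p = (r%:R^-1 * ip p (V p) (V p))^-1 *: hproj g prj p (nabla V V p).
  by rewrite e scalerA mulVf// scale1r.
by apply: scalemx_sub; exact: hproj_horizontal.
Qed.

Lemma vapp_vnabla_norm X Y Z p : basic X -> basic Y -> basic Z ->
  vapp Z (fun q => ip q (vnabla X Y q) (vnabla X Y q)) p = 2 * ip p (nabla Z (vnabla X Y) p) (vnabla X Y p).
Proof.
move=> bX bY bZ; have sA := smooth_vnabla sub lc (basic_smooth bX) (basic_smooth bY).
rewrite (vapp_form lc p (basic_smooth bZ) sA sA) (metricC p (vnabla X Y p)).
have alg (a : R) : a + a = 2 * a by lra.
exact: alg.
Qed.

Lemma curvature_vnabla_basic X Y : basic X -> basic Y -> basic H ->
  basic (hpart g prj (curvature nabla X Y (oneillA g prj nabla X Y))).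
Proof.
move=> bX bY bH; rewrite (oneillA_basic bX bY).
have [sX sY] := (basic_smooth bX, basic_smooth bY).
have sA := smooth_vnabla sub lc sX sY.
apply: (basicP sub).
- by apply: (smooth_hpart sub); exact: (smooth_curvature lc).
- by move=> p _; exact: hproj_horizontal.
move=> Z bZ p q pq; rewrite !(form_hproj sub) ?(basic_horizontal _ bZ)//.
have alg (a a' b b' c c' k w w' h h' v v' i i' u u' j j' : R) : a = a' -> b = b' -> c = c' ->
    w = w' -> h = h' -> v = v' -> i = i' -> u = u' -> j = j' ->
    a - b - c - k * (w * h + v * i + u * j) = a' - b' - c' - k * (w' * h' + v' * i' + u' * j').
  by do 9!move->.
apply: etrans (curvature_vnabla sub lc umbilic p bX bY bZ) _.
apply: etrans (esym (curvature_vnabla sub lc umbilic q bX bY bZ)).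
have aa U V W : basic U -> basic V -> basic W ->
    ip p (vnabla U V p) (vnabla U W p) = ip q (vnabla U V q) (vnabla U W q).
  by move=> bU bV bW; exact: (vnabla_form_fibrewise sub lc R_constant bU bV bW pq).
have hh U : basic U -> ip p (H p) (U p) = ip q (H q) (U q).
  by move=> bU; exact: (basic_form_constant sub bH bU pq).
apply: (alg); try exact: hh; try (apply: aa => //; exact: (hnabla_basic sub lc)).
have nz : (2 : R) != 0 by rewrite pnatr_eq0.
apply: (mulfI nz); apply: etrans (esym (vapp_vnabla_norm p bX bY bZ)) _; apply: etrans (vapp_vnabla_norm q bX bY bZ).
apply: (vapp_basic_constant sub bZ) pq; last exact: (vnabla_norm_fibrewise sub lc R_constant bX bY).
by move=> x; exact: smooth_fun_at_metric.
Qed.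

(** For [Z = X], the relation [A_Y X = - A_X Y] makes the second mean curvature term equal to the
    first, and [A_X X = 0] removes the third. *)
Lemma curvature_vnabla_self X Y p : basic X -> basic Y ->
  ip p (curvature nabla X Y (vnabla X Y) p) (X p) =
    ip p (nabla X (vnabla X Y) p) (vnabla X Y p)
  - ip p (vnabla X (hnabla X Y) p) (vnabla X Y p) - ip p (vnabla Y (hnabla X X) p) (vnabla Y X p)
  - r%:R^-1 * (2 * ip p (vnabla X Y p) (vnabla X Y p) * ip p (H p) (X p)).
Proof.
move=> bX bY; apply: etrans (curvature_vnabla sub lc umbilic p bX bY bX) _.
have e1 : ip p (vnabla Y X p) (vnabla Y X p) = ip p (vnabla X Y p) (vnabla X Y p).
  by rewrite (vnabla_anti sub lc p bY bX) mxformNl mxformNr opprK.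
have e2 : ip p (vnabla X X p) (vnabla X Y p) = 0 by rewrite (vnabla_self sub lc p bX) mxform0l.
have alg (a b c k w w' v h i : R) : w' = w -> v = 0 ->
   a - b - c - k * (w * h + w' * h + v * i) = a - b - c - k * (2 * w * h).
  by move=> -> ->; ring.
exact: alg.
Qed.

Lemma mean_curvature_form_flat X p q : basic X -> prj p = prj q ->
  (forall Y x, basic Y -> prj x = prj q -> vnabla X Y x = 0) ->
  ip p (H p) (X p) = ip q (H q) (X q).
Proof.
move=> bX pq A0; have sX := basic_smooth bX.
have sf x : smooth_fun_at (fun y => ip y (H y) (X y)) x by exact: smooth_fun_at_metric.
suff flat x v : prj x = prj q -> tangent_map prj x v = 0 -> dfun (fun y => ip y (H y) (X y)) x v = 0.
  exact: (fibre_constant (submersion_smooth sub) (submersion_onto sub) (@conn (prj q)) sf flat pq erefl).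
move=> xq v0; have vV : (v <= vertical x)%MS by apply/verticalP.
have [V [sV vVV Vx]] := vertical_through sub vV.
rewrite -Vx; apply: etrans (vapp_form lc x sV H_smooth sX) _.
have hH := mean_curvature_horizontal x.
rewrite -(form_hproj sub _ (basic_horizontal x bX)) (H_parallel openT sV vVV I) mxform0l add0r metricC.
rewrite -(nabla_basic_vertical sub lc bX sV vVV hH).
(* Only the value of [H] at [x] matters from here on, so it is replaced by a basic field [Y] with
   that value. This turns [g (nabla_X V) H] into [- g V (A_X Y)], to which the assumption applies,
   although [H] is not yet known to be basic. *)
have [Y bY Yx] := basic_through sub hH.
rewrite -Yx metricC; apply/eqP; rewrite -oppr_eq0; apply/eqP.
apply: etrans (esym (form_nabla_horizontal lc x (basic_smooth bY) sV vVV (fun z => basic_horizontal z bY) sX)) _.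
by rewrite -(vnabla_form sub _ _ (vVV x I)) (A0 Y x bY xq) mxform0l.
Qed.

Lemma mean_curvature_basic :
  (forall X Y, basic X -> basic Y -> basic (hpart g prj (curvature nabla X Y (oneillA g prj nabla X Y)))) ->
  basic H.
Proof.
(* Everything except the product with [H] agrees at the two points; cancelling the common nonzero
   factor [2 k w] leaves [h = h']. *)
have alg (a a' b b' c c' k w w' h h' : R) : k != 0 -> w != 0 ->
    a - b - c - k * (2 * w * h) = a' - b' - c' - k * (2 * w' * h') ->
    b = b' -> c = c' -> 2 * a = 2 * a' -> w = w' -> h = h'.
  move=> k0 w0 E eb ec ea ew; have kw : k * (2 * w) != 0 by rewrite !mulf_neq0// pnatr_eq0.
  by apply: (mulfI kw); move: E ea; rewrite -eb -ec -ew; lra.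
move=> bR; apply: (basicP sub) => //; first by move=> p _; exact: mean_curvature_horizontal.
move=> X bX p q pq.
have [[Y bY nA]|noY] := pselect (exists2 Y, basic Y & ip p (vnabla X Y p) (vnabla X Y p) != 0); last first.
  (* The case distinction looks at the point [p] only; since [|A_X Y|^2] is fibrewise, its vanishing
     there for every basic [Y] spreads over the whole fibre. *)
  apply: mean_curvature_form_flat => // Y x bY xq; apply: anisotropic; first exact: vnabla_vertical.
  have -> : ip x (vnabla X Y x) (vnabla X Y x) = ip p (vnabla X Y p) (vnabla X Y p).
    by apply: (vnabla_norm_fibrewise sub lc R_constant bX bY); rewrite xq.
  by apply/eqP; apply: contraPT noY => nA; case; exists Y.
have nrm := vnabla_norm_fibrewise sub lc R_constant bX bY pq.
have {}bR := bR X Y bX bY; rewrite (oneillA_basic bX bY) in bR.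
have e : ip p (curvature nabla X Y (vnabla X Y) p) (X p) = ip q (curvature nabla X Y (vnabla X Y) q) (X q).
  exact: (hpart_form_fibrewise bR bX pq).
have {}e := etrans (esym (curvature_vnabla_self p bX bY)) (etrans e (curvature_vnabla_self q bX bY)).
have aa U V W : basic U -> basic V -> basic W ->
    ip p (vnabla U V p) (vnabla U W p) = ip q (vnabla U V q) (vnabla U W q).
  by move=> bU bV bW; exact: (vnabla_form_fibrewise sub lc R_constant bU bV bW pq).
have e1 := aa X (hnabla X Y) Y bX (hnabla_basic sub lc bX bY) bY.
have e2 := aa Y (hnabla X X) X bY (hnabla_basic sub lc bX bX) bX.
have e3 : 2 * ip p (nabla X (vnabla X Y) p) (vnabla X Y p) = 2 * ip q (nabla X (vnabla X Y) q) (vnabla X Y q).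
  apply: etrans (esym (vapp_vnabla_norm p bX bY bX)) _; apply: etrans (vapp_vnabla_norm q bX bY bX).
  apply: (vapp_basic_constant sub bX) pq; last exact: (vnabla_norm_fibrewise sub lc R_constant bX bY).
  have sA := smooth_vnabla sub lc (basic_smooth bX) (basic_smooth bY).
  by move=> x; exact: smooth_fun_at_metric.
apply: alg e e1 e2 e3 nrm => //; by rewrite invr_eq0 r_neq0.
Qed.

End MeanCurvature.

Theorem theorem3p8 (R : realType) (m n r s s' : nat)
    (M : manifold R m) (B : manifold R n) (g : metric M) (g' : metric B)
    (pi : M -> B) (nabla : vfield M -> vfield M -> vfield M) (H : vfield M)
    (dim_fibres : m = (n + r)%N) (r_gt0 : (0 < r)%N)
    (submersion_pi : semi_riemannian_submersion g g' pi)
    (fibres_connected : forall b : B, connected (pi @^-1` [set b]))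
    (nabla_lc : levi_civita g nabla)
    (H_mean : mean_curvature g pi nabla r H)
    (umbilic : totally_umbilic_fibres g pi nabla r H)
    (index_M : has_index g s) (index_B : has_index g' s')
    (R_constant : forall X Y : vfield M, basic g pi X -> basic g pi Y ->
       constant_along_fibres pi (curvature4 g nabla X Y X Y))
    (H_parallel : parallel_along_fibres g pi nabla H)
    (index_fibres : s = s' \/ s = (s' + r)%N) :
  basic g pi H <->
  (forall X Y : vfield M, basic g pi X -> basic g pi Y ->
     basic g pi
       (hpart g pi (curvature nabla X Y (oneillA g pi nabla X Y)))).
Proof.
have [sH _] := H_mean; split.
  by move=> bH X Y bX bY; exact: (curvature_vnabla_basic submersion_pi nabla_lc umbilic R_constant bX bY bH).
exact: (mean_curvature_basic dim_fibres r_gt0 submersion_pi fibres_connected nabla_lc sH umbilic index_M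
  index_B R_constant H_parallel index_fibres).
Qed.
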